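(* Let $\theta\in(0,1)$ and suppose the urn probabilities satisfy $p_i=i^{-1/\theta}L_0(i,\theta)$, where $L_0(i,\theta)$ is a slowly varying function of $i$ as $i\to\infty$. Let $k\ge1$ be an integer. If $$\frac{(k-\theta)\,\mathbf{E} R_{n,k}-(k+1)\,\mathbf{E} R_{n,k+1}}{\sqrt{\alpha(n)}}\to0\quad\text{as } n\to\infty,$$ then, as $n\to\infty$, $$\sqrt{R_{n,k}}\left(\frac{kR_{n,k}-(k+1)R_{n,k+1}}{R_{n,k}}-\theta\right)\Rightarrow\mathbf{N}_{0,\sigma_k^2},$$ $$\sigma_k^2=(k-\theta)(2k+1-\theta)-\frac{2k-\theta+\theta^2}{k\,2^{2k+2-\theta}\,\mathrm{B}(k-\theta,k)},$$ where $\mathrm{B}$ is the Beta function.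
   Context: Infinite urn scheme: there are infinitely many urns $i=1,2,\ldots$ with probabilities $p_1\ge p_2\ge\cdots>0$, $\sum_i p_i=1$. Each of $n$ balls is independently placed in urn $i$ with probability $p_i$. $J_i(n)$ is the number of balls in urn $i$ after $n$ balls. $R_{n,k}=\sum_{i\ge1}\mathbf{I}\{J_i(n)=k\}$ is the number of urns with exactly $k$ balls. $\alpha(x)=\max\{j\mid p_j\ge1/x\}$ (equal to $0$ if there is no such $j$). $\Rightarrow\mathbf{N}_{0,\sigma^2}$ denotes weak convergence to the normal law with mean $0$ and variance $\sigma^2$. *)

(* Defs.v *)
From HB Require Import structures.
From mathcomp Require Export all_boot all_order all_algebra.
From mathcomp Require Export all_classical all_reals all_analysis.

Set Implicit Arguments.
Unset Strict Implicit.
Unset Printing Implicit Defensive.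

Export Order.TTheory GRing.Theory Num.Theory.
Export numFieldNormedType.Exports.

Local Open Scope classical_set_scope.
Local Open Scope ring_scope.

Definition slowly_varying (R : realType) (L : R -> R) : Prop :=
  exists a : R,
    [/\ measurable_fun `[a, +oo[ L,
        forall x, a <= x -> 0 < L x
      & forall c, 0 < c -> L (c * x) / L x @[x --> +oo] --> (1 : R)].

Definition mutually_independent (R : realType) (d d' : measure_display)
    (T : measurableType d) (U : measurableType d') (P : probability T R)
    (I : choiceType) (X : I -> {RV P >-> U}) : Prop :=
  forall (J : seq I) (A : I -> set U),
    uniq J -> (forall j, measurable (A j)) ->
    P (\bigcap_(j in [set` J]) X j @^-1` A j)
      = (\prod_(j <- J) P (X j @^-1` A j))%E.

Definition weak_cvg (R : realType) (d : measure_display)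
    (T : measurableType d) (P : probability T R) (Z : nat -> T -> R)
    (mu : probability (measurableTypeR R) R) : Prop :=
  forall f : R -> R, continuous f -> (exists M, forall x, `|f x| <= M) ->
    ('E_P[f \o Z n] @[n --> \oo] --> \int[mu]_x (f x)%:E)%E.

(* Urns are numbered from 1, so values at index 0 are never used; [X j] is the
   urn receiving ball number j+1. *)
Section urn_scheme.
Variables (R : realType) (T : Type).
Implicit Types (p : nat -> R) (X : nat -> T -> nat).

(* The set of such j is finite for x > 0 when [p] is summable. The big operator
   returns 0 on the empty set. *)
Definition urn_alpha p (x : R) : nat :=
  \big[maxn/0%N]_(j \in [set j : nat | (1 <= j)%N /\ x^-1 <= p j]) j.

Definition urn_load X (n i : nat) (w : T) : nat :=
  (\sum_(j < n) (X j w == i))%N.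

(* For k >= 1 at most n summands are nonzero. For k = 0 the support is infinite
   and the finitely supported sum would return the junk value 0. *)
Definition urn_occ X (n k : nat) (w : T) : R :=
  \sum_(i \in [set i : nat | (1 <= i)%N]) ((urn_load X n i w == k)%:R : R).

End urn_scheme.
Arguments urn_occ R {T} X n k w.

(* The library's [beta_fun] only takes natural arguments. *)
Definition euler_beta (R : realType) (a b : R) : R :=
  \int[lebesgue_measure]_(t in `]0, 1[) (t `^ (a - 1) * (1 - t) `^ (b - 1)).

Definition urn_sigma2 (R : realType) (theta : R) (k : nat) : R :=
  (k%:R - theta) * (2 * k%:R + 1 - theta)
  - (2 * k%:R - theta + theta ^+ 2)
    / (k%:R * 2 `^ (2 * k%:R + 2 - theta) * euler_beta (k%:R - theta) k%:R).

(* Main.v *)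
From HB Require Import structures.
Require Import Defs.
From mathcomp Require Import ring lra zify.
From mathcomp Require Import measurable_realfun.

Set Implicit Arguments.
Unset Strict Implicit.
Unset Printing Implicit Defensive.

Local Open Scope classical_set_scope.
Local Open Scope ring_scope.

(** Put c0 = k - theta and c1 = -(k+1). Where R_{n,k} > 0 the statistic equals (c0 R_{n,k} + c1
    R_{n,k+1}) / sqrt(R_{n,k}), and its numerator is a sum over the urns of g(J_i(n)), where g is c0
    at k, c1 at k+1 and 0 elsewhere. The bias hypothesis says that the mean of the numerator is
    o(sqrt(alpha(n))). So two facts suffice: R_{n,k} / (A alpha(n)) tends to 1 in probability
    ([urn_lln]), and the centred numerator divided by sqrt(A alpha(n)) is asymptotically normal with
    variance sigma_k^2. [urn_weak_cvg] combines them.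

    Asymptotics of sums. With rho = 1/theta, the urn of index about c alpha(n) has n p_i close to
    c^(-rho). Hence a sum over urns of h_n(n p_i), divided by alpha(n), is a Riemann sum for the
    integral of h(c^(-rho)) over c > 0; a Potter-type bound gives domination ([urn_sum_dct]). Single
    loads become Poisson in the limit, so the means and variances lead to the integrals [gint].
    Their recursion and scaling rules ([gint_rec], [gint_scale]) identify the limiting variance as A
    sigma_k^2 ([two_values_var]).

    Normal limit. The number n of balls is fixed, so the loads are dependent, and Stein's method is
    applied to the multinomial loads themselves. Given that one urn holds j balls, the other n - j
    balls fall independently into the other urns ([multE_split]). A smooth function of the remaining
    sum barely notices the loss of j balls: a ball matters only if it lands in an urn with few
    balls, and the total probability of doing so tends to 0 ([small_mass_cvg0]). Each centred term
    is therefore almost uncorrelated with smooth functions of the others ([multE_cov]), and a Taylor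
    expansion gives Stein's identity with the sum of the individual variances ([stein_multinomial]).
    Solving Stein's equation for smooth test functions ([stein_solution]) and approximating
    continuous ones ([mollify]) turns this into weak convergence ([stein_weak_cvg]).

    Truncation. For each n only the first M n urns are kept, with M n >= n^2 and so large that all n
    balls fall among them with probability at least 1 - 1/n and the mean occupancies move by at most
    1. [Rexp_load] identifies expectations on the probability space with the recursive multinomial
    expectation [multE]. *)

(** * Expectations of functions of multinomial loads, by recursion on the balls *)

Section multinomial_expectation.
Variables (R : realType) (U : finType).
Implicit Types (q : U -> R) (r : R) (J : U -> nat) (F G : (U -> nat) -> R).

Definition subprob q r := [/\ forall u, 0 <= q u, 0 <= r & r + \sum_u q u = 1].

Definition add_ball (u : U) J : U -> nat := fun v => ((u == v) + J v)%N.

(* [r] is the probability that a ball misses all the urns of [U]. *)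
Fixpoint multE q r n F : R :=
  if n is m.+1 then
    r * multE q r m F + \sum_u q u * multE q r m (F \o add_ball u)
  else F (fun=> 0%N).

Lemma multE_lin q r n a F G :
  multE q r n (fun J => a * F J + G J) = a * multE q r n F + multE q r n G.
Proof.
elim: n F G => [//|n IH] F G /=.
rewrite IH mulrDr mulrDr [a * (r * _)]mulrCA addrACA; congr (_ + _).
rewrite mulr_sumr -big_split/=; apply: eq_bigr => u _.
by rewrite [multE _ _ _ _](IH (F \o add_ball u) (G \o add_ball u)); ring.
Qed.

Lemma multE0 q r n : multE q r n (fun=> 0) = 0.
Proof.
have := multE_lin q r n (-1) (fun=> 0) (fun=> 0).
by rewrite [in LHS]mulr0 addr0 mulN1r addNr.
Qed.

Lemma multED q r n F G :
  multE q r n (fun J => F J + G J) = multE q r n F + multE q r n G.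
Proof.
by rewrite -[X in _ = X + _]mul1r -multE_lin; congr multE; apply/funext => J; rewrite mul1r.
Qed.

Lemma multEZ q r n a F : multE q r n (fun J => a * F J) = a * multE q r n F.
Proof.
rewrite -[RHS]addr0 -(multE0 q r n) -multE_lin.
by congr multE; apply/funext => J; rewrite addr0.
Qed.

Lemma multEB q r n F G :
  multE q r n (fun J => F J - G J) = multE q r n F - multE q r n G.
Proof.
by rewrite multED -[X in _ = _ + X]mulN1r -multEZ; congr (_ + multE _ _ _ _);
  apply/funext => J; rewrite mulN1r.
Qed.

Lemma multE_sum q r n (I : finType) (F : I -> (U -> nat) -> R) :
  multE q r n (fun J => \sum_i F i J) = \sum_i multE q r n (F i).
Proof.
have -> : (fun J => \sum_i F i J) = \sum_i F i.
  by apply/funext => J; rewrite fct_sumE.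
apply: (big_morph (multE q r n)); last by exact: multE0.
by move=> A B; rewrite -multED.
Qed.

Section weights.
Variables (q : U -> R) (r : R).
Hypothesis qr : subprob q r.

Lemma multE_ge0 n F : (forall J, 0 <= F J) -> 0 <= multE q r n F.
Proof.
case: qr => q0 r0 _; elim: n F => [|n IH] F F0 //=.
rewrite addr_ge0 ?mulr_ge0 ?IH//; apply: sumr_ge0 => u _.
by rewrite mulr_ge0// IH// => J; exact: F0.
Qed.

Lemma multE_le n F G : (forall J, F J <= G J) -> multE q r n F <= multE q r n G.
Proof.
move=> FG; rewrite -subr_ge0 -multEB; apply: multE_ge0 => J.
by rewrite subr_ge0.
Qed.

Lemma multE_cst n c : multE q r n (fun=> c) = c.
Proof.
case: qr => _ _ qr1; elim: n => //= n IH.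
rewrite IH (eq_bigr (fun u => q u * c)) => [|u _]; last by congr (_ * _); exact: IH.
by rewrite -mulr_suml -mulrDl qr1 mul1r.
Qed.

Lemma multE_norm n F : `|multE q r n F| <= multE q r n (fun J => `|F J|).
Proof.
rewrite ler_norml; apply/andP; split; last by apply: multE_le => J; exact: ler_norm.
rewrite -mulN1r -multEZ; apply: multE_le => J.
by rewrite mulN1r lerNl -normrN ler_norm.
Qed.

Lemma multE_bound n F c : (forall J, `|F J| <= c) -> `|multE q r n F| <= c.
Proof. by move=> Fc; rewrite (le_trans (multE_norm _ _))// -[leRHS](multE_cst n) multE_le. Qed.

Lemma subprob_le1 u : q u <= 1.
Proof.
case: qr => q0 r0 <-; rewrite (bigD1 u)//= addrCA lerDl addr_ge0//.
by apply: sumr_ge0.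
Qed.

End weights.
End multinomial_expectation.

(** * Binomial expectations, by recursion on the trials *)

Section binomial_expectation.
Variable R : realType.
Implicit Types (p : R) (f g : nat -> nat -> R).

(** The second argument of [f] counts failures: after conditioning on one urn it is the number of
    balls left for the others, available without subtraction. *)
Fixpoint binE p n f : R :=
  if n is m.+1 then
    p * binE p m (fun i j => f i.+1 j) + (1 - p) * binE p m (fun i j => f i j.+1)
  else f 0%N 0%N.

Lemma binE_lin p n a f g :
  binE p n (fun i j => a * f i j + g i j) = a * binE p n f + binE p n g.
Proof. by elim: n f g => [//|n IH] f g /=; rewrite !IH; ring. Qed.

Lemma binE0 p n : binE p n (fun _ _ => 0) = 0.
Proof. by elim: n => //= n ->; rewrite !mulr0 addr0. Qed.

Lemma binEZ p n a f : binE p n (fun i j => a * f i j) = a * binE p n f.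
Proof. by elim: n f => [//|n IH] f /=; rewrite !IH; ring. Qed.

Lemma binED p n f g :
  binE p n (fun i j => f i j + g i j) = binE p n f + binE p n g.
Proof. by elim: n f g => [//|n IH] f g /=; rewrite !IH; ring. Qed.

Lemma binEB p n f g :
  binE p n (fun i j => f i j - g i j) = binE p n f - binE p n g.
Proof. by elim: n f g => [//|n IH] f g /=; rewrite !IH; ring. Qed.

Lemma binE_cst p n c : binE p n (fun _ _ => c) = c.
Proof. by elim: n => //= n ->; ring. Qed.

Lemma binE_le p n f g : 0 <= p <= 1 ->
  (forall i j, (i + j)%N = n -> f i j <= g i j) -> binE p n f <= binE p n g.
Proof.
move=> p01; elim: n f g => [|n IH] f g fg /=; first by rewrite fg.
by rewrite lerD// ler_wpM2l ?subr_ge0 ?(andP p01).1 ?(andP p01).2//; apply: IH => i j ijn;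
  rewrite fg// ?addSn ?addnS ijn.
Qed.

Lemma eq_binE p n f g :
  (forall i j, (i + j)%N = n -> f i j = g i j) -> binE p n f = binE p n g.
Proof.
elim: n f g => [|n IH] f g fg /=; first by rewrite fg.
by congr (_ * _ + _ * _); apply: IH => i j ijn; rewrite fg// ?addSn ?addnS ijn.
Qed.

Lemma binE_norm p n f : 0 <= p <= 1 ->
  `|binE p n f| <= binE p n (fun i j => `|f i j|).
Proof.
move=> p01; rewrite ler_norml; apply/andP; split; last first.
  by apply: binE_le => // i j _; exact: ler_norm.
rewrite -mulN1r -binEZ; apply: binE_le => // i j _.
by rewrite mulN1r lerNl -normrN ler_norm.
Qed.

Lemma binE_id p n : binE p n (fun i _ => i%:R) = n%:R * p.
Proof.
elim: n => [|n IH] /=; first by rewrite mul0r.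
rewrite (eq_binE _ (g := fun i _ => 1 + i%:R)) => [|i j _]; last by rewrite -natr1 addrC.
by rewrite binED binE_cst IH -natr1; ring.
Qed.

Lemma binE_exp p n a : binE p n (fun i _ => a ^+ i) = (1 - p + a * p) ^+ n.
Proof.
elim: n => [//|n IH] /=.
rewrite (eq_binE _ (g := fun i _ => a * a ^+ i)) => [|i j _]; last by rewrite exprS.
by rewrite binEZ IH exprS; ring.
Qed.

Lemma binE_pmf p n k : binE p n (fun i _ => (i == k)%:R) =
  'C(n, k)%:R * p ^+ k * (1 - p) ^+ (n - k).
Proof.
elim: n k => [|n IH] [|k] /=.
- by rewrite bin0 !expr0 !mulr1.
- by rewrite bin0n !mul0r.
- rewrite (eq_binE _ (g := fun _ _ => 0)) // binE0 IH !bin0 !subn0 exprS; ring.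
rewrite (eq_binE _ (g := fun i _ => (i == k)%:R)) // !IH binS natrD subSS.
have [kn|nk] := ltnP k n.
  by rewrite -(subnSK kn) !exprS; ring.
by rewrite (bin_small (m := k.+1)) ?ltnS// exprS; ring.
Qed.

End binomial_expectation.

Lemma binE_sum (R : realType) (p : R) n (I : finType) (f : I -> nat -> nat -> R) :
  binE p n (fun i j => \sum_k f k i j) = \sum_k binE p n (f k).
Proof. by elim: n f => [//|n IH] f /=; rewrite !IH !mulr_sumr big_split. Qed.

(** * Conditioning on the load of one urn *)

Section conditioning.
Variables (R : realType) (U : finType) (q : U -> R) (r : R) (i : U).
Hypothesis qr : subprob q r.

(** All balls that avoid urn [i], inside [U] or not, merge into one failure of probability
    [1 - q i]. *)
Lemma multE_urn n (phi : nat -> R) :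
  multE q r n (fun J => phi (J i)) = binE (q i) n (fun j _ => phi j).
Proof.
case: qr => _ _ qr1; elim: n phi => [//|n IH] phi /=.
rewrite (bigD1 i)//= (eq_bigr (fun u => q u * multE q r n (fun J => phi (J i)))).
  rewrite -mulr_suml IH (_ : _ \o _ = (fun J => phi (J i).+1)); last first.
    by apply/funext => J /=; rewrite /add_ball eqxx.
  have -> : 1 - q i = r + \sum_(u | u != i) q u by rewrite -qr1 (bigD1 i)//=; ring.
  by rewrite (IH (phi \o S))/=; ring.
move=> u ui; congr (_ * multE _ _ _ _); apply/funext => J /=.
by rewrite /add_ball (negbTE ui).
Qed.

End conditioning.

Section removal.
Variables (R : realType) (U : finType) (q : U -> R) (r : R).
Hypothesis qr : subprob q r.

Lemma subprob_ge0_le1 u : 0 <= q u <= 1.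
Proof. by case: (qr) => q0 _ _; rewrite q0 (subprob_le1 qr). Qed.

(** Condition on the urn u of the extra ball. It changes [F] only if u holds at most l balls, and
    that indicator is at most 2^l 2^(-J u), whose mean is 2^l (1 - q u / 2)^m. *)
Lemma multE_incr m (L : R) l (F : (U -> nat) -> R) : 0 <= L ->
  (forall u J, `|F (add_ball u J) - F J| <= L * (J u <= l)%N%:R) ->
  `|multE q r m.+1 F - multE q r m F| <=
    L * 2 ^+ l * \sum_u q u * (1 - q u / 2) ^+ m.
Proof.
move=> L0 FL; case: (qr) => q0 _ qr1.
have -> : multE q r m.+1 F - multE q r m F =
    \sum_u q u * multE q r m (fun J => F (add_ball u J) - F J).
  rewrite /= -[X in _ - X]mul1r -qr1 mulrDl opprD addrACA subrr add0r mulr_suml.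
  by rewrite -sumrB; apply: eq_bigr => u _; rewrite multEB mulrBr.
rewrite (le_trans (ler_norm_sum _ _ _))// mulr_sumr; apply: ler_sum => u _.
rewrite normrM (ger0_norm (q0 u)) mulrCA ler_wpM2l//.
rewrite (le_trans (multE_norm qr _ _))//.
apply: (@le_trans _ _ (multE q r m (fun J => L * 2 ^+ l * 2^-1 ^+ (J u)))).
  apply: multE_le => // J; rewrite (le_trans (FL u J))// -mulrA ler_wpM2l//.
  case: leqP => Jl; last by rewrite mulr_ge0// exprn_ge0.
  rewrite exprVn; apply: (@le_trans _ _ (2 ^+ J u / 2 ^+ J u)).
    by rewrite divff// expf_neq0.
  by rewrite ler_wpM2r ?invr_ge0 ?exprn_ge0// ler_weXn2l// ler1n.
rewrite multEZ (multE_urn u qr m (fun j => 2^-1 ^+ j)) binE_exp.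
by rewrite (_ : 1 - q u + 2^-1 * q u = 1 - q u / 2)//; field.
Qed.

(** The law of a ball known to avoid urn [i]. The urn stays in [U] with weight 0, so the type of
    load vectors does not change. *)
Definition rem_urn i u := if u == i then 0 else q u / (1 - q i).

Section removed_urn.
Variable i : U.
Hypothesis qi1 : q i < 1.
Local Notation q' := (rem_urn i).
Local Notation r' := (r / (1 - q i)).

Lemma subprob_rem : subprob q' r'.
Proof.
case: (qr) => q0 r0 qr1; have q1 : 0 < 1 - q i by rewrite subr_gt0.
split; first by move=> u; rewrite /rem_urn; case: eqP => // _; rewrite divr_ge0// ltW.
  by rewrite divr_ge0// ltW.
rewrite (bigD1 i)//= {1}/rem_urn eqxx add0r.
rewrite (eq_bigr (fun u => q u / (1 - q i))); last first.
  by move=> u ui; rewrite /rem_urn (negbTE ui).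
rewrite -mulr_suml -mulrDl -[X in X / _](_ : 1 - q i = _).
  by rewrite divff// gt_eqF.
by rewrite -qr1 (bigD1 i)//=; ring.
Qed.

Lemma add_ballC (u v : U) J : add_ball u (add_ball v J) = add_ball v (add_ball u J).
Proof. by apply/funext => w; rewrite /add_ball addnCA. Qed.

(** Given that urn [i] holds j balls, the other m = n - j balls are independent with the law
    [rem_urn]. The hypothesis says that [F] ignores the load of [i]; the induction places one
    ball. *)
Lemma multE_split n (phi : nat -> R) F : (forall J, F (add_ball i J) = F J) ->
  multE q r n (fun J => phi (J i) * F J) =
  binE (q i) n (fun j m => phi j * multE q' r' m F).
Proof.
have q1 : 1 - q i != 0 by rewrite subr_eq0 gt_eqF.
elim: n phi F => [//|n IH] phi F Fi.
pose B u := binE (q i) n (fun j m => phi j * multE q' r' m (F \o add_ball u)).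
have -> : multE q r n.+1 (fun J => phi (J i) * F J) =
    r * binE (q i) n (fun j m => phi j * multE q' r' m F)
    + (q i * binE (q i) n (fun j m => phi j.+1 * multE q' r' m F)
    + \sum_(u | u != i) q u * B u).
  rewrite /= IH//; congr (_ + _); rewrite (bigD1 i)//=; congr (_ * _ + _).
    rewrite -(IH (phi \o S))//; congr multE; apply/funext => J /=.
    by rewrite Fi /add_ball eqxx.
  apply: eq_bigr => u ui; rewrite /B -IH; last first.
    by move=> J /=; rewrite add_ballC Fi.
  congr (_ * multE _ _ _ _); apply/funext => J /=.
  by rewrite /add_ball (negbTE ui).
have -> : binE (q i) n.+1 (fun j m => phi j * multE q' r' m F) =
    q i * binE (q i) n (fun j m => phi j.+1 * multE q' r' m F) +
    (1 - q i) * (r' * binE (q i) n (fun j m => phi j * multE q' r' m F) +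
      \sum_u q' u * B u).
  rewrite [LHS]/=; congr (_ + _ * _).
  rewrite (eq_binE _ (g := fun j m => r' * (phi j * multE q' r' m F) +
     \sum_u q' u * (phi j * multE q' r' m (F \o add_ball u)))); last first.
    move=> j m _; rewrite mulrDr mulr_sumr mulrCA.
    by congr (_ + _); apply: eq_bigr => u _; rewrite mulrCA.
  rewrite binED binEZ binE_sum; congr (_ + _); apply: eq_bigr => u _.
  exact: binEZ.
rewrite addrCA; congr (_ + _); rewrite mulrDr mulrA mulrCA divff// mulr1.
congr (_ + _); rewrite [in RHS](bigD1 i)//= {1}/rem_urn eqxx mul0r add0r.
rewrite mulr_sumr; apply: eq_bigr => u ui; rewrite /rem_urn (negbTE ui) mulrA.
by rewrite mulrCA divff// mulr1.
Qed.

(** Given the load j of urn [i], the mean of [F] is within j kappa of its value for n balls. In the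
    mean of the product only loads j <= l count, which gives the term [l%:R]; in the product of the
    means the drift averages to kappa E[J i], which gives [n%:R * q i]. *)
Lemma multE_cov n (phi : nat -> R) F l (kappa : R) : 0 <= kappa ->
  (forall J, F (add_ball i J) = F J) ->
  (forall j, phi j != 0 -> (j <= l)%N) ->
  (forall j, (j <= n)%N ->
    `|multE q' r' (n - j) F - multE q' r' n F| <= j%:R * kappa) ->
  `|multE q r n (fun J => phi (J i) * F J)
    - multE q r n (fun J => phi (J i)) * multE q r n F|
  <= kappa * (binE (q i) n (fun j _ => `|phi j|) * (l%:R + n%:R * q i)).
Proof.
move=> k0 Fi phil Ak; have q01 := subprob_ge0_le1 i.
set A := fun m => multE q' r' m F.
have EF : multE q r n F = binE (q i) n (fun _ m => A m).
  transitivity (multE q r n (fun J => 1 * F J)).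
    by congr multE; apply/funext => J; rewrite mul1r.
  rewrite (multE_split n (fun=> 1) Fi); apply: eq_binE => j m _.
  by rewrite mul1r.
rewrite (multE_split n phi Fi) EF multE_urn//.
set B := binE (q i) n (fun j _ => phi j).
(* A covariance is unchanged when the constant [A n] is subtracted from the second factor. *)
have -> : binE (q i) n (fun j m => phi j * A m) - B * binE (q i) n (fun _ m => A m)
  = binE (q i) n (fun j m => phi j * (A m - A n))
    - B * binE (q i) n (fun _ m => A m - A n).
  have e1 : binE (q i) n (fun j m => phi j * (A m - A n)) =
      binE (q i) n (fun j m => phi j * A m) - B * A n.
    rewrite mulrC -binEZ -binEB; apply: eq_binE => j m _; ring.
  by rewrite e1 binEB binE_cst; ring.
have Ad j m : (j + m)%N = n -> `|A m - A n| <= j%:R * kappa.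
  by move=> jmn; have := Ak j; rewrite -jmn leq_addr addKn; exact.
have le1 : `|binE (q i) n (fun j m => phi j * (A m - A n))| <=
    kappa * (binE (q i) n (fun j _ => `|phi j|) * l%:R).
  rewrite mulrCA mulrC -binEZ (le_trans (binE_norm _ _ q01))//.
  apply: binE_le => // j m jmn; rewrite normrM mulrC.
  have [->|/phil jl] := eqVneq (phi j) 0; first by rewrite normr0 !mulr0.
  rewrite ler_wpM2r// (le_trans (Ad _ _ jmn))// mulrC ler_wpM2l//.
  by rewrite ler_nat.
have le2 : `|B * binE (q i) n (fun _ m => A m - A n)| <=
    kappa * (binE (q i) n (fun j _ => `|phi j|) * (n%:R * q i)).
  rewrite normrM mulrCA; apply: ler_pM => //; first exact: binE_norm.
  rewrite -binE_id -binEZ (le_trans (binE_norm _ _ q01))//.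
  by apply: binE_le => // j m jmn; rewrite mulrC Ad.
by rewrite (le_trans (ler_normB _ _))// !mulrDr lerD.
Qed.

End removed_urn.

(** The mean of 2^(-J u) over the urn u hit by a fresh ball. Times 2^l, it bounds the probability
    that ball m+1 lands in an urn holding at most l balls. *)
Definition small_mass m := \sum_u q u * (1 - q u / 2) ^+ m.

Lemma small_mass_term u m : 0 <= (1 - q u / 2) ^+ m <= 1.
Proof.
have /andP[q0 q1] := subprob_ge0_le1 u.
by rewrite exprn_ge0 ?exprn_ile1//; lra.
Qed.

Lemma small_mass_ge0 m : 0 <= small_mass m.
Proof.
apply: sumr_ge0 => u _.
by rewrite mulr_ge0 ?(andP (subprob_ge0_le1 u)).1 ?(andP (small_mass_term u m)).1.
Qed.

Lemma le_small_mass m n : (m <= n)%N -> small_mass n <= small_mass m.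
Proof.
move=> mn; apply: ler_sum => u _; have /andP[q0 q1] := subprob_ge0_le1 u.
rewrite ler_wpM2l// ler_wiXn2l//; lra.
Qed.

Lemma small_mass_rem i m : q i < 1 ->
  \sum_u rem_urn i u * (1 - rem_urn i u / 2) ^+ m <= small_mass m / (1 - q i).
Proof.
move=> qi1; rewrite mulr_suml; apply: ler_sum => u _; rewrite /rem_urn.
have /andP[q0 q1] := subprob_ge0_le1 u.
have q1i : 0 < 1 - q i by rewrite subr_gt0.
case: eqP => ui.
  by rewrite mul0r divr_ge0 ?mulr_ge0 ?(andP (small_mass_term u m)).1// ltW.
rewrite [leLHS]mulrAC ler_wpM2r ?invr_ge0 ?(ltW q1i)// ler_wpM2l// lerXn2r ?nnegrE//.
- by have := subprob_le1 (subprob_rem qi1) u; rewrite /rem_urn (introF eqP ui) => h; lra.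
- lra.
- rewrite lerD2l lerN2 ler_wpM2r// ler_pdivlMr// ler_piMr//.
  by have := (andP (subprob_ge0_le1 i)).1; lra.
Qed.

End removal.

Lemma step_bound (R : realType) (A : nat -> R) n j (D : R) : (j <= n)%N ->
  (forall m, (n - j <= m)%N -> `|A m.+1 - A m| <= D) ->
  `|A (n - j)%N - A n| <= j%:R * D.
Proof.
elim: j => [|j IH] jn AD; first by rewrite subn0 subrr normr0 mul0r.
rewrite -(subrKA (A (n - j)%N)) -natr1 mulrDl mul1r addrC.
rewrite (le_trans (ler_normD _ _))// lerD ?IH//; [lia| |].
  by move=> m nm; rewrite AD//; lia.
by rewrite distrC -[X in A X - _](subnSK jn) AD.
Qed.

(** For j < n/2 all steps start from at least n/2 balls and cost [D] each. Otherwise the trivial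
    bound 2B is at most j (4B/n). *)
Lemma drift_bound (R : realType) (A : nat -> R) n j (D B : R) :
  (0 < n)%N -> (j <= n)%N ->
  (forall m, (n./2 <= m)%N -> `|A m.+1 - A m| <= D) ->
  (forall m, `|A m| <= B) ->
  `|A (n - j)%N - A n| <= j%:R * (D + 4 * B / n%:R).
Proof.
move=> n0 jn AD AB; have B0 : 0 <= B by rewrite (le_trans _ (AB 0%N)).
have D0 : 0 <= D by rewrite (le_trans (normr_ge0 _) (AD n _))// -divn2 leq_div.
have n0' : (0 : R) < n%:R by rewrite ltr0n.
rewrite mulrDr; have [jn2|jn2] := leqP n (2 * j).
  apply: (@le_trans _ _ (2 * B)).
    by rewrite (le_trans (ler_normB _ _))// mulr2n mulrDl !mul1r lerD.
  rewrite -[leLHS]add0r lerD ?mulr_ge0// mulrA ler_pdivlMr//.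
  have : (n%:R : R) <= 2 * j%:R by rewrite -natrM ler_nat.
  by move=> h; nra.
apply: (@le_trans _ _ (j%:R * D)); last first.
  by rewrite lerDl mulr_ge0// divr_ge0// mulr_ge0.
by apply: step_bound => // m nm; apply: AD; rewrite -divn2; lia.
Qed.

(** * Stein's method for a sum of bounded functions of the loads *)

Section urn_statistic.
Variables (R : realType) (U : finType) (q : U -> R) (r c G : R) (n l : nat).
Variable g : nat -> R.
Hypothesis qr : subprob q r.
Hypothesis c0 : 0 < c.
Hypothesis qc : forall u, q u <= 1 - c.
Hypothesis gG : forall j, `|g j| <= G.
Hypothesis gl : forall j, g j != 0 -> (j <= l)%N.
Hypothesis l0 : (0 < l)%N.
Hypothesis n0 : (0 < n)%N.
Implicit Types (u : U) (J : U -> nat).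

Definition urn_mean u := binE (q u) n (fun j _ => g j).
Definition urn_dev u j := g j - urn_mean u.
Definition urn_var u := binE (q u) n (fun j _ => urn_dev u j ^+ 2).
Definition urn_abs u := binE (q u) n (fun j _ => `|g j|).
Definition dev_sum J := \sum_u urn_dev u (J u).
Definition dev_sum' u J := \sum_(w | w != u) urn_dev w (J w).
(** The sum over urns of the factors that multiply [kappa] in [multE_cov] when [phi] is [g]. *)
Definition urn_weight := \sum_u urn_abs u * (l%:R + n%:R * q u).

Local Notation E := (multE q r n).
Local Notation E' u m := (multE (rem_urn q u) (r / (1 - q u)) m).

Lemma q_lt1 u : q u < 1.
Proof. by rewrite (le_lt_trans (qc u))// ltrBlDr ltrDl. Qed.

Lemma G_ge0 : 0 <= G.
Proof. exact: le_trans (normr_ge0 _) (gG 0%N). Qed.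

Lemma l_ge1 : 1 <= l%:R :> R.
Proof. by rewrite ler1n. Qed.

Lemma urn_abs_ge0 u : 0 <= urn_abs u.
Proof.
by rewrite -(binE_cst (q u) n 0); apply: binE_le => //; exact: (subprob_ge0_le1 qr).
Qed.

Lemma urn_abs_leG u : urn_abs u <= G.
Proof.
by rewrite -(binE_cst (q u) n G); apply: binE_le => //; exact: (subprob_ge0_le1 qr).
Qed.

Lemma urn_mean_le u : `|urn_mean u| <= urn_abs u.
Proof. by apply: binE_norm; exact: (subprob_ge0_le1 qr). Qed.

Lemma urn_mean_leG u : `|urn_mean u| <= G.
Proof. exact: le_trans (urn_mean_le u) (urn_abs_leG u). Qed.

Lemma urn_dev_le u j : `|urn_dev u j| <= 2 * G.
Proof.
have := gG j; have := urn_mean_leG u; rewrite /urn_dev !ler_norml.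
by move=> /andP[a1 a2] /andP[b1 b2]; apply/andP; split; lra.
Qed.

Lemma urn_varE u : urn_var u = binE (q u) n (fun j _ => g j ^+ 2) - urn_mean u ^+ 2.
Proof.
rewrite /urn_var (eq_binE _ (g := fun j _ =>
   (- (2 * urn_mean u)) * g j + (g j ^+ 2 + urn_mean u ^+ 2))); last first.
  by move=> j m _; rewrite /urn_dev; ring.
by rewrite binE_lin binED binE_cst -/(urn_mean u); ring.
Qed.

Lemma urn_var_ge0 u : 0 <= urn_var u.
Proof.
rewrite -(binE_cst (q u) n 0); apply: binE_le => [|j m _]; last exact: sqr_ge0.
exact: (subprob_ge0_le1 qr).
Qed.

Lemma urn_var_le u : urn_var u <= G * urn_abs u.
Proof.
rewrite urn_varE (@le_trans _ _ (binE (q u) n (fun j _ => g j ^+ 2)))//.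
  by rewrite lerBlDr lerDl sqr_ge0.
rewrite -binEZ; apply: binE_le => [|j m _]; first exact: (subprob_ge0_le1 qr).
by rewrite -real_normK ?num_real// expr2 ler_wpM2r.
Qed.

Lemma weight_ge1 u : 1 <= l%:R + n%:R * q u.
Proof.
have /andP[q0 _] := subprob_ge0_le1 qr u.
by rewrite (le_trans l_ge1)// lerDl mulr_ge0.
Qed.

Lemma urn_abs_le_weight : \sum_u urn_abs u <= urn_weight.
Proof. by apply: ler_sum => u _; rewrite ler_peMr ?urn_abs_ge0// weight_ge1. Qed.

Lemma urn_weight_ge0 : 0 <= urn_weight.
Proof. by apply: le_trans urn_abs_le_weight; apply: sumr_ge0 => u _; exact: urn_abs_ge0. Qed.

Lemma sum_urn_var_le : \sum_u urn_var u <= G * urn_weight.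
Proof.
apply: (@le_trans _ _ (\sum_u G * urn_abs u)).
  by apply: ler_sum => u _; exact: urn_var_le.
by rewrite -mulr_sumr ler_wpM2l ?G_ge0// urn_abs_le_weight.
Qed.

Lemma dev_sumE u J : dev_sum J = urn_dev u (J u) + dev_sum' u J.
Proof. by rewrite /dev_sum (bigD1 u). Qed.

Lemma dev_sum'_add_self u J : dev_sum' u (add_ball u J) = dev_sum' u J.
Proof. by apply: eq_bigr => w wu; rewrite /add_ball eq_sym (negbTE wu). Qed.

(** Only the term of urn w moves, and only through [g], since the centring does not depend on the
    loads. Above l balls [g] is 0 before and after the move. *)
Lemma dev_sum'_add u w J :
  `|dev_sum' u (add_ball w J) - dev_sum' u J| <= 2 * G * (J w <= l)%N%:R.
Proof.
have G0 := G_ge0.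
have [->|wu] := eqVneq w u.
  by rewrite dev_sum'_add_self subrr normr0 mulr_ge0// mulr_ge0.
rewrite /dev_sum' -sumrB (bigD1 w)//= big1 ?addr0 => [|i /andP[_ iw]]; last first.
  by rewrite /add_ball eq_sym (negbTE iw) subrr.
rewrite /add_ball eqxx /urn_dev opprB addrA subrK add1n.
case: leqP => Jl; last first.
  have z j : (l < j)%N -> g j = 0.
    by move=> lj; apply: contraTeq lj => /gl; rewrite -leqNgt.
  by rewrite !z ?subrr ?normr0 ?mulr_ge0// ltnW.
have := gG (J w); have := gG (J w).+1; rewrite mulr1 !ler_norml.
by move=> /andP[a1 a2] /andP[b1 b2]; apply/andP; split; lra.
Qed.

Lemma E_dev_mul u F : E (fun J => urn_dev u (J u) * F J) =
  E (fun J => g (J u) * F J) - E (fun J => g (J u)) * E F.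
Proof.
rewrite (multE_urn u qr n g) -/(urn_mean u) -multEZ -multEB.
by congr multE; apply/funext => J; rewrite /urn_dev mulrBl.
Qed.

(** [multE_cov] wants a function vanishing above l. The squared deviation does not vanish there, but
    it does once the constant [urn_mean u ^+ 2] is removed. *)
Lemma E_dev_sqr_mul u F :
  E (fun J => urn_dev u (J u) ^+ 2 * F J) - urn_var u * E F =
  E (fun J => (g (J u) ^+ 2 - 2 * urn_mean u * g (J u)) * F J) -
  E (fun J => g (J u) ^+ 2 - 2 * urn_mean u * g (J u)) * E F.
Proof.
have -> : E (fun J => urn_dev u (J u) ^+ 2 * F J) =
    E (fun J => (g (J u) ^+ 2 - 2 * urn_mean u * g (J u)) * F J)
    + urn_mean u ^+ 2 * E F.
  rewrite -multEZ -multED; congr multE; apply/funext => J; rewrite /urn_dev; ring.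
rewrite (multE_urn u qr n (fun j => g j ^+ 2 - 2 * urn_mean u * g j)).
by rewrite urn_varE binEB binEZ -/(urn_mean u); ring.
Qed.

Lemma multE_step (L : R) (F : (U -> nat) -> R) (q' : U -> R) r' m : subprob q' r' ->
  0 <= L -> (forall w J, `|F (add_ball w J) - F J| <= L) ->
  `|multE q' r' m.+1 F - multE q' r' m F| <= L.
Proof.
move=> q'r' L0 FL; have [q0 r0 qr1] := q'r'.
have -> : multE q' r' m.+1 F - multE q' r' m F =
    \sum_u q' u * multE q' r' m (fun J => F (add_ball u J) - F J).
  rewrite /= -[X in _ - X]mul1r -qr1 mulrDl opprD addrACA subrr add0r mulr_suml.
  by rewrite -sumrB; apply: eq_bigr => u _; rewrite multEB mulrBr.
rewrite (le_trans (ler_norm_sum _ _ _))// (@le_trans _ _ (\sum_u q' u * L))//.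
  apply: ler_sum => u _; rewrite normrM (ger0_norm (q0 u)) ler_wpM2l//.
  exact: multE_bound.
by rewrite -mulr_suml ler_piMl// -qr1 lerDr.
Qed.

(** A crude bound of the right order, for use with Chebyshev's inequality. The diagonal contributes
    at most [G * urn_weight]; the rest comes from [multE_cov] with kappa = 2G, since one ball moves
    [dev_sum'] by at most 2G. *)
Lemma dev_sum_variance : E (fun J => dev_sum J ^+ 2) <= 3 * G * urn_weight.
Proof.
have G0 := G_ge0.
have -> : E (fun J => dev_sum J ^+ 2) =
    \sum_u E (fun J => urn_dev u (J u) * dev_sum J).
  by rewrite -multE_sum; congr multE; apply/funext => J; rewrite expr2 {1}/dev_sum mulr_suml.
rewrite (_ : 3 * G * _ = G * urn_weight + 2 * G * urn_weight); last by ring.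
apply: (@le_trans _ _ (\sum_u (urn_var u + 2 * G * (urn_abs u * (l%:R + n%:R * q u))))).
  apply: ler_sum => u _.
  have -> : E (fun J => urn_dev u (J u) * dev_sum J) =
     urn_var u + E (fun J => urn_dev u (J u) * dev_sum' u J).
    rewrite /urn_var -(multE_urn u qr n (fun j => urn_dev u j ^+ 2)) -multED.
    by congr multE; apply/funext => J; rewrite (dev_sumE u); ring.
  rewrite lerD2l (le_trans (ler_norm _))//.
  rewrite E_dev_mul.
  apply: (@multE_cov _ _ q r qr u (q_lt1 u) n g (dev_sum' u) l (2 * G)); rewrite ?mulr_ge0//.
  - by move=> J; exact: dev_sum'_add_self.
  - move=> j jn; apply: (@step_bound _ (fun m => E' u m (dev_sum' u))) => // m _.
    apply: multE_step; rewrite ?mulr_ge0//; first exact: (subprob_rem qr (q_lt1 u)).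
    move=> w J; rewrite (le_trans (dev_sum'_add u w J))// ler_piMr ?mulr_ge0//.
    by case: (_ <= _)%N.
by rewrite big_split/= -mulr_sumr lerD// sum_urn_var_le.
Qed.

Variable b : R.
Hypothesis b0 : 0 < b.
Local Notation D := (small_mass q n./2).

(** The [kappa] of [multE_cov] for a test function of [dev_sum' u / b] with Lipschitz constant [Lh]
    and bound [B], as produced by [drift_bound]. Dividing [D] by [c] pays for renormalizing the
    weights once urn u is removed. *)
Definition cov_rate (Lh B : R) := Lh * (2 * G / b) * 2 ^+ l * (D / c) + 4 * B / n%:R.

Lemma cov_rate_ge0 Lh B : 0 <= Lh -> 0 <= B -> 0 <= cov_rate Lh B.
Proof.
move=> L0 B0; have G0 := G_ge0; have D0 := small_mass_ge0 qr n./2.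
rewrite addr_ge0 ?mulr_ge0 ?divr_ge0 ?exprn_ge0//.
  by rewrite invr_ge0 ltW.
by rewrite invr_ge0 ltW.
Qed.

Lemma cov_test u (phi : nat -> R) (k : R -> R) (B Lh : R) :
  (forall x, `|k x| <= B) -> 0 <= Lh ->
  (forall x y, `|k x - k y| <= Lh * `|x - y|) ->
  (forall j, phi j != 0 -> (j <= l)%N) ->
  `|E (fun J => phi (J u) * k (dev_sum' u J / b))
    - E (fun J => phi (J u)) * E (fun J => k (dev_sum' u J / b))|
  <= cov_rate Lh B * (binE (q u) n (fun j _ => `|phi j|) * (l%:R + n%:R * q u)).
Proof.
move=> kB L0 kL phil; have G0 := G_ge0.
have B0 : 0 <= B := le_trans (normr_ge0 _) (kB 0).
have D0 := small_mass_ge0 qr n./2.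
pose F J := k (dev_sum' u J / b).
have FL w J : `|F (add_ball w J) - F J| <= Lh * (2 * G / b) * (J w <= l)%N%:R.
  rewrite (le_trans (kL _ _))// -mulrA ler_wpM2l// -mulrBl normrM (gtr0_norm (_ : 0 < b^-1)) ?invr_gt0//.
  by rewrite mulrAC ler_wpM2r ?invr_ge0 ?(ltW b0)// dev_sum'_add.
apply: (@multE_cov _ _ q r qr u (q_lt1 u) n phi F l) => //.
- exact: cov_rate_ge0.
- by move=> J; rewrite /F dev_sum'_add_self.
move=> j jn; have qr' := subprob_rem qr (q_lt1 u).
apply: (@drift_bound _ (fun m => E' u m F)) => //; last first.
  by move=> m; apply: (multE_bound qr') => J; exact: kB.
move=> m nm; have := @multE_incr _ _ _ _ qr' m (Lh * (2 * G / b)) l F.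
rewrite !mulr_ge0 ?invr_ge0 ?(ltW b0)// => /(_ isT FL)/le_trans; apply.
rewrite ler_wpM2l ?mulr_ge0 ?exprn_ge0 ?invr_ge0 ?(ltW b0)//.
rewrite (le_trans (small_mass_rem qr m (q_lt1 u)))//.
have q1u : c <= 1 - q u by have := qc u; rewrite lerBrDr lerBrDl addrC.
apply: ler_pM; rewrite ?invr_ge0 ?subr_ge0 ?(ltW (q_lt1 u)) ?(small_mass_ge0 qr)//.
  exact: (le_small_mass qr nm).
by rewrite lef_pV2// posrE (lt_le_trans c0).
Qed.

Variables (f f1 : R -> R) (C0 C1 C2 : R).
Hypothesis fC0 : forall x, `|f x| <= C0.
Hypothesis f1C1 : forall x, `|f1 x| <= C1.
Hypothesis fL : forall x y, `|f x - f y| <= C1 * `|x - y|.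
Hypothesis f1L : forall x y, `|f1 x - f1 y| <= C2 * `|x - y|.
Hypothesis f2 : forall x h, `|f (x + h) - f x - h * f1 x| <= C2 * h ^+ 2.

Let W J := dev_sum J / b.
Let W' u J := dev_sum' u J / b.
Let x u J := urn_dev u (J u).

Lemma C2_ge0 : 0 <= C2.
Proof. by have := le_trans (normr_ge0 _) (f2 0 1); rewrite expr1n mulr1. Qed.

Lemma C1_ge0 : 0 <= C1.
Proof. exact: le_trans (normr_ge0 _) (f1C1 0). Qed.

Lemma C0_ge0 : 0 <= C0.
Proof. exact: le_trans (normr_ge0 _) (fC0 0). Qed.

Lemma W_E u J : W J = W' u J + x u J / b.
Proof. by rewrite /W /W' /x (dev_sumE u) mulrDl addrC. Qed.

(** Leave one out: W = W' + x/b, so x f(W) is x f(W') + (x^2/b) f1(W') up to a Taylor error. The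
    centred x is almost uncorrelated with f(W'), and x^2 with f1(W'); these give the first two error
    terms. The last one is half the Taylor error and half the cost of returning from f1(W') to
    f1(W). *)
Lemma stein_urn u :
  `|E (fun J => x u J * f (W J)) - urn_var u / b * E (fun J => f1 (W J))| <=
    cov_rate C1 C0 * (urn_abs u * (l%:R + n%:R * q u))
    + b^-1 * (cov_rate C2 C1 * (3 * G * (urn_abs u * (l%:R + n%:R * q u))))
    + 4 * C2 * G / b ^+ 2 * urn_var u.
Proof.
have G0 := G_ge0; have C20 := C2_ge0; have v0 := urn_var_ge0 u.
have b0' : b != 0 by rewrite gt_eqF.
have bV : 0 < b^-1 by rewrite invr_gt0.
have wt := weight_ge1 u.
have e0 := urn_abs_ge0 u.
have t1 : `|E (fun J => x u J * f (W' u J))| <=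
    cov_rate C1 C0 * (urn_abs u * (l%:R + n%:R * q u)).
  by rewrite E_dev_mul; apply: cov_test => //; exact: C1_ge0.
have t2 : `|E (fun J => x u J ^+ 2 * f1 (W' u J)) - urn_var u * E (fun J => f1 (W' u J))|
    <= cov_rate C2 C1 * (3 * G * (urn_abs u * (l%:R + n%:R * q u))).
  rewrite E_dev_sqr_mul.
  set phi := fun j => g j ^+ 2 - 2 * urn_mean u * g j.
  apply: (le_trans (@cov_test u phi f1 C1 C2 _ _ _ _)) => //.
    move=> j; apply: contraNT; rewrite -ltnNge => lj.
    rewrite /phi; have -> : g j = 0 by apply: contraTeq lj => /gl; rewrite -leqNgt.
    by rewrite expr0n/= mulr0 subr0.
  rewrite ler_wpM2l ?cov_rate_ge0 ?C1_ge0// mulrA ler_wpM2r ?(le_trans _ wt)//.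
  rewrite -binEZ; apply: binE_le => [|j m _]; first exact: (subprob_ge0_le1 qr).
  (* [phi j] factors as [(g j - 2 * urn_mean u) * g j], and the first factor is at most 3G. *)
  rewrite /phi expr2 -mulrBl normrM ler_wpM2r//.
  have := gG j; have := urn_mean_leG u; rewrite !ler_norml => /andP[? ?] /andP[? ?].
  by apply/andP; split; lra.
have t3 : `|E (fun J => f1 (W' u J)) - E (fun J => f1 (W J))| <= C2 * (2 * G / b).
  rewrite -multEB; apply: multE_bound => // J; rewrite (le_trans (f1L _ _))//.
  rewrite ler_wpM2l// (W_E u) opprD addNKr normrN normrM (gtr0_norm bV).
  by rewrite ler_wpM2r ?(ltW bV)// urn_dev_le.
have t4 : `|E (fun J => x u J * f (W J)) - (E (fun J => x u J * f (W' u J))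
     + b^-1 * E (fun J => x u J ^+ 2 * f1 (W' u J)))| <= 2 * G * C2 / b ^+ 2 * urn_var u.
  rewrite -multEZ -multED -multEB (le_trans (multE_norm qr _ _))//.
  rewrite /urn_var -(multE_urn u qr n (fun j => urn_dev u j ^+ 2)) -multEZ.
  apply: multE_le => // J; rewrite (W_E u) -/(x u J).
  have -> : x u J * f (W' u J + x u J / b) - (x u J * f (W' u J) +
      b^-1 * (x u J ^+ 2 * f1 (W' u J))) =
    x u J * (f (W' u J + x u J / b) - f (W' u J) - x u J / b * f1 (W' u J)) by field.
  rewrite normrM (_ : 2 * G * C2 / b ^+ 2 * x u J ^+ 2 = 2 * G * (C2 * (x u J / b) ^+ 2)).
    by rewrite ler_pM// urn_dev_le.
  by field.
have -> : E (fun J => x u J * f (W J)) - urn_var u / b * E (fun J => f1 (W J)) =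
  (E (fun J => x u J * f (W J)) - (E (fun J => x u J * f (W' u J))
     + b^-1 * E (fun J => x u J ^+ 2 * f1 (W' u J))))
  + E (fun J => x u J * f (W' u J))
  + b^-1 * (E (fun J => x u J ^+ 2 * f1 (W' u J)) - urn_var u * E (fun J => f1 (W' u J)))
  + urn_var u / b * (E (fun J => f1 (W' u J)) - E (fun J => f1 (W J))) by field.
have t2' := t2; rewrite -(ler_pM2l bV) in t2'.
have t3' : `|urn_var u / b * (E (fun J => f1 (W' u J)) - E (fun J => f1 (W J)))|
    <= 2 * G * C2 / b ^+ 2 * urn_var u.
  rewrite normrM ger0_norm ?divr_ge0// ?(ltW b0)//.
  rewrite (_ : 2 * G * _ / _ * _ = urn_var u / b * (C2 * (2 * G / b))); last by field.
  by rewrite ler_wpM2l// divr_ge0// ltW.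
rewrite -{1}(gtr0_norm bV) -normrM in t2'.
apply: (le_trans (ler_normD _ _)); apply: (le_trans (lerD (ler_normD _ _) t3')).
apply: (le_trans (lerD (lerD (ler_normD _ _) t2') (lexx _))).
rewrite (_ : 4 * C2 * G / b ^+ 2 * urn_var u =
  2 * G * C2 / b ^+ 2 * urn_var u + 2 * G * C2 / b ^+ 2 * urn_var u); last by field.
by lra.
Qed.

(** Sum of [stein_urn] over the urns. When [urn_weight] is of order b^2, the error is of order D +
    b/n + 1/b. *)
Lemma stein_multinomial :
  `|E (fun J => W J * f (W J)) - (\sum_u urn_var u) / b ^+ 2 * E (fun J => f1 (W J))| <=
  urn_weight * (cov_rate C1 C0 / b + 3 * G * cov_rate C2 C1 / b ^+ 2
    + 4 * C2 * G ^+ 2 / b ^+ 3).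
Proof.
have G0 := G_ge0; have C20 := C2_ge0; have b0' : b != 0 by rewrite gt_eqF.
have -> : E (fun J => W J * f (W J)) - (\sum_u urn_var u) / b ^+ 2 * E (fun J => f1 (W J))
  = b^-1 * \sum_u (E (fun J => x u J * f (W J)) - urn_var u / b * E (fun J => f1 (W J))).
  rewrite sumrB -multE_sum mulrBr -(multEZ _ _ _ b^-1); congr (_ - _).
    congr multE; apply/funext => J.
    by rewrite {1}/W /dev_sum -mulr_suml mulrA [in RHS]mulrC; ring.
  by rewrite -mulr_suml -mulr_suml; field.
rewrite normrM gtr0_norm ?invr_gt0// (le_trans (ler_wpM2l _ (ler_norm_sum _ _ _)))//.
  by rewrite invr_ge0 ltW.
rewrite (le_trans (ler_wpM2l _ (ler_sum _ (fun u _ => stein_urn u))))//.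
  by rewrite invr_ge0 ltW.
rewrite !big_split/= -!mulr_sumr -/urn_weight.
apply: (@le_trans _ _ (b^-1 * (cov_rate C1 C0 * urn_weight + b^-1 *
   (cov_rate C2 C1 * (3 * G * urn_weight)) + 4 * C2 * G / b ^+ 2 * (G * urn_weight)))).
  rewrite ler_wpM2l ?invr_ge0 ?(ltW b0)// lerD2l ler_wpM2l ?sum_urn_var_le//.
  by rewrite !mulr_ge0// invr_ge0 exprn_ge0 ?(ltW b0).
by rewrite le_eqVlt; apply/orP; left; apply/eqP; field.
Qed.

End urn_statistic.

(** * Derivatives, Lipschitz bounds and first-order Taylor bounds *)

Section real_derivatives.
Variable R : realType.
Implicit Types (f g : R -> R) (x a b : R).

Lemma der_id x : is_derive x (1 : R) (fun t : R => t) (1 : R).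
Proof. exact: (@is_derive_id _ R x 1). Qed.

Lemma der_cst (c x : R) : is_derive x (1 : R) (fun=> c) (0 : R).
Proof. exact: (@is_derive_cst _ R R c x 1). Qed.

Lemma derM f g x a b : is_derive x (1 : R) f a -> is_derive x (1 : R) g b ->
  is_derive x (1 : R) (fun t => f t * g t) (a * g x + f x * b).
Proof.
move=> fa gb; apply: (@is_derive_eq _ _ _ (f * g) _ _ _ _ (is_deriveM fa gb)).
by rewrite addrC [a * _]mulrC.
Qed.

Lemma derD f g x a b : is_derive x (1 : R) f a -> is_derive x (1 : R) g b ->
  is_derive x (1 : R) (fun t => f t + g t) (a + b).
Proof. by move=> fa gb; exact: (is_deriveD fa gb). Qed.

Lemma derB f g x a b : is_derive x (1 : R) f a -> is_derive x (1 : R) g b ->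
  is_derive x (1 : R) (fun t => f t - g t) (a - b).
Proof. by move=> fa gb; exact: (is_deriveB fa gb). Qed.

Lemma derZ c f x a : is_derive x (1 : R) f a ->
  is_derive x (1 : R) (fun t => c * f t) (c * a).
Proof. by move=> fa; exact: (is_deriveZ c fa). Qed.

Lemma der_comp f g x a b : is_derive (g x) (1 : R) f a -> is_derive x (1 : R) g b ->
  is_derive x (1 : R) (fun t => f (g t)) (a * b).
Proof. by move=> fa gb; exact: (is_derive1_comp fa gb). Qed.

Lemma der_inv x : x != 0 -> is_derive x (1 : R) (fun t => t^-1) (- x ^- 2).
Proof.
move=> x0; apply: (is_derive_eq (is_deriveV x0 (der_id x))).
by rewrite [_ *: _]mulr1.
Qed.

Lemma der_continuous f x a : is_derive x (1 : R) f a -> {for x, continuous f}.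
Proof. by move=> [df _]; exact/differentiable_continuous/derivable1_diffP. Qed.

Lemma lipschitz_der f f' C x y : (forall t, is_derive t (1 : R) f (f' t)) ->
  (forall t, `|f' t| <= C) -> `|f x - f y| <= C * `|x - y|.
Proof.
move=> df fC; have cf : continuous f by move=> t; exact: der_continuous (df t).
wlog yx : x y / y <= x => [H|].
  by have [|/ltW] := leP y x => h; [|rewrite distrC (distrC x)]; exact: H.
have [c _ ->] := MVT_segment yx (fun t _ => df t) (continuous_subspaceT cf).
by rewrite normrM ler_wpM2r.
Qed.

Lemma taylor1_der f f' C2 x h : (forall t, is_derive t (1 : R) f (f' t)) ->
  (forall t u, `|f' t - f' u| <= C2 * `|t - u|) ->
  `|f (x + h) - f x - h * f' x| <= C2 * h ^+ 2.
Proof.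
move=> df fL; have cf : continuous f by move=> t; exact: der_continuous (df t).
have C20 : 0 <= C2.
  by have := le_trans (normr_ge0 _) (fL 1 0); rewrite subr0 normr1 mulr1.
have key c : `|c - x| <= `|h| -> `|h * f' c - h * f' x| <= C2 * h ^+ 2.
  move=> ch; rewrite -mulrBr normrM mulrC (le_trans (ler_wpM2r _ (fL _ _)))//.
  by rewrite -mulrA ler_wpM2l// -real_normK ?num_real// expr2 ler_wpM2r.
have [h0|h0] := leP 0 h.
  have xh : x <= x + h by rewrite lerDl.
  have [c + ->] := MVT_segment xh (fun t _ => df t) (continuous_subspaceT cf).
  rewrite in_itv/= => /andP[c1 c2]; rewrite [x + h]addrC addrK mulrC; apply: key.
  by rewrite !ger0_norm// ?subr_ge0// lerBlDl.
have xh : x + h <= x by rewrite gerDl ltW.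
have [c + e] := MVT_segment xh (fun t _ => df t) (continuous_subspaceT cf).
rewrite in_itv/= => /andP[c1 c2]; rewrite -[f (x + h) - _]opprB e.
rewrite (_ : - _ - _ = h * f' c - h * f' x); last by ring.
apply: key; rewrite distrC ger0_norm ?subr_ge0// ltr0_norm//; lra.
Qed.

Lemma inv_cvgy : t^-1 @[t --> +oo] --> (0 : R).
Proof.
apply/cvgr0Pnorm_le => e e0; near=> t.
have t0 : 0 < t by near: t; exact: nbhs_pinfty_gt.
by rewrite gtr0_norm ?invr_gt0// invf_ple ?posrE.
Unshelve. all: by end_near. Qed.

Lemma cvg0Z (T : Type) (D : set_system T) {FD : Filter D} (u : T -> R) (c : R) :
  u x @[x --> D] --> (0 : R) -> c * u x @[x --> D] --> (0 : R).
Proof.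
move=> u0; rewrite -[X in _ --> X](mulr0 c).
by apply: cvgM => //; exact: cvg_cst.
Qed.

End real_derivatives.

(** * A priori bounds for Stein's equation of the normal law *)

Section stein_equation.
Variables (R : realType) (s : R).
Hypothesis s0 : 0 < s.

Definition gaussw (x : R) := expR (- (x ^+ 2 / (s ^+ 2 *+ 2))).

Let sn0 : s != 0. Proof. by rewrite gt_eqF. Qed.

Let s20 : 0 < s ^+ 2. Proof. by rewrite exprn_gt0. Qed.

Lemma gaussw_gt0 x : 0 < gaussw x. Proof. exact: expR_gt0. Qed.

Lemma gausswN x : gaussw (- x) = gaussw x.
Proof. by rewrite /gaussw sqrrN. Qed.

Lemma is_derive_gaussw (x : R) : is_derive x (1 : R) gaussw (- (x / s ^+ 2) * gaussw x).
Proof.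
have h : is_derive x (1 : R) (fun t => - (s ^+ 2 *+ 2)^-1 * (t * t))
    (- (s ^+ 2 *+ 2)^-1 * (1 * x + x * 1)).
  by apply: derZ; apply: derM; exact: der_id.
have -> : gaussw = fun t => expR (- (s ^+ 2 *+ 2)^-1 * (t * t)).
  by apply/funext => t; rewrite /gaussw mulNr mulrC expr2.
apply: (is_derive_eq (der_comp (is_derive_expR _) h)).
by rewrite mulrC; congr (_ * _); rewrite -mulr_natr; field.
Qed.

Lemma gaussw_cvgy : gaussw x @[x --> +oo] --> (0 : R).
Proof.
apply/cvgr0Pnorm_le => e e0; near=> x.
have x0 : 0 < x by near: x; exact: nbhs_pinfty_gt.
rewrite ger0_norm ?expR_ge0// /gaussw expRN invf_ple ?posrE ?expR_gt0//.
rewrite (le_trans _ (expR_ge1Dx _))// -lerBlDl.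
rewrite ler_pdivlMr ?mulrn_wgt0//.
have x1 : 1 <= x by near: x; exact: nbhs_pinfty_ge.
by rewrite (@le_trans _ _ x)// ?expr2 ?ler_peMr// 1?ltW//.
Unshelve. all: by end_near. Qed.

(** The function (g(t) - M/t) [gaussw](t) has a nonnegative derivative for t > 0 and tends to 0 at
    infinity, so it is at most 0. *)
Lemma stein_bound_le (g rho : R -> R) (M x : R) :
  (forall t : R, is_derive t (1 : R) g ((t * g t + rho t) / s ^+ 2)) ->
  (forall t, `|rho t| <= M) ->
  g t * gaussw t @[t --> +oo] --> (0 : R) ->
  0 < x -> x * g x <= M.
Proof.
move=> dg rM glim x0; have M0 : 0 <= M := le_trans (normr_ge0 _) (rM 0).
pose G t := (g t - M * t^-1) * gaussw t.
have dG (t : R) : 0 < t -> is_derive t (1 : R) G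
    (((rho t + M) / s ^+ 2 + M / t ^+ 2) * gaussw t).
  move=> t0; have tn0 : t != 0 by rewrite gt_eqF.
  apply: (is_derive_eq (derM (derB (dg t) (derZ M (der_inv tn0))) (is_derive_gaussw t))).
  by field; rewrite tn0.
have Glim : G t @[t --> +oo] --> (0 : R).
  rewrite -[X in _ --> X](subrr (0 : R)).
  have -> : G = fun t => g t * gaussw t - (M * t^-1) * gaussw t.
    by apply/funext => t; rewrite /G mulrBl.
  apply: cvgB => //; rewrite -[X in _ --> X](mul0r (0 : R)).
  apply: cvgM gaussw_cvgy; rewrite -[X in _ --> X](mulr0 M).
  by apply: cvgM; [exact: cvg_cst|exact: inv_cvgy].
have Gnd (y : R) : x <= y -> G x <= G y.
  move=> xy; apply: (@ger0_derive1_ndecry _ G x) => //.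
  - move=> t; rewrite in_itv/= andbT => xt.
    by have [] := dG t (lt_trans x0 xt).
  - move=> t; rewrite in_itv/= andbT => xt; have t0 := lt_trans x0 xt.
    rewrite derive1E; have [_ ->] := dG t t0.
    have := rM t; rewrite ler_norml => /andP[rm _].
    by rewrite mulr_ge0 ?(ltW (gaussw_gt0 _))// addr_ge0// divr_ge0 ?sqr_ge0//; lra.
  - apply: continuous_in_subspaceT => t; rewrite inE/= in_itv/= andbT => xt.
    exact: der_continuous (dG t (lt_le_trans x0 xt)).
have : G x <= 0.
  by apply: (cvgr_to_ge Glim); near=> y; apply: Gnd.
by rewrite /G pmulr_lle0 ?gaussw_gt0// subr_le0 ler_pdivlMr// mulrC.
Unshelve. all: by end_near. Qed.

(** The lower bound and the negative half-line follow from the symmetries g -> -g and t -> -t of the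
    equation. *)
Lemma stein_bound (g rho : R -> R) (M x : R) :
  (forall t : R, is_derive t (1 : R) g ((t * g t + rho t) / s ^+ 2)) ->
  (forall t, `|rho t| <= M) ->
  g t * gaussw t @[t --> +oo] --> (0 : R) ->
  g t * gaussw t @[t --> -oo] --> (0 : R) ->
  `|x * g x| <= M.
Proof.
have pos (h r : R -> R) (y : R) :
    (forall t : R, is_derive t (1 : R) h ((t * h t + r t) / s ^+ 2)) ->
    (forall t, `|r t| <= M) -> h t * gaussw t @[t --> +oo] --> (0 : R) -> 0 < y ->
    `|y * h y| <= M.
  move=> dh rM hlim y0; rewrite ler_norml (stein_bound_le dh rM)// andbT.
  rewrite lerNl -mulrN.
  apply: (@stein_bound_le (fun t => - h t) (fun t => - r t)) => //.
  - move=> t; apply: (is_derive_eq (is_deriveN (dh t))); rewrite mulrN -opprD mulNr.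
    by [].
  - by move=> t; rewrite normrN.
  - rewrite -oppr0; under eq_fun do rewrite mulNr; exact: cvgN.
move=> dg rM gy gNy; have M0 := le_trans (normr_ge0 _) (rM 0).
have [x0|x0|->] := ltgtP x 0; last by rewrite mul0r normr0.
- rewrite -normrN -mulNr -[X in g X]opprK.
  apply: (pos (fun t => g (- t)) (fun t => - rho (- t))).
  - move=> t; have dN : is_derive t (1 : R) (fun t => - t) (- 1).
      exact: is_deriveN (der_id t).
    by apply: (is_derive_eq (der_comp (dg (- t)) dN)); field.
  - by move=> t; rewrite normrN.
  - move/cvgNy_compNP : gNy; apply: cvg_trans; apply: near_eq_cvg; near=> t.
    by rewrite /= gausswN.
  - by rewrite oppr_gt0.
- exact: (pos g rho).
Unshelve. all: by end_near. Qed.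

End stein_equation.

Lemma integral_normal_prob (R : realType) (m s : R) (f : R -> R) U :
  measurable U -> (normal_prob m s).-integrable U (EFin \o f) ->
  (\int[normal_prob m s]_(x in U) (f x)%:E =
   \int[lebesgue_measure]_(x in U) (f x * normal_pdf m s x)%:E)%E.
Proof.
move=> mU intf; have [mf finf] := integrableP _ _ _ intf.
rewrite -(Radon_Nikodym_change_of_variables (normal_prob_dominates m s))//=.
under [RHS]eq_integral do rewrite EFinM.
apply: ae_eq_integral => //.
- apply: emeasurable_funM => //; apply: (measurable_int lebesgue_measure).
  apply: (integrableS _ _ (@subsetT _ _)) => //=.
  by apply: Radon_Nikodym_integrable; exact: normal_prob_dominates.
- apply: emeasurable_funM => //=.
  by apply/measurable_EFinP/measurable_funTS; exact: measurable_normal_pdf.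
- apply: ae_eqe_mul2l => /=.
  rewrite Radon_NikodymE//=; first exact: normal_prob_dominates.
  move=> abmu.
  case: cid => /= h [h1 h2 h3].
  apply: integral_ae_eq => //=.
  + exact: integrableS h2.
  + by apply/measurable_EFinP/measurable_funTS; exact: measurable_normal_pdf.
  + by move=> E E01 mE; rewrite -h3.
Qed.

Lemma bounded_integrable_prob d (T : measurableType d) (R : realType)
    (P : probability T R) (f : T -> R) (B : R) (A : set T) :
  measurable A -> measurable_fun setT f -> (forall x, `|f x| <= B) ->
  P.-integrable A (EFin \o f).
Proof.
move=> mA mf fB; apply: measurable_bounded_integrable => //.
- by rewrite (le_lt_trans (probability_le1 P mA))// ltry.
- exact: measurable_funTS.
- by exists B; split; [exact: num_real|move=> x Bx y _ /=; rewrite (le_trans (fB y)) ?ltW].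
Qed.

(** * A solution of Stein's equation for smooth bounded data *)

Section stein_solution.
Variables (R : realType) (s : R).
Hypothesis s0 : 0 < s.
Local Notation mu := (@lebesgue_measure R).
Local Notation Nor := (normal_prob (0 : R) s).
Local Notation w := (gaussw s).

Let sn0 : s != 0. Proof. by rewrite gt_eqF. Qed.

Lemma normal_pdf_gaussw x : normal_pdf 0 s x = normal_peak s * w x.
Proof. by rewrite normal_pdfE// /normal_fun subr0 mulNr. Qed.

Lemma gaussw_normal_pdf x : w x = (normal_peak s)^-1 * normal_pdf 0 s x.
Proof. by rewrite normal_pdf_gaussw mulKf// gt_eqF// normal_peak_gt0. Qed.

(** The identity as a random variable under the normal law, so that the limits of distribution
    functions give the normal tails. *)
Let idTR : measurableTypeR R -> R := idfun.

#[local] HB.instance Definition _ :=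
  @isMeasurableFun.Build _ _ _ _ idTR (@measurable_id _ _ setT).

Lemma normal_tail_y : Nor `]x, +oo[ @[x --> +oo] --> 0%E.
Proof.
exact: (cvg_ccdfy0 (idTR : {RV Nor >-> R})).
Qed.

Lemma normal_tail_Ny : Nor `]-oo, x] @[x --> -oo] --> 0%E.
Proof.
exact: (cvg_cdfNy0 (idTR : {RV Nor >-> R})).
Qed.

Variables (h h1 : R -> R) (B B1 : R).
Hypothesis dh : forall x : R, is_derive x (1 : R) h (h1 x).
Hypothesis hB : forall x, `|h x| <= B.
Hypothesis h1B : forall x, `|h1 x| <= B1.

Definition normal_mean (k : R -> R) := fine (\int[Nor]_x (k x)%:E)%E.
Local Notation N := (normal_mean h).

Let k t := (h t - N) * w t.

Lemma measurable_h : measurable_fun setT h.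
Proof. by apply: continuous_measurable_fun => x; exact: der_continuous (dh x). Qed.

Lemma integrable_h : Nor.-integrable setT (EFin \o h).
Proof. by apply: (@bounded_integrable_prob _ _ _ Nor h B) => //; exact: measurable_h. Qed.

Lemma integrable_pdfM (f : R -> R) C : continuous f -> (forall x, `|f x| <= C) ->
  mu.-integrable setT (fun x => (f x * normal_pdf 0 s x)%:E).
Proof.
move=> cf fC; apply: (@le_integrable _ _ _ mu _ measurableT _
   (fun x => (C * normal_pdf 0 s x)%:E)).
- apply/measurable_EFinP/measurable_funM; first exact: continuous_measurable_fun.
  exact: measurable_normal_pdf.
- move=> x _; rewrite lee_fin !normrM ler_wpM2r// (le_trans (fC x))//.
  exact: ler_norm.
- under eq_fun do rewrite EFinM.
  by apply: integrableZl => //; exact: integrable_normal_pdf.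
Qed.

Let hN t := h t - N.

Let hNC t : `|hN t| <= B + `|N|.
Proof. by rewrite (le_trans (ler_normB _ _))// lerD2r. Qed.

Let chN : continuous hN.
Proof. by move=> t; apply: cvgB; [exact: der_continuous (dh t)|exact: cvg_cst]. Qed.

Let kE t : k t = (normal_peak s)^-1 * (hN t * normal_pdf 0 s t).
Proof. by rewrite /k gaussw_normal_pdf mulrCA. Qed.

Let ck : continuous k.
Proof.
move=> t; apply: cvgM; first exact: chN.
exact: der_continuous (is_derive_gaussw s0 t).
Qed.

Let ik A : measurable A -> mu.-integrable A (EFin \o k).
Proof.
move=> mA; apply: (@integrableS _ _ _ mu setT) => //.
have := integrableZl measurableT (normal_peak s)^-1 (integrable_pdfM chN hNC).
by apply: eq_integrable => // t _; rewrite /= kE EFinM.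
Qed.

Lemma integral_h_pdf : (\int[mu]_x (h x * normal_pdf 0 s x)%:E = N%:E)%E.
Proof.
rewrite -integral_normal_prob//; last exact: integrable_h.
by rewrite fineK//; apply: integrable_fin_num => //; exact: integrable_h.
Qed.

Let k_total : \int[mu]_x k x = 0.
Proof.
have -> : \int[mu]_x k x =
    \int[mu]_x ((normal_peak s)^-1 * (hN x * normal_pdf 0 s x)).
  by apply: eq_Rintegral => t _; rewrite kE.
rewrite RintegralZl//; last exact: integrable_pdfM hNC.
rewrite (_ : (\int[mu]_x _)%R = 0) ?mulr0//.
have -> : (\int[mu]_x (hN x * normal_pdf 0 s x))%R =
    (\int[mu]_x (h x * normal_pdf 0 s x - N * normal_pdf 0 s x))%R.
  by apply: eq_Rintegral => t _; rewrite mulrBl.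
have i1 : mu.-integrable setT (EFin \o normal_pdf 0 s) by exact: integrable_normal_pdf.
rewrite RintegralB//; last 2 first.
  apply: integrable_pdfM hB => t; exact: der_continuous (dh t).
  apply: (integrable_pdfM (f := fun=> N) (C := `|N|)) => // t; exact: cvg_cst.
rewrite RintegralZl// /Rintegral integral_h_pdf integral_normal_pdf/= mulr1.
by rewrite subrr.
Qed.

Let C := (B + `|N|) * (normal_peak s)^-1.

Let k_bound A : measurable A -> `|\int[mu]_(t in A) k t| <= C * fine (Nor A).
Proof.
move=> mA; rewrite (le_trans (le_normr_Rintegral mA (ik mA)))//.
have ip : mu.-integrable A (EFin \o normal_pdf 0 s).
  by apply: (@integrableS _ _ _ mu setT) => //; exact: integrable_normal_pdf.
have -> : C * fine (Nor A) = \int[mu]_(t in A) (C * normal_pdf 0 s t).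
  by rewrite RintegralZl.
apply: le_Rintegral => //.
- by have := integrable_abse (ik mA); apply: eq_integrable.
- by have := integrableZl mA C ip; apply: eq_integrable => // t _; rewrite EFinM.
- move=> t _; rewrite kE 2!normrM mulrA (ger0_norm (normal_pdf_ge0 _ _ _)).
  rewrite ler_wpM2r ?normal_pdf_ge0// ger0_norm ?invr_ge0 ?normal_peak_ge0//.
  by rewrite mulrC ler_wpM2r ?invr_ge0 ?normal_peak_ge0.
Qed.

Let F x := \int[mu]_(t in `]-oo, x]) k t.

Let dF (x : R) : is_derive x (1 : R) F (k x).
Proof.
have x1 : x < x + 1 by rewrite ltrDl.
have [dF F'] : derivable F x 1 /\ F^`()%classic x = k x.
  apply: (@continuous_FTC1 _ k -oo%O x (x + 1) x1) => //; [exact: (ik (measurable_itv _))| |exact: ck].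
  by rewrite /= ltNyr.
rewrite derive1E in F'; exact: (@DeriveDef _ _ _ x (1 : R) F (k x) dF F').
Qed.

Let fine_cvg0 (T : Type) (D : set_system T) {FD : Filter D} (u : T -> \bar R) :
  u x @[x --> D] --> 0%E -> C * fine (u x) @[x --> D] --> (0 : R).
Proof.
by move=> u0; apply: cvg0Z; exact: (fine_cvg (a := 0)).
Qed.

Let FNy : F x @[x --> -oo] --> (0 : R).
Proof.
apply/norm_cvg0P.
apply: (@squeeze_cvgr _ _ _ _ (fun=> 0) (fun x => C * fine (Nor `]-oo, x]))).
- by near=> x; rewrite normr_ge0/= k_bound.
- exact: cvg_cst.
- exact: (fine_cvg0 normal_tail_Ny).
Unshelve. all: by end_near. Qed.

Let Fy : F x @[x --> +oo] --> (0 : R).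
Proof.
apply/norm_cvg0P.
apply: (@squeeze_cvgr _ _ _ _ (fun=> 0) (fun x => C * fine (Nor `]x, +oo[))).
- near=> x; rewrite normr_ge0/= (le_trans _ (k_bound (measurable_itv _)))//.
  have : \int[mu]_(t in `]-oo, x]) k t + \int[mu]_(t in `]x, +oo[) k t = 0.
    have UT : `]-oo, x]%classic `|` `]x, +oo[%classic = [set: R].
      by rewrite itv_setU_setT.
    rewrite -k_total -UT Rintegral_setU//.
      by apply: ik; exact: measurableU.
    exact: disjoint_rays.
  by move/eqP; rewrite addr_eq0 => /eqP; rewrite /F => ->; rewrite normrN.
- exact: cvg_cst.
- exact: (fine_cvg0 normal_tail_y).
Unshelve. all: by end_near. Qed.

(** The solution is f = F / (s^2 w), where F integrates (h - N) w from minus infinity; F vanishes at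
    both ends because N is the normal mean of h. [stein_bound] bounds x f(x), hence f', through the
    equation. Differentiating the equation shows that f' solves one of the same form with right-hand
    side f + h', so x f'(x) and then f'' are bounded too. *)
Lemma stein_solution : exists (f f1 : R -> R) (C0 C1 C2 : R),
  [/\ forall x, `|f x| <= C0, forall x, `|f1 x| <= C1,
      forall x y, `|f x - f y| <= C1 * `|x - y|,
      forall x y, `|f1 x - f1 y| <= C2 * `|x - y| &
      forall x t, `|f (x + t) - f x - t * f1 x| <= C2 * t ^+ 2] /\
  forall x, s ^+ 2 * f1 x - x * f x = h x - N.
Proof.
have s20 : s ^+ 2 != 0 by rewrite sqrf_eq0.
pose f x := (s ^+ 2)^-1 * (F x * (w x)^-1).
pose f1 x := (x * f x + hN x) / s ^+ 2.
have wn0 x : w x != 0 by rewrite gt_eqF// gaussw_gt0.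
have df x : is_derive x (1 : R) f (f1 x).
  have dw := der_comp (der_inv (wn0 x)) (is_derive_gaussw s0 x).
  apply: (is_derive_eq (derZ (s ^+ 2)^-1 (derM (dF x) dw))).
  by rewrite /f1 /f /k -/(hN x); field; rewrite sn0 wn0.
have fw x : f x * w x = (s ^+ 2)^-1 * F x by rewrite /f -2!mulrA mulVf// mulr1.
have fwy : f t * w t @[t --> +oo] --> (0 : R).
  rewrite (_ : (fun t => f t * w t) = (fun t => (s ^+ 2)^-1 * F t)); last exact/funext.
  exact: cvg0Z.
have fwNy : f t * w t @[t --> -oo] --> (0 : R).
  rewrite (_ : (fun t => f t * w t) = (fun t => (s ^+ 2)^-1 * F t)); last exact/funext.
  exact: cvg0Z.
have xf x : `|x * f x| <= B + `|N| by apply: (stein_bound s0 (rho := hN)).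
(* The bound on x f(x) controls f only away from 0; on [-1, 1] continuity is used. *)
have [C0 fC0] : exists C0 : R, forall x : R, `|f x| <= C0.
  have cf : {within `[-1, 1], continuous (fun x => `|f x|)}.
    apply: continuous_subspaceT => x; apply: cvg_norm.
    exact: der_continuous (df x).
  have l1 : (-1 : R) <= 1 by lra.
  have [c _ fc] := EVT_max l1 cf.
  exists (`|f c| + (B + `|N|)) => x.
  have BN : 0 <= B + `|N| := le_trans (normr_ge0 _) (hNC 0).
  have [x1|x1] := lerP `|x| 1.
    by rewrite (le_trans (fc x _)) ?lerDl// in_itv/= -ler_norml.
  have : `|f x| <= `|x * f x| by rewrite (normrM x) ler_peMl// ltW.
  by move=> /le_trans/(_ (xf x)) h'; rewrite -[leLHS]add0r lerD.
have f1C1 x : `|f1 x| <= (B + `|N| + (B + `|N|)) / s ^+ 2.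
  rewrite /f1 normrM (ger0_norm (_ : 0 <= (s ^+ 2)^-1)) ?invr_ge0 ?sqr_ge0//.
  by rewrite ler_wpM2r ?invr_ge0 ?sqr_ge0// (le_trans (ler_normD _ _))// lerD.
set C1 := _ / s ^+ 2 in f1C1.
have df1 x : is_derive x (1 : R) f1 ((x * f1 x + (f x + h1 x)) / s ^+ 2).
  have dhN : is_derive x (1 : R) hN (h1 x - 0) by apply: derB (dh x) (der_cst _ _).
  rewrite /f1; under eq_fun do rewrite mulrC.
  apply: (is_derive_eq (derZ (s ^+ 2)^-1 (derD (derM (der_id x) (df x)) dhN))).
  by rewrite subr0 mul1r -/(f1 x); field.
have f1w (D : set_system R) : Filter D -> w t @[t --> D] --> (0 : R) ->
    f1 t * w t @[t --> D] --> (0 : R).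
  move=> FD w0; apply/norm_cvg0P.
  apply: (@squeeze_cvgr _ _ _ _ (fun=> 0) (fun x => C1 * w x)).
  - by near=> x; rewrite normr_ge0/= normrM (ger0_norm (ltW (gaussw_gt0 s x))) ler_wpM2r// ltW ?gaussw_gt0.
  - exact: cvg_cst.
  - exact: cvg0Z.
have wNy : w t @[t --> -oo] --> (0 : R).
  apply/cvgNy_compNP; apply: cvg_trans (gaussw_cvgy s0); apply: near_eq_cvg.
  by near=> t; rewrite /= gausswN.
have xf1 x : `|x * f1 x| <= C0 + B1.
  apply: (stein_bound s0 (rho := fun x => f x + h1 x)) => //.
  - by move=> t; rewrite (le_trans (ler_normD _ _))// lerD.
  - by apply: f1w (gaussw_cvgy s0).
  - exact: f1w.
pose C2 := (C0 + B1 + (C0 + B1)) / s ^+ 2.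
have f2C2 x : `|(x * f1 x + (f x + h1 x)) / s ^+ 2| <= C2.
  rewrite normrM (ger0_norm (_ : 0 <= (s ^+ 2)^-1)) ?invr_ge0 ?sqr_ge0//.
  rewrite ler_wpM2r ?invr_ge0 ?sqr_ge0// (le_trans (ler_normD _ _))// lerD//.
  by rewrite (le_trans (ler_normD _ _))// lerD.
have f1L x y : `|f1 x - f1 y| <= C2 * `|x - y| by exact: lipschitz_der df1 f2C2.
exists f, f1, C0, C1, C2; split; first split => //.
- by move=> x y; exact: lipschitz_der df f1C1.
- by move=> x t; exact: taylor1_der df f1L.
- by move=> x; rewrite /f1 /hN; field.
Unshelve. all: by end_near. Qed.

End stein_solution.

(** * From smooth test functions to weak convergence *)

Lemma uniform_continuity_segment (R : realType) (f : R -> R) (K e : R) :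
  continuous f -> 0 < e ->
  exists2 del : R, 0 < del &
    forall x t : R, `|x| <= K -> `|t - x| <= del -> `|f t - f x| <= e.
Proof.
move=> cf e0.
pose Q (del x : R) := forall t : R, `|t - x| <= del -> `|f t - f x| <= e.
have cK := @segment_compact R (- K) K.
have : \forall del \near 0^'+, `[- K, K] `<=` Q del.
  apply: (compact_near_coveringP _).1 => // x _.
  have e20 : 0 < e / 2 by rewrite divr_gt0.
  have [eta /= eta0 xeta] := (nbhs_ballP _ _).1 ((@cvgrPdist_lt _ _ _ _ _ _ _).1 (cf x) _ e20).
  have eta2 : 0 < eta / 2 by rewrite divr_gt0.
  exists (ball x (eta / 2), [set del : R | del < eta / 2]) => /=.
    split; first exact: nbhsx_ballx.
    exact: nbhs_right_lt.
  move=> [x' del]/= [xx' dl] t tx'.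
  have xt : `|f x - f t| < e / 2.
    apply: xeta; rewrite /ball/= -(subrKA x') (le_lt_trans (ler_normD _ _))//.
    rewrite (splitr eta) ltrD// distrC (le_lt_trans tx')//.
  have xx : `|f x - f x'| < e / 2.
    by apply: xeta; rewrite /ball/= (lt_trans xx')// ltr_pdivrMr// ltr_pMr// ltr1n.
  change (`|f t - f x'| <= e).
  rewrite -(subrKA (f x)) (le_trans (ler_normD _ _))// [`|f t - _|]distrC.
  by rewrite (splitr e) lerD// ltW.
move=> [del /= del0 H]; have d2 : 0 < del / 2 by rewrite divr_gt0.
exists (del / 2) => // x t xK; apply: (H (del / 2)) => //=.
  by rewrite sub0r normrN gtr0_norm// ltr_pdivrMr// ltr_pMr// ltr1n.
by rewrite in_itv/= -ler_norml.
Qed.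

(** [h x] is the mean over [x, x + del] of f times a tent function; it is differentiable with
    bounded derivative, and by the mean value theorem it is a value of f times the tent within del
    of x. The tent makes the product integrable from minus infinity, and it equals 1 up to K + 1
    with del <= 1, so it is invisible for |x| <= K. *)
Lemma mollify (R : realType) (f : R -> R) (B K e : R) :
  continuous f -> (forall x, `|f x| <= B) -> 0 < K -> 0 < e ->
  exists (h h1 : R -> R) (B1 : R),
  [/\ forall x : R, is_derive x (1 : R) h (h1 x), forall x, `|h x| <= B,
      forall x, `|h1 x| <= B1 & forall x, `|x| <= K -> `|h x - f x| <= e].
Proof.
move=> cf fB K0 e0; have B0 : 0 <= B := le_trans (normr_ge0 _) (fB 0).
have [del' d'0 Hdel'] := uniform_continuity_segment K cf e0.
pose del := Num.min del' 1.
have d0 : 0 < del by rewrite lt_min d'0 ltr01.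
have Hdel (x t : R) : `|x| <= K -> `|t - x| <= del -> `|f t - f x| <= e.
  by move=> xK tx; apply: Hdel' => //; rewrite (le_trans tx)// ge_min lexx.
have d1 : del <= 1 by rewrite ge_min lexx orbT.
pose tent (x : R) := Num.max 0 (Num.min 1 (K + 2 - `|x|)).
have tent01 x : 0 <= tent x <= 1.
  by rewrite /tent le_max lexx/= ge_max ler01/= ge_min lexx.
have ctent : continuous tent.
  move=> x; apply: (@continuous_max R R (fun=> 0) (fun x => Num.min 1 (K + 2 - `|x|))).
    exact: cvg_cst.
  apply: (@continuous_min R R (fun=> 1) (fun x => K + 2 - `|x|)); first exact: cvg_cst.
  by apply: cvgB; [exact: cvg_cst|apply: cvg_norm; exact: cvg_id].
have tent1 (x : R) : `|x| <= K + 1 -> tent x = 1.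
  move=> xK; rewrite /tent; have -> : Num.min 1 (K + 2 - `|x|) = 1.
    by apply/min_idPl; lra.
  by apply/max_idPr.
have tent0 (x : R) : K + 2 < `|x| -> tent x = 0.
  move=> xK; rewrite /tent; apply/max_idPl; rewrite ge_min; apply/orP; right; lra.
pose g x := f x * tent x.
have cg : continuous g by move=> x; apply: cvgM; [exact: cf|exact: ctent].
have gB x : `|g x| <= B.
  have /andP[t0 t1] := tent01 x.
  by rewrite normrM (ger0_norm t0) (le_trans (ler_piMr _ t1)).
have ig : (@lebesgue_measure R).-integrable setT (EFin \o g).
  pose I := [set` `[- (K + 2), K + 2]] : set R.
  have mI : measurable (I : set (measurableTypeR R)) by exact: measurable_itv.
  have finI : ((@lebesgue_measure R) I < +oo)%E.
    by rewrite /I lebesgue_measure_itv/=; case: ifP => _; rewrite ?ltry// -EFinD ltry.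
  have -> : EFin \o g = (EFin \o g) \_ `[- (K + 2), K + 2].
    apply/funext => x; rewrite /restrict/=; case: ifPn => //.
    rewrite notin_setE/= in_itv/= => /negP; rewrite -ler_norml -ltNge => /tent0 tx.
    by rewrite /g tx mulr0.
  apply: (proj1 (@integrable_mkcond _ _ R (@lebesgue_measure R) I (EFin \o g) mI)).
  apply: (@measurable_bounded_integrable _ _ _ (@lebesgue_measure R) g I mI finI).
  - by apply: measurable_funTS; exact: continuous_measurable_fun.
  - by exists B; split; [exact: num_real|move=> x Bx y _ /=; rewrite (le_trans (gB y)) ?ltW].
pose Phi x := (\int[lebesgue_measure]_(t in `]-oo, x]) g t)%R.
have dPhi (x : R) : is_derive x (1 : R) Phi (g x).
  have x1 : x < x + 1 by rewrite ltrDl.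
  have [dF F'] : derivable Phi x 1 /\ Phi^`()%classic x = g x.
    apply: (@continuous_FTC1 _ g -oo%O x (x + 1) x1) => //; [|by rewrite /= ltNyr|exact: cg].
    by apply: integrableS ig => //; exact: measurable_itv.
  by rewrite derive1E in F'; exact: (@DeriveDef _ _ _ x (1 : R) Phi (g x) dF F').
pose h x := del^-1 * (Phi (x + del) - Phi x).
pose h1 x := del^-1 * (g (x + del) - g x).
have hmid (x : R) : exists2 c, x <= c <= x + del & h x = g c.
  have xd : x <= x + del by rewrite lerDl ltW.
  have cPhi : continuous Phi by move=> t; exact: der_continuous (dPhi t).
  have [c + ec] := MVT_segment xd (fun t _ => dPhi t) (continuous_subspaceT cPhi).
  rewrite in_itv/= => cx; exists c => //.
  by rewrite /h ec [x + del]addrC addrK mulrC mulfK// gt_eqF.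
exists h, h1, (del^-1 * (B + B)); split.
- move=> x; have dx : is_derive x (1 : R) (fun t => t + del) (1 + 0).
    exact: (derD (der_id x) (der_cst del x)).
  have dxd := der_comp (dPhi _) dx; rewrite addr0 mulr1 in dxd.
  exact: (derZ del^-1 (derB dxd (dPhi x))).
- by move=> x; have [c _ ->] := hmid x.
- move=> x; rewrite /h1 normrM gtr0_norm ?invr_gt0// ler_wpM2l ?invr_ge0 ?(ltW d0)//.
  by rewrite (le_trans (ler_normB _ _))// lerD.
- move=> x xK; have [c /andP[c1 c2] ->] := hmid x.
  rewrite /g tent1 ?mulr1; last first.
    move: xK; rewrite !ler_norml => /andP[x1 x2]; apply/andP; split; lra.
  by apply: Hdel => //; rewrite ger0_norm ?subr_ge0//; lra.
Qed.

Lemma measurable_set_lt d (T : measurableType d) (R : realType) (f g : T -> R) :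
  measurable_fun setT f -> measurable_fun setT g -> measurable [set w | f w < g w].
Proof.
move=> mf mg.
have := measurable_fun_ltr mf mg measurableT (Y := [set true]) I.
rewrite setTI; congr measurable; apply/seteqP; split => w //=.
Qed.

Section bounded_expectation.
Context d (T : measurableType d) (R : realType) (P : probability T R).
Implicit Types (Y : T -> R) (A : set T).

Lemma prob_fine_le1 A : measurable A -> fine (P A) <= 1.
Proof. by move=> mA; rewrite -lee_fin fineK ?fin_num_measure// probability_le1. Qed.

Lemma le_fine_prob A A' : measurable A -> measurable A' -> A `<=` A' ->
  fine (P A) <= fine (P A').
Proof.
by move=> mA mA' AA'; rewrite fine_le ?fin_num_measure// le_measure// inE.
Qed.

Lemma fine_prob_setU A A' : measurable A -> measurable A' ->
  fine (P (A `|` A')) <= fine (P A) + fine (P A').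
Proof.
move=> mA mA'; rewrite -lee_fin EFinD !fineK ?fin_num_measure//; last exact: measurableU.
exact: measureU2.
Qed.

Lemma Rexp_cst (c : R) : \int[P]_w c = c.
Proof.
rewrite Rintegral_cst// (_ : fine _ = 1) ?mulr1//; last first.
exact: (congr1 fine (probability_setT P)).
Qed.

Lemma Rexp_indic_bound Y A (a b : R) : measurable_fun setT Y -> measurable A ->
  0 <= b -> (forall w, `|Y w| <= a + b * \1_A w) ->
  `|\int[P]_w Y w| <= a + b * fine (P A).
Proof.
move=> mY mA b0 YA.
have YB w : `|Y w| <= a + b.
  by rewrite (le_trans (YA w))// lerD2l ler_piMr// indicE.
have iY := bounded_integrable_prob P measurableT mY YB.
rewrite (le_trans (le_normr_Rintegral measurableT iY))//.
have mI : measurable_fun setT (\1_A : T -> R) by exact: measurable_indic.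
have iI : P.-integrable setT (EFin \o (\1_A : T -> R)).
  by apply: (bounded_integrable_prob P (B := 1)) => // w; rewrite indicE; case: (w \in A); rewrite ?normr1 ?normr0.
have iC (c : R) : P.-integrable setT (EFin \o (fun=> c) : T -> \bar R).
  by apply: (bounded_integrable_prob P (B := `|c|)).
have ibI : P.-integrable setT (EFin \o (fun w => b * \1_A w)).
  by have := integrableZl measurableT b iI; apply: eq_integrable => // w _; rewrite /= EFinM.
have -> : a + b * fine (P A) = \int[P]_w (a + b * \1_A w).
  rewrite RintegralD// RintegralZl// Rexp_cst.
  by congr (_ + _ * _); rewrite /Rintegral integral_indic// setIT.
apply: le_Rintegral => //.
- by have := integrable_abse iY; apply: eq_integrable.
- have := integrableD measurableT (iC a) ibI; apply: eq_integrable => // w _.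
Qed.

End bounded_expectation.

Lemma fine_cvg0 (R : realType) (T : Type) (D : set_system T) {FD : Filter D} (u : T -> \bar R) :
  u x @[x --> D] --> 0%E -> fine (u x) @[x --> D] --> (0 : R).
Proof. by move=> u0; exact: (fine_cvg (a := 0)). Qed.

Lemma normal_tail (R : realType) (s e : R) : 0 < s -> 0 < e ->
  exists2 K, 0 < K & fine (normal_prob (0 : R) s [set x | K < `|x|]) <= e.
Proof.
move=> s0 e0; have e2 : 0 < e / 2 by rewrite divr_gt0.
have h1 : fine (normal_prob (0 : R) s `]x, +oo[) @[x --> +oo] --> (0 : R).
  exact: (fine_cvg0 (normal_tail_y s)).
have h2 : fine (normal_prob (0 : R) s `]-oo, - x]) @[x --> +oo] --> (0 : R).
  have := (@cvgNy_compNP _ R (fun x => fine (normal_prob (0 : R) s `]-oo, x])) (nbhs (0 : R))).1.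
  by apply; exact: (fine_cvg0 (normal_tail_Ny s)).
have : \forall K \near +oo, 0 < K /\ fine (normal_prob (0 : R) s [set x | K < `|x|]) <= e.
  near=> K; have K0 : 0 < K by near: K; exact: nbhs_pinfty_gt.
  split => //.
  have mA : measurable (`]-oo, - K]%classic : set (measurableTypeR R)) by exact: measurable_itv.
  have mB : measurable (`]K, +oo[%classic : set (measurableTypeR R)) by exact: measurable_itv.
  apply: (@le_trans _ _ (fine (normal_prob (0 : R) s (`]-oo, - K]%classic `|` `]K, +oo[%classic)))).
    apply: le_fine_prob; [|exact: measurableU|].
      have -> : [set x : R | K < `|x|] = `]-oo, - K[%classic `|` `]K, +oo[%classic.
        apply/seteqP; split => x /=; rewrite !in_itv/= andbT ltr_normr ltrNr.
          by rewrite orbC => /orP.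
        by move=> h; rewrite orbC; apply/orP.
      by apply: measurableU; exact: measurable_itv.
    move=> x /=; rewrite !in_itv/= andbT ltr_normr => /orP[?|h]; first by right.
    by left; lra.
  rewrite (le_trans (fine_prob_setU _ mA mB))// (splitr e) lerD//.
    rewrite (le_trans (ler_norm _))//; near: K.
    by move/cvgr0Pnorm_le : h2; exact.
  rewrite (le_trans (ler_norm _))//; near: K.
  by move/cvgr0Pnorm_le : h1; exact.
by move=> /filter_ex[K [K0 Ke]]; exists K.
Unshelve. all: by end_near. Qed.

(** By Stein's equation, the third hypothesis says that E h(W n) tends to the normal mean of every
    smooth h. A bounded continuous f is replaced by a mollification accurate on [-K, K]; tightness
    of W and of the normal law handles the outside, and uniform continuity of f passes from W to
    Z. *)
Lemma stein_weak_cvg (R : realType) (s : R) (d : measure_display)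
    (T : measurableType d) (P : probability T R) (W Z : nat -> T -> R) (C : R) :
  0 < s ->
  (forall n, measurable_fun setT (W n)) ->
  (forall n, measurable_fun setT (Z n)) ->
  (forall (f f1 : R -> R) (C0 C1 C2 : R),
    [/\ forall x, `|f x| <= C0, forall x, `|f1 x| <= C1,
      forall x y, `|f x - f y| <= C1 * `|x - y|,
      forall x y, `|f1 x - f1 y| <= C2 * `|x - y| &
      forall x t, `|f (x + t) - f x - t * f1 x| <= C2 * t ^+ 2] ->
    \int[P]_w (s ^+ 2 * f1 (W n w) - W n w * f (W n w)) @[n --> \oo] --> (0 : R)) ->
  (forall K, 0 < K ->
    \forall n \near \oo, fine (P [set w | K < `|W n w|]) <= C / K ^+ 2) ->
  (forall eta : R, 0 < eta ->
    fine (P [set w | eta < `|Z n w - W n w|]) @[n --> \oo] --> (0 : R)) ->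
  weak_cvg P Z (normal_prob 0 s).
Proof.
move=> s0 mW mZ steinW tightW closeZ f cf [M fM].
have M0 : 0 <= M := le_trans (normr_ge0 _) (fM 0).
have mf : measurable_fun setT f by exact: continuous_measurable_fun.
have mfZ n : measurable_fun setT (f \o Z n) by exact: measurableT_comp.
have EZ n : 'E_P[f \o Z n]%E = (\int[P]_w f (Z n w))%:E.
  rewrite unlock /Rintegral fineK//; apply: integrable_fin_num => //.
  by apply: (bounded_integrable_prob P (f := f \o Z n) (B := M)) => // w; exact: fM.
have Ef : (\int[normal_prob 0 s]_x (f x)%:E = (normal_mean s f)%:E)%E.
  rewrite /normal_mean fineK//; apply: integrable_fin_num => //.
  by apply: (@bounded_integrable_prob _ _ _ (normal_prob 0 s) f M).
rewrite Ef; under eq_fun do rewrite EZ.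
apply: cvg_EFin; first by near=> n.
apply/cvgrPdist_le => e e0.
(* The errors add up to (4 + 6M) e': 2 + 4M from f(Z) to h(W), 1 from Stein's equation, 1 + 2M from
   comparing the normal means of h and f. *)
pose e' := e / (7 + 6 * M).
have D0 : 0 < 7 + 6 * M by rewrite ltr_wpDr// mulr_ge0.
have e'0 : 0 < e' by rewrite divr_gt0.
have [K1 K10 hK1] := normal_tail s0 e'0.
have [K2 K20 hK2] : exists2 K, 0 < K & C / K ^+ 2 <= e'.
  pose K := 1 + `|C| / e'; have c0 : 0 <= `|C| / e' by rewrite divr_ge0// ltW.
  have K1' : 1 <= K by rewrite lerDl.
  have K0 : 0 < K by rewrite (lt_le_trans ltr01).
  exists K => //; rewrite ler_pdivrMr ?exprn_gt0// (le_trans (ler_norm C))//.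
  rewrite (@le_trans _ _ (e' * K))//.
    by rewrite /K mulrDr mulr1 [_ * (_ / _)]mulrC divfK ?gt_eqF// lerDr ltW.
  by rewrite ler_wpM2l ?(ltW e'0)// expr2 ler_peMr// ltW.
pose K := Num.max K1 K2.
have K0 : 0 < K by rewrite lt_max K10.
have [h [h1 [B1 [dh hM h1B1 hf]]]] := mollify cf fM K0 e'0.
have [del del0 Hdel] := uniform_continuity_segment K cf e'0.
have [g [g1 [C0 [C1 [C2 [gC geq]]]]]] := stein_solution s0 dh hM h1B1.
have ch : continuous h by move=> x; exact: der_continuous (dh x).
have mh : measurable_fun setT h by exact: continuous_measurable_fun.
have mhW n : measurable_fun setT (h \o W n) by exact: measurableT_comp.
have third : `|normal_mean s f - normal_mean s h| <= e' + 2 * M * e'.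
  have i1 : (normal_prob (0 : R) s).-integrable setT (EFin \o f).
    exact: (@bounded_integrable_prob _ _ _ (normal_prob 0 s) f M).
  have i2 : (normal_prob (0 : R) s).-integrable setT (EFin \o h).
    exact: (@bounded_integrable_prob _ _ _ (normal_prob 0 s) h M).
  have -> : normal_mean s f - normal_mean s h =
      \int[normal_prob (0 : R) s]_x (f x - h x) by rewrite RintegralB.
  have mA : measurable ([set x : R | K < `|x|] : set (measurableTypeR R)).
    by apply: measurable_set_lt => //; exact: measurableT_comp.
  rewrite -mulrA; apply: (le_trans (@Rexp_indic_bound _ _ _ (normal_prob (0 : R) s)
     (fun x => f x - h x) [set x : R | K < `|x|] e' (2 * M) _ mA _ _)) => //.
  - exact: measurable_funB.
  - by rewrite mulr_ge0.
  - move=> x; rewrite indicE; have [xK|xK] := leP `|x| K.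
      rewrite memNset ?mulr0 ?addr0; first by rewrite distrC hf.
      by apply/negP; rewrite -leNgt.
    rewrite mem_set// mulr1 (le_trans (ler_normB _ _))//.
    have := fM x; have := hM x; lra.
  - rewrite lerD2l mulrA ler_wpM2l ?mulr_ge0// (le_trans _ hK1)//.
    apply: le_fine_prob => //; first by apply: measurable_set_lt => //; exact: measurableT_comp.
    by move=> x /=; apply: le_lt_trans; rewrite le_max lexx.
have second : \forall n \near \oo, `|\int[P]_w h (W n w) - normal_mean s h| <= e'.
  have := steinW g g1 C0 C1 C2 gC => /cvgr0Pnorm_le/(_ _ e'0).
  apply: filterS => n; rewrite (_ : (\int[P]_w _)%R = \int[P]_w h (W n w) - normal_mean s h)//.
  under eq_Rintegral do rewrite geq.
  rewrite RintegralB//.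
  - by rewrite Rexp_cst.
  - by apply: (bounded_integrable_prob P (f := h \o W n) (B := M)) => // w; exact: hM.
  - by apply: (bounded_integrable_prob P (B := `|normal_mean s h|)).
have first : \forall n \near \oo,
    `|\int[P]_w f (Z n w) - \int[P]_w h (W n w)| <= (e' + e') + 2 * M * (e' + e').
  have t1 := tightW _ K0.
  have t2 : \forall n \near \oo, fine (P [set w | del < `|Z n w - W n w|]) <= e'.
    have /cvgr0Pnorm_le/(_ _ e'0) := closeZ _ del0.
    by apply: filterS => n; apply: le_trans; exact: ler_norm.
  near=> n.
  have mA : measurable [set w | K < `|W n w|].
    by apply: measurable_set_lt => //; exact: measurableT_comp.
  have mA' : measurable [set w | del < `|Z n w - W n w|].
    by apply: measurable_set_lt => //; apply: measurableT_comp => //; exact: measurable_funB.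
  have -> : \int[P]_w f (Z n w) - \int[P]_w h (W n w) =
      \int[P]_w (f (Z n w) - h (W n w)).
    rewrite RintegralB//.
    - by apply: (bounded_integrable_prob P (f := f \o Z n) (B := M)) => // w; exact: fM.
    - by apply: (bounded_integrable_prob P (f := h \o W n) (B := M)) => // w; exact: hM.
  apply: (le_trans (@Rexp_indic_bound _ _ _ P (fun w => f (Z n w) - h (W n w))
    ([set w | K < `|W n w|] `|` [set w | del < `|Z n w - W n w|])
    (e' + e') (2 * M) _ _ _ _)).
  - exact: (measurable_funB (mfZ n) (mhW n)).
  - exact: measurableU.
  - by rewrite mulr_ge0.
  - move=> w; rewrite indicE; have [xK|xK] := leP `|W n w| K; last first.
      rewrite mem_set; last by left.
      rewrite mulr1 (le_trans (ler_normB _ _))//.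
      have := fM (Z n w); have := hM (W n w); lra.
    have [zd|zd] := leP `|Z n w - W n w| del; last first.
      rewrite mem_set; last by right.
      rewrite mulr1 (le_trans (ler_normB _ _))//.
      have := fM (Z n w); have := hM (W n w); lra.
    rewrite memNset ?mulr0 ?addr0; last first.
      by move=> [|]/=; apply/negP; rewrite -leNgt.
    rewrite -(subrKA (f (W n w))) (le_trans (ler_normD _ _))// lerD//.
      by apply: Hdel.
    by rewrite distrC hf.
  - rewrite lerD2l ler_wpM2l ?mulr_ge0// (le_trans (fine_prob_setU _ mA mA'))// lerD//.
      apply: (le_trans (_ : _ <= C / K ^+ 2)); first by near: n.
      apply: le_trans hK2.
      have C0' : 0 <= C.
        have : 0 <= C / K ^+ 2.
          by apply: (@le_trans _ _ (fine (P [set w | K < `|W n w|]))); [exact: fine_ge0|near: n].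
        by rewrite pmulr_lge0// invr_gt0 exprn_gt0.
      rewrite ler_wpM2l// lef_pV2 ?posrE ?exprn_gt0// lerXn2r ?nnegrE ?(ltW K0) ?(ltW K20)//.
      by rewrite le_max lexx orbT.
    by near: n.
near=> n.
have f1 : `|\int[P]_w f (Z n w) - \int[P]_w h (W n w)| <= (e' + e') + 2 * M * (e' + e').
  by near: n.
have f2 : `|\int[P]_w h (W n w) - normal_mean s h| <= e' by near: n.
rewrite -(subrKA (normal_mean s h)) (le_trans (ler_normD _ _))//.
rewrite -[normal_mean s h - _](subrKA (\int[P]_w h (W n w))).
apply: (le_trans (lerD (lexx _) (ler_normD _ _))).
rewrite [`|normal_mean s h - _|]distrC [`|_ - \int[P]_w f _|]distrC.
have ee : e' * (7 + 6 * M) = e by rewrite /e' divfK// gt_eqF.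
have Me := mulr_ge0 M0 (ltW e'0).
clearbody e'; lra.
Unshelve. all: by end_near. Qed.

Lemma powR_continuous (R : realType) (a x : R) : 0 < x ->
  {for x, continuous (fun t => t `^ a)}.
Proof. by move=> x0; exact: der_continuous (is_derive1_powR a x0). Qed.

Lemma cvg_near_le (R : realType) (u : nat -> R) (l e : R) : u n @[n --> \oo] --> l ->
  0 < e -> \forall n \near \oo, l - e <= u n <= l + e.
Proof.
move=> /cvgrPdist_le ul e0; have := ul _ e0; apply: filterS => n.
by rewrite distrC ler_norml => /andP[h1 h2]; apply/andP; split; lra.
Qed.

Lemma nat_fraction_between (R : realType) (x y : R) : 0 <= x -> x < y ->
  exists a b : nat, [/\ (0 < a)%N, (0 < b)%N & x < a%:R / b%:R < y].
Proof.
move=> x0 xy; have [q] := rat_in_itvoo xy; rewrite in_itv/= => /andP[xq qy].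
have q0 : 0 < q by rewrite -(ltr0q R) (le_lt_trans x0).
exists `|numq q|%N, `|denq q|%N; split.
- by rewrite absz_gt0 numq_eq0 gt_eqF.
- by rewrite absz_gt0 denq_eq0.
- by rewrite !natr_absz !gtr0_norm ?numq_gt0// xq.
Qed.

Lemma filterS4 (T : Type) (F : set_system T) (FF : Filter F) (A B C D E : set T) :
  (forall x, A x -> B x -> C x -> D x -> E x) -> F A -> F B -> F C -> F D -> F E.
Proof.
move=> h FA FB FC FD; apply: filterS2 (filterI FA FB) (filterI FC FD).
by move=> x [? ?] [? ?]; exact: h.
Qed.

Lemma filterS5 (T : Type) (F : set_system T) (FF : Filter F) (A B C D G E : set T) :
  (forall x, A x -> B x -> C x -> D x -> G x -> E x) ->
  F A -> F B -> F C -> F D -> F G -> F E.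
Proof.
move=> h FA FB FC FD FG; apply: filterS3 (filterI FA FB) (filterI FC FD) FG.
by move=> x [? ?] [? ?] ?; exact: h.
Qed.

(** * Monotone regularly varying sequences *)

Section regular_variation.
Variables (R : realType) (p : nat -> R) (rho : R).
Hypothesis p0 : forall i, (1 <= i)%N -> 0 < p i.
Hypothesis pni : forall i, (1 <= i)%N -> p i.+1 <= p i.
Hypothesis prv : forall a, (1 <= a)%N ->
  p (a * i)%N / p i @[i --> \oo] --> a%:R `^ (- rho).

Lemma p_le i j : (1 <= i)%N -> (i <= j)%N -> p j <= p i.
Proof.
move=> i1; elim: j => [|j IH]; first by rewrite leqn0 => /eqP->.
by rewrite leq_eqVlt => /predU1P[->//|]; rewrite ltnS => ij;
  rewrite (le_trans (pni (leq_trans i1 ij)))// IH.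
Qed.

Lemma rv_ratio a b (i : nat -> nat) : (0 < a)%N -> (0 < b)%N ->
  i n @[n --> \oo] --> \oo ->
  p (a * i n)%N / p (b * i n)%N @[n --> \oo] --> (a%:R / b%:R : R) `^ (- rho).
Proof.
move=> a0 b0 ioo.
have ha : p (a * i n)%N / p (i n) @[n --> \oo] --> a%:R `^ (- rho).
  exact: cvg_comp ioo (prv a0).
have hb : p (b * i n)%N / p (i n) @[n --> \oo] --> b%:R `^ (- rho).
  exact: cvg_comp ioo (prv b0).
have bn0 : (b%:R : R) `^ (- rho) != 0 by rewrite gt_eqF// powR_gt0// ltr0n.
have e : (a%:R / b%:R : R) `^ (- rho) = a%:R `^ (- rho) * (b%:R `^ (- rho))^-1.
  by rewrite powRM ?invr_ge0// -powRN opprK -(powR_inv1 (ler0n R b)) -powRrM mulN1r opprK.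
rewrite e; apply: cvg_trans (cvgM ha (cvgV bn0 hb)); apply: near_eq_cvg.
near=> n; have i1 : (1 <= i n)%N.
  by near: n; exact: (iffLR (cvgnyPge i) ioo 1%N).
rewrite /=; have := p0 i1; have : 0 < p (b * i n)%N by apply: p0; rewrite muln_gt0 b0.
by move=> h1 h2; field; rewrite !gt_eqF.
Unshelve. all: by end_near. Qed.

Section ratio.
Variables (i j : nat -> nat) (c : R).
Hypothesis c0 : 0 < c.
Hypothesis ioo : i n @[n --> \oo] --> \oo.
Hypothesis jic : (j n)%:R / (i n)%:R @[n --> \oo] --> c.

Let i_large (A : R) : \forall n \near \oo, A <= (i n)%:R.
Proof.
have /cvgnyPge/(_ (Num.trunc A).+1) := ioo; apply: filterS => n h.
by rewrite (le_trans (ltW (truncnS_gt A)))// ler_nat.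
Qed.

(** Take a rational a/b slightly below c and i' = floor(i/b) + 1. Then i <= b i' and eventually a i'
    <= j, so monotonicity bounds p(j)/p(i) by p(a i')/p(b i'), where the limits along integer
    multiples apply. *)
Lemma ratio_le e : 0 < e -> \forall n \near \oo, p (j n) / p (i n) <= c `^ (- rho) + e.
Proof.
move=> e0; have e2 : 0 < e / 2 by rewrite divr_gt0.
have : \forall x \near c, `|c `^ (- rho) - x `^ (- rho)| <= e / 2.
  have := @powR_continuous R (- rho) c c0; move/cvgrPdist_le; exact.
move=> /nbhs_ballP[d /= d0 hd].
pose x := Num.max 0 (c - d).
have xc : x < c by rewrite gt_max c0/= gtrBl.
have x0 : 0 <= x by rewrite le_max lexx.
have [a [b [a0 b0 /andP[xq qc]]]] := nat_fraction_between x0 xc.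
set q : R := a%:R / b%:R in xq qc.
have hq : q `^ (- rho) <= c `^ (- rho) + e / 2.
  have : `|c `^ (- rho) - q `^ (- rho)| <= e / 2.
    apply: hd; rewrite /ball/= gtr0_norm ?subr_gt0//.
    by move: xq; rewrite gt_max => /andP[_]; lra.
  by rewrite ler_norml => /andP[h _]; lra.
pose i' n := (i n %/ b).+1.
have i'oo : i' n @[n --> \oo] --> \oo.
  apply/cvgnyPge => A; have /cvgnyPge/(_ (A * b)%N) := ioo; apply: filterS => n h.
  by rewrite /i' (leq_trans _ (leqnSn _))// leq_divRL.
have := cvg_near_le (rv_ratio a0 b0 i'oo) e2.
have e3 : 0 < (c - q) / 2 by rewrite divr_gt0// subr_gt0.
have := cvg_near_le jic e3.
have := i_large (a%:R / ((c - q) / 2)); have := i_large 1.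
apply: filterS4 => n i1 iA /andP[hj _] /andP[_ hr].
have in0 : (0 : R) < (i n)%:R by exact: lt_le_trans i1.
have b0' : (0 : R) < b%:R by rewrite ltr0n.
have ibi : (i n <= b * i' n)%N by rewrite /i' mulnC ltnW// ltn_ceil.
have aij : (a * i' n <= j n)%N.
  rewrite -(ler_nat R); apply: (@le_trans _ _ ((c - (c - q) / 2) * (i n)%:R)); last first.
    by rewrite -ler_pdivlMr.
  rewrite ler_pdivrMr// in iA.
  apply: (@le_trans _ _ (q * (i n)%:R + a%:R)); last by lra.
  rewrite /i' natrM -natr1 mulrDr mulr1 lerD2r /q.
  rewrite -mulrA ler_wpM2l// mulrC ler_pdivlMr// -natrM ler_nat leq_divM//.
have j1 : (1 <= a * i' n)%N by rewrite muln_gt0 a0.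
have i1' : (1 <= i n)%N by rewrite -(ler_nat R).
have pj := p_le j1 aij; have pi := p_le i1' ibi.
have pi0 := p0 i1'; have pb0 : 0 < p (b * i' n)%N by apply: p0; rewrite (leq_trans i1').
apply: (@le_trans _ _ (p (a * i' n)%N / p (b * i' n)%N)); last by lra.
apply: ler_pM => //; rewrite ?invr_ge0 ?(ltW pi0)//.
  by rewrite ltW// p0// (leq_trans j1).
by rewrite lef_pV2.
Qed.

(** Mirror image of [ratio_le]: a/b slightly above c and i' = floor(i/b). *)
Lemma ratio_ge e : 0 < e -> \forall n \near \oo, c `^ (- rho) - e <= p (j n) / p (i n).
Proof.
move=> e0; have e2 : 0 < e / 2 by rewrite divr_gt0.
have : \forall x \near c, `|c `^ (- rho) - x `^ (- rho)| <= e / 2.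
  have := @powR_continuous R (- rho) c c0; move/cvgrPdist_le; exact.
move=> /nbhs_ballP[d /= d0 hd].
have xc : c < c + d by rewrite ltrDl.
have [a [b [a0 b0 /andP[xq qc]]]] := nat_fraction_between (ltW c0) xc.
set q : R := a%:R / b%:R in xq qc.
have hq : c `^ (- rho) - e / 2 <= q `^ (- rho).
  have : `|c `^ (- rho) - q `^ (- rho)| <= e / 2.
    apply: hd; rewrite /ball/= distrC gtr0_norm ?subr_gt0//.
    by lra.
  by rewrite ler_norml => /andP[_ h]; lra.
pose i' n := (i n %/ b)%N.
have i'oo : i' n @[n --> \oo] --> \oo.
  apply/cvgnyPge => A; have /cvgnyPge/(_ (A * b)%N) := ioo; apply: filterS => n h.
  by rewrite /i' leq_divRL.
have := cvg_near_le (rv_ratio a0 b0 i'oo) e2.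
have e3 : 0 < (q - c) / 2 by rewrite divr_gt0// subr_gt0.
have c2 : 0 < c / 2 by rewrite divr_gt0.
have := cvg_near_le jic c2.
have := cvg_near_le jic e3.
have := i_large (a%:R / ((q - c) / 2)); have := i_large b%:R.
apply: filterS5 => n ib iA /andP[_ hj] /andP[jc _] /andP[hr _].
have b0' : (0 : R) < b%:R by rewrite ltr0n.
have in0 : (0 : R) < (i n)%:R by exact: lt_le_trans ib.
have i1 : (1 <= i' n)%N by rewrite /i' divn_gt0// -(ler_nat R).
have ibi : (b * i' n <= i n)%N by rewrite /i' mulnC leq_divM.
have jn1 : (1 <= j n)%N.
  rewrite -(ltr_nat R); have : 0 < (j n)%:R / (i n)%:R :> R by lra.
  by rewrite pmulr_lgt0// invr_gt0.
have aij : (j n <= a * i' n)%N.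
  rewrite -(ler_nat R); apply: (@le_trans _ _ ((c + (q - c) / 2) * (i n)%:R)).
    by rewrite -ler_pdivrMr.
  rewrite ler_pdivrMr// in iA.
  apply: (@le_trans _ _ (q * (i n)%:R - a%:R)); first by lra.
  rewrite lerBlDr natrM -[X in _ + X]mulr1 -mulrDr natr1 /q -mulrA ler_wpM2l//.
  by rewrite mulrC ler_pdivrMr// -natrM ler_nat /i' ltnW// ltn_ceil.
have pj := p_le jn1 aij; have b1 : (1 <= b * i' n)%N by rewrite muln_gt0 b0.
have pi := p_le b1 ibi.
have pi0 : 0 < p (i n) by apply: p0; rewrite (leq_trans b1).
have pb0 := p0 b1.
apply: (@le_trans _ _ (p (a * i' n)%N / p (b * i' n)%N)); first by lra.
apply: ler_pM => //; rewrite ?invr_ge0 ?(ltW pb0)//.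
  by rewrite ltW// p0// (leq_trans jn1).
by rewrite lef_pV2.
Qed.

Lemma ratio_cvg : p (j n) / p (i n) @[n --> \oo] --> c `^ (- rho).
Proof.
apply/cvgrPdist_le => e e0; have := ratio_le e0; have := ratio_ge e0.
apply: filterS2 => n h1 h2.
by rewrite distrC ler_norml; apply/andP; split; lra.
Qed.

End ratio.
End regular_variation.

(** * The counting function alpha(n) and urn probabilities at scale alpha(n) *)

Section urn_counting.
Variables (R : realType) (p : nat -> R) (rho : R).
Hypothesis p0 : forall i, (1 <= i)%N -> 0 < p i.
Hypothesis pni : forall i, (1 <= i)%N -> p i.+1 <= p i.
Hypothesis pinv : forall i, (1 <= i)%N -> p i <= i%:R^-1.
Hypothesis prv : forall a, (1 <= a)%N ->
  p (a * i)%N / p i @[i --> \oo] --> a%:R `^ (- rho).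
Hypothesis rho1 : 1 < rho.

Definition urn_al n := urn_alpha p n%:R.
Local Notation al := urn_al.

Lemma urn_al_set n : (0 < n)%N -> finite_set [set j | (1 <= j)%N /\ n%:R^-1 <= p j].
Proof.
move=> n0; apply: (@sub_finite_set _ _ `I_n.+1); last exact: finite_II.
move=> j [j1 pj] /=; rewrite ltnS -(ler_nat R).
have := le_trans pj (pinv j1).
by rewrite lef_pV2 ?posrE ?ltr0n.
Qed.

Lemma le_urn_al n j : (0 < n)%N -> (1 <= j)%N -> n%:R^-1 <= p j -> (j <= al n)%N.
Proof.
move=> n0 j1 pj; rewrite /al /urn_alpha (fsbig_finite _ _ (urn_al_set n0))/=.
apply: (leq_bigmax_seq (F := fun j => j)) => //.
by rewrite in_fset_set ?mem_set//; exact: urn_al_set.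
Qed.

Lemma urn_al_spec n : (0 < n)%N -> n%:R^-1 <= p 1%N ->
  [/\ (1 <= al n)%N, n%:R^-1 <= p (al n), p (al n).+1 < n%:R^-1 & (al n <= n)%N].
Proof.
move=> n0 p1; pose Q j := (1 <= j)%N && (n%:R^-1 <= p j).
have exQ : exists j, Q j by exists 1%N; rewrite /Q p1.
have Qn j : Q j -> (j <= n)%N.
  move=> /andP[j1 pj]; have := le_trans pj (pinv j1).
  by rewrite lef_pV2 ?posrE ?ltr0n// ler_nat.
case: (ex_maxnP exQ Qn) => m /andP[m1 pm] mmax.
have -> : al n = m.
  apply/eqP; rewrite eqn_leq (le_urn_al n0 m1 pm) andbT.
  rewrite /al /urn_alpha (fsbig_finite _ _ (urn_al_set n0))/=.
  apply/bigmax_leqP_seq => j; rewrite in_fset_set; last exact: urn_al_set.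
  by rewrite inE/= => -[j1 pj] _; apply: mmax; rewrite /Q j1.
split => //; last by apply: Qn; rewrite /Q m1.
by rewrite ltNge; apply/negP => h; have := mmax m.+1; rewrite /Q h ltnn => /(_ isT).
Qed.

Lemma near_p1 : \forall n \near \oo, (0 < n)%N /\ n%:R^-1 <= p 1%N.
Proof.
near=> n; have n0 : (0 < n)%N by near: n; exact: nbhs_infty_gt.
split => //; rewrite invf_ple ?posrE ?ltr0n ?p0//.
near: n; exact: nbhs_infty_ger.
Unshelve. all: by end_near. Qed.

Lemma urn_al_cvgy : al n @[n --> \oo] --> \oo.
Proof.
apply/cvgnyPge => A; near=> n.
have n0 : (0 < n)%N by near: n; exact: nbhs_infty_gt.
apply: (leq_trans (leqnSn A)); apply: le_urn_al => //.
rewrite invf_ple ?posrE ?ltr0n ?p0//; near: n; exact: nbhs_infty_ger.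
Unshelve. all: by end_near. Qed.

(** By definition of alpha, 1/n lies between p(al + 1) and p(al), and the ratio of these two tends
    to 1. *)
Lemma p_al_cvg : n%:R * p (al n) @[n --> \oo] --> (1 : R).
Proof.
have aloo := urn_al_cvgy.
have al1 : (al n).+1%:R / (al n)%:R @[n --> \oo] --> (1 : R).
  rewrite -[X in _ --> X]addr0.
  have : 1 + ((al n)%:R)^-1 @[n --> \oo] --> (1 + 0 : R).
    apply: cvgD; first exact: cvg_cst.
    have : ((al n)%:R : R) @[n --> \oo] --> +oo%R by exact: cvg_comp aloo (@cvgr_idn R).
    by move=> h; exact: cvg_comp h (@inv_cvgy R).
  apply: cvg_trans; apply: near_eq_cvg; near=> n.
  have a1 : (0 < al n)%N by near: n; exact: (iffLR (cvgnyPge _) aloo 1%N).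
  by rewrite -natr1 mulrDl divff ?mul1r// pnatr_eq0 -lt0n.
have := ratio_cvg p0 pni prv ltr01 aloo al1; rewrite powR1 => rat.
have rV : (p (al n).+1 / p (al n))^-1 @[n --> \oo] --> (1 : R).
  by rewrite -[X in _ --> X]invr1; apply: cvgV => //; exact: oner_neq0.
apply: (@squeeze_cvgr _ _ _ _ (fun=> 1) (fun n => (p (al n).+1 / p (al n))^-1)) => //; last exact: cvg_cst.
near=> n.
have [n0 p1] : (0 < n)%N /\ n%:R^-1 <= p 1%N by near: n; exact: near_p1.
have [a1 pa pa1 _] := urn_al_spec n0 p1.
have n0' : (0 : R) < n%:R by rewrite ltr0n.
have pp : 0 < p (al n).+1 by exact: p0.
rewrite invfM invrK -ler_pdivrMl// mulr1 pa/= mulrC [leRHS]mulrC ler_wpM2l//.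
  by rewrite ltW// p0.
by rewrite -[leLHS]invrK lef_pV2 ?posrE ?invr_gt0// ltW.
Unshelve. all: by end_near. Qed.

(** If the urns, numbered from 1, occupy successive cells of width 1 / [al n] on the half-line, this
    is the urn whose cell contains c. *)
Definition urn_idx n (c : R) := (Num.trunc (c * (al n)%:R)).+1.

Lemma urn_idx_cvg (c : R) : 0 < c ->
  n%:R * p (urn_idx n c) @[n --> \oo] --> c `^ (- rho).
Proof.
move=> c0; have aloo := urn_al_cvgy.
have alyR : ((al n)%:R : R) @[n --> \oo] --> +oo%R by exact: cvg_comp aloo (@cvgr_idn R).
have idx1 : (urn_idx n c)%:R / (al n)%:R @[n --> \oo] --> c.
  apply: (@squeeze_cvgr _ _ _ _ (fun=> c) (fun n => c + ((al n)%:R)^-1)).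
  - near=> n.
    have a1 : (0 < al n)%N by near: n; exact: (iffLR (cvgnyPge _) aloo 1%N).
    have a1' : (0 : R) < (al n)%:R by rewrite ltr0n.
    rewrite ler_pdivlMr// (ltW (truncnS_gt _))/= ler_pdivrMr// mulrDl mulVf ?gt_eqF//.
    by rewrite /urn_idx -natr1 lerD2r truncn_le mulr_ge0// ltW.
  - exact: cvg_cst.
  - rewrite -[X in _ --> X]addr0; apply: cvgD; first exact: cvg_cst.
    exact: cvg_comp alyR (@inv_cvgy R).
have := ratio_cvg p0 pni prv c0 aloo idx1 => rat.
rewrite -[X in _ --> X]mul1r; apply: cvg_trans (cvgM p_al_cvg rat).
apply: near_eq_cvg; near=> n.
have a1 : (0 < al n)%N by near: n; exact: (iffLR (cvgnyPge _) aloo 1%N).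
by rewrite /=; field; rewrite gt_eqF// p0.
Unshelve. all: by end_near. Qed.

(** Strictly between 1 and rho: c^(-rho') is integrable at infinity, and the gap below rho absorbs
    the slowly varying factor. *)
Let rho' := (1 + rho) / 2.

Let kappa : R := 2 `^ (- rho').

Let near_double : exists i0, forall i, (i0 <= i)%N -> (1 <= i)%N -> p (2 * i)%N <= kappa * p i.
Proof.
have kr : (2 : R) `^ (- rho) < kappa.
  rewrite /kappa !powRN ltf_pV2 ?posrE ?powR_gt0//.
  rewrite /powR pnatr_eq0/= ltr_expR ltr_pM2r ?ln_gt0 ?ltr1n// /rho'; have := rho1; lra.
have e0 : 0 < kappa - 2 `^ (- rho) by rewrite subr_gt0.
have [i0 _ h] := cvg_near_le (prv (isT : (1 <= 2)%N)) e0.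
exists i0 => i ii0 i1; have /andP[_] := h i ii0.
by rewrite addrC subrK ler_pdivrMr// p0.
Qed.

(** A Potter-type bound. Far enough out, doubling the index multiplies p by at most 2^(-rho'). This
    is iterated m times from [al n], where 2^m <= c < 2^(m+1); the factor 2^rho' covers the rounding
    of c to a power of 2, and the factor 2 bounds n p(al n). *)
Lemma urn_idx_dom : exists C, 0 < C /\ \forall n \near \oo, forall c : R, 1 <= c ->
  n%:R * p (urn_idx n c) <= C * c `^ (- rho').
Proof.
have [i0 hi0] := near_double.
have k0 : 0 < kappa by exact: powR_gt0.
have r'0 : 0 <= rho' by rewrite /rho' divr_ge0// addr_ge0// (le_trans ler01)// ltW.
exists (2 * 2 `^ rho'); split; first by rewrite mulr_gt0// powR_gt0.
have aloo := urn_al_cvgy.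
have p2 : \forall n \near \oo, n%:R * p (al n) <= 2.
  have := cvg_near_le p_al_cvg (ltr01 : 0 < 1 :> R).
  by apply: filterS => n /andP[_].
near=> n => c c1.
have a1 : (0 < al n)%N by near: n; exact: (iffLR (cvgnyPge _) aloo 1%N).
have ai0 : (i0 <= al n)%N by near: n; exact: (iffLR (cvgnyPge _) aloo i0).
have pow m : p (2 ^ m * al n)%N <= kappa ^+ m * p (al n).
  elim: m => [|m IH]; first by rewrite mul1n expr0 mul1r.
  have m1 : (al n <= 2 ^ m * al n)%N by rewrite leq_pmull// expn_gt0.
  rewrite expnS -mulnA exprS -mulrA (le_trans (hi0 _ _ _))//.
  - exact: leq_trans ai0 m1.
  - exact: leq_trans a1 m1.
  - by rewrite ler_wpM2l// ltW.
have [m /andP[mc cm]] : exists m, (2 ^+ m <= c) && (c < 2 ^+ m.+1).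
  pose Q m := 2 ^+ m <= c.
  have exQ : exists m, Q m by exists 0%N; rewrite /Q expr0.
  have bQ m : Q m -> (m <= Num.trunc c)%N.
    rewrite /Q => h; rewrite truncn_ge_nat ?(le_trans ler01 c1)//.
    by apply: le_trans h; rewrite -natrX ler_nat ltnW// ltn_expl.
  case: (ex_maxnP exQ bQ) => m Qm mmax; exists m; rewrite [X in X && _]Qm/=.
  by rewrite ltNge; apply/negP => h; have := mmax m.+1 h; rewrite ltnn.
have idx : (2 ^ m * al n <= urn_idx n c)%N.
  rewrite /urn_idx -(ler_nat R) natrM natrX; apply: ltW; apply: le_lt_trans (truncnS_gt _).
  by rewrite ler_wpM2r.
have i1 : (1 <= 2 ^ m * al n)%N by rewrite muln_gt0 expn_gt0.
have kc : kappa ^+ m <= 2 `^ rho' * c `^ (- rho').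
  have -> : kappa ^+ m = 2 `^ rho' * (2 ^+ m.+1) `^ (- rho').
    rewrite -powR_mulrn ?ltW// /kappa -powRrM -powR_mulrn// -powRrM -powRD; last first.
      by rewrite pnatr_eq0/= implybT.
    congr powR; rewrite -natr1; ring.
  rewrite ler_wpM2l ?powR_ge0// !powRN lef_pV2 ?posrE ?powR_gt0 ?exprn_gt0//; last first.
    by rewrite (lt_le_trans ltr01).
  by rewrite ge0_ler_powR ?nnegrE ?exprn_ge0 ?(le_trans ler01 c1)// ltW.
apply: (@le_trans _ _ (n%:R * (kappa ^+ m * p (al n)))).
  by rewrite ler_wpM2l// (le_trans (p_le pni i1 idx)).
rewrite mulrCA [leLHS]mulrC -[leRHS]mulrA; apply: ler_pM => //.
- by rewrite mulr_ge0// ltW// p0.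
- by rewrite exprn_ge0 ?ltW.
- by near: n.
Unshelve. all: by end_near. Qed.

End urn_counting.

Lemma powRN_cvgy (R : realType) (a : R) : 0 < a -> x `^ (- a) @[x --> +oo] --> (0 : R).
Proof.
move=> a0; apply/cvgr0Pnorm_le => e e0; near=> x.
have x0 : 0 < x by near: x; exact: nbhs_pinfty_gt.
rewrite ger0_norm ?powR_ge0// powRN invf_ple ?posrE ?powR_gt0//.
have -> : e^-1 = (e^-1 `^ a^-1) `^ a.
  by rewrite -powRrM mulVf ?gt_eqF// powRr1// invr_ge0 ltW.
rewrite ge0_ler_powR ?nnegrE ?powR_ge0 ?(ltW a0) ?(ltW x0)//.
Unshelve. all: by end_near. Qed.

Lemma shifted_powR_integrable (R : realType) (a C : R) : 1 < a ->
  (@lebesgue_measure R).-integrable `]0, +oo[ (fun x => (C * (1 + x) `^ (- a))%:E).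
Proof.
move=> a1; have a1' : 1 - a != 0 by rewrite subr_eq0 eq_sym gt_eqF.
pose f (x : R) := (1 + x) `^ (- a).
pose F (x : R) := (1 - a)^-1 * (1 + x) `^ (1 - a).
have dx (x : R) : is_derive x (1 : R) (fun t => 1 + t) 1.
  by apply: (is_derive_eq (derD (der_cst 1 x) (der_id x))); rewrite add0r.
have dF (x : R) : 0 <= x -> is_derive x (1 : R) F (f x).
  move=> x0; have x1 : 0 < 1 + x by lra.
  apply: (is_derive_eq (derZ (1 - a)^-1 (der_comp (is_derive1_powR (1 - a) x1) (dx x)))).
  by rewrite mulr1 mulKf// /f; congr powR; ring.
have cf (x : R) : 0 <= x -> {for x, continuous f}.
  move=> x0; have x1 : 0 < 1 + x by lra.
  exact: der_continuous (der_comp (is_derive1_powR (- a) x1) (dx x)).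
have f0 x : 0 <= f x by exact: powR_ge0.
have Fy : F x @[x --> +oo] --> (0 : R).
  apply: cvg0Z; have -> : 1 - a = - (a - 1) by ring.
  have h : (1 + x : R) @[x --> +oo] --> +oo%R by exact: cvg_addrl.
  have a10 : 0 < a - 1 by lra.
  exact: cvg_comp h (powRN_cvgy a10).
have If : (\int[lebesgue_measure]_(x in `[0%R, +oo[) (f x)%:E = 0%:E - (F 0%R)%:E)%E.
  apply: (ge0_continuous_FTC2y _ _ Fy) => //.
  - by apply: continuous_in_subspaceT => x; rewrite inE/= in_itv/= andbT; exact: cf.
  - by move=> x x0; have [] := dF x (ltW x0).
  - by apply: cvg_at_right_filter; exact: der_continuous (dF 0 (lexx 0)).
  - move=> x; rewrite in_itv/= andbT => x0; rewrite derive1E.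
    by have [_ ->] := dF x (ltW x0).
have mf : measurable_fun setT f.
  apply: (measurableT_comp (measurable_powR (- a))); exact: measurable_funD.
have intf : (@lebesgue_measure R).-integrable `[0, +oo[ (EFin \o f).
  apply/integrableP; split; first by apply/measurable_EFinP; exact: measurable_funTS.
  under eq_integral do rewrite /= ger0_norm//.
  by rewrite If -EFinB ltry.
have : (@lebesgue_measure R).-integrable `]0, +oo[ (fun x => C%:E * (f x)%:E)%E.
  apply: integrableZl => //; apply: integrableS intf => //.
  by move=> x /=; rewrite !in_itv/= !andbT; exact: ltW.
by apply: eq_integrable => // x _; rewrite EFinM.
Unshelve. all: by end_near. Qed.

(** * Sums over urns as Riemann sums *)

Section urn_sums.
Variables (R : realType) (p : nat -> R) (rho : R).
Hypothesis p0 : forall i, (1 <= i)%N -> 0 < p i.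
Hypothesis pni : forall i, (1 <= i)%N -> p i.+1 <= p i.
Hypothesis pinv : forall i, (1 <= i)%N -> p i <= i%:R^-1.
Hypothesis prv : forall a, (1 <= a)%N ->
  p (a * i)%N / p i @[i --> \oo] --> a%:R `^ (- rho).
Hypothesis rho1 : 1 < rho.
Local Notation al := (urn_al p).
Local Notation mu := (@lebesgue_measure R).

Variables (M : nat -> nat) (h_ : nat -> R -> R) (h : R -> R) (K : R).
Hypothesis Mn : forall n, (n * n <= M n)%N.
Hypothesis K0 : 0 <= K.
Hypothesis h_cvg : forall (x_ : nat -> R) (x : R), 0 < x ->
  x_ n @[n --> \oo] --> x -> h_ n (x_ n) @[n --> \oo] --> h x.
Hypothesis h_dom : forall n (x : R), 0 <= x -> x <= n%:R ->
  `|h_ n x| <= K * Num.min 1 x.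
Hypothesis mh : measurable_fun setT h.

Let a n i := h_ n (n%:R * p i.+1).

Let cell n (i : nat) : set R := `[i%:R / (al n)%:R, i.+1%:R / (al n)%:R[%classic.

Let g n (c : R) := \sum_(i < M n) a n i * \1_(cell n i) c.

Let cellP n i (c : R) : (0 < al n)%N -> 0 <= c ->
  (c \in cell n i) = (Num.trunc (c * (al n)%:R) == i).
Proof.
move=> a0 c0; have a0' : (0 : R) < (al n)%:R by rewrite ltr0n.
rewrite truncn_eq ?mulr_ge0//; apply/idP/idP.
  by rewrite inE /cell/= in_itv/= ler_pdivrMr// ltr_pdivlMr.
by move=> h'; rewrite inE /cell/= in_itv/= ler_pdivrMr// ltr_pdivlMr.
Qed.

Let g_val n (c : R) : (0 < al n)%N -> 0 <= c ->
  g n c = if (Num.trunc (c * (al n)%:R) < M n)%N then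
    h_ n (n%:R * p (urn_idx p n c)) else 0.
Proof.
move=> a0 c0; case: ifPn => tM.
  rewrite /g (bigD1 (Ordinal tM))//= big1 ?addr0 => [|i it].
    by rewrite indicE cellP// eqxx mulr1.
  rewrite indicE cellP//; case: eqP => [e|_]; last by rewrite mulr0.
  by move: it; rewrite -val_eqE/= e eqxx.
rewrite /g big1// => i _; rewrite indicE cellP//; case: eqP => [e|_]; last by rewrite mulr0.
by move: tM; rewrite e ltn_ord.
Qed.

Let measurable_cell n i : measurable (cell n i).
Proof. exact: measurable_itv. Qed.

Let measurable_g n : measurable_fun setT (g n).
Proof.
by apply: measurable_sum => i; apply: measurable_funM => //.
Qed.

Let mu_cell n i : (0 < al n)%N -> mu (cell n i `&` `]0, +oo[) = ((al n)%:R^-1)%:E.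
Proof.
move=> a0; have a0' : (0 : R) < (al n)%:R by rewrite ltr0n.
have e (j : nat) : (j.+1%:R / (al n)%:R - j%:R / (al n)%:R : R) = (al n)%:R^-1.
  by rewrite -natr1 mulrDl addrAC subrr add0r mul1r.
have lt (j : nat) : (j%:R / (al n)%:R : R) < j.+1%:R / (al n)%:R.
  by rewrite ltr_pM2r ?invr_gt0// ltr_nat.
have [i0|i0] := posnP i.
  have -> : cell n i `&` `]0, +oo[ = `]i%:R / (al n)%:R, i.+1%:R / (al n)%:R[%classic.
    rewrite i0 /cell mul0r; apply/seteqP; split => c /=; rewrite !in_itv/= ?andbT.
      by move=> [/andP[_ ->] ->].
    by move=> /andP[c0 c1]; rewrite ltW// c1.
  by rewrite lebesgue_measure_itv/= lte_fin lt -EFinD e.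
have -> : cell n i `&` `]0, +oo[ = `[i%:R / (al n)%:R, i.+1%:R / (al n)%:R[%classic.
  apply/setIidl => c; rewrite /cell/= !in_itv/= andbT => /andP[ic _].
  by rewrite (lt_le_trans _ ic)// divr_gt0// ltr0n.
by rewrite lebesgue_measure_itv/= lte_fin lt -EFinD e.
Qed.

Let integral_g n : (0 < al n)%N ->
  (\int[mu]_(c in `]0%R, +oo[) (g n c)%:E = ((\sum_(i < M n) a n i) / (al n)%:R)%:E)%E.
Proof.
move=> a0.
have mD : measurable (`]0, +oo[%classic : set (measurableTypeR R)) by exact: measurable_itv.
have intI i : mu.-integrable `]0, +oo[ (fun c => (\1_(cell n i) c)%:E).
  apply/integrableP; split.
    apply/measurable_EFinP/measurable_funTS; apply: measurable_indic.
    exact: measurable_cell.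
  have E : (\int[mu]_(x in `]0%R, +oo[) `|(\1_(cell n i) x)%:E|)%E = ((al n)%:R^-1)%:E.
    transitivity (\int[mu]_(x in `]0%R, +oo[) (\1_(cell n i) x)%:E)%E.
      by apply: eq_integral => c _; rewrite gee0_abs// lee_fin indicE.
    by rewrite integral_indic//; [exact: mu_cell|exact: measurable_cell].
  by apply: (le_lt_trans (y := ((al n)%:R^-1)%:E)); [rewrite -E|rewrite ltry].
under eq_integral do rewrite -sumEFin.
rewrite integral_sum//; last first.
  move=> i; have := integrableZl mD (a n i) (intI i).
  by apply: eq_integrable => // c _; rewrite EFinM.
rewrite (eq_bigr (fun i : 'I_(M n) => (a n i / (al n)%:R)%:E)).
  by rewrite sumEFin mulr_suml.
move=> i _; under eq_integral do rewrite EFinM.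
rewrite integralZl// integral_indic//; last exact: measurable_cell.
by rewrite EFinM; congr (_ * _)%E; exact: mu_cell.
Qed.

(** The normalized sum is the integral of the step function [g n], equal on the cell of each urn to
    that urn's summand. It converges pointwise by [urn_idx_cvg], and [h_dom] with [urn_idx_dom]
    dominates it. *)
Lemma urn_sum_dct :
  mu.-integrable `]0, +oo[ (fun c => (h (c `^ (- rho)))%:E) /\
  (\sum_(i < M n) h_ n (n%:R * p i.+1)) / (al n)%:R @[n --> \oo] -->
    \int[mu]_(c in `]0, +oo[) h (c `^ (- rho)).
Proof.
have aloo := urn_al_cvgy p0 pinv.
have al0 : \forall n \near \oo, (0 < al n)%N by exact: (iffLR (cvgnyPge _) aloo 1%N).
have [C [C0 dom]] := urn_idx_dom p0 pni pinv prv rho1.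
pose r' := (1 + rho) / 2.
have r'1 : 1 < r' by rewrite /r'; have := rho1; lra.
(* The factor 2^r' lets (1 + c)^(-r') dominate both the constant 1 for c <= 1 and c^(-r') for c >=
   1. *)
pose G (c : R) := (K * (Num.max 1 C * 2 `^ r')) * (1 + c) `^ (- r').
have Gdom n (c : R) : 0 < c -> (0 < al n)%N -> (0 < n)%N ->
    (forall c : R, 1 <= c -> n%:R * p (urn_idx p n c) <= C * c `^ (- r')) ->
    `|g n c| <= G c.
  move=> c0 a0 n0 hC.
  have r'0 : 0 <= r' by rewrite (le_trans ler01)// ltW.
  have c10 : 0 < 1 + c by rewrite addr_gt0.
  have G0 : 0 <= G c.
    by rewrite /G !mulr_ge0// ?powR_ge0// le_max ler01.
  rewrite g_val ?(ltW c0)//; case: ifP => // _; last by rewrite normr0.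
  set x := n%:R * _; have pi0 : 0 < p (urn_idx p n c) by exact: p0.
  have x0 : 0 <= x by rewrite mulr_ge0// ltW.
  have xn : x <= n%:R.
    rewrite ler_piMr// (le_trans (p_le pni (isT : (1 <= 1)%N) (isT : (1 <= urn_idx p n c)%N)))//.
    by rewrite (le_trans (pinv _))// invr1.
  rewrite (le_trans (h_dom x0 xn))// /G -mulrA ler_wpM2l//.
  have [c1|c1] := leP c 1.
    rewrite (@le_trans _ _ 1)// ?ge_min ?lexx// powRN ler_pdivlMr ?powR_gt0// mul1r.
    apply: (@le_trans _ _ (2 `^ r')).
      by rewrite ge0_ler_powR ?nnegrE// ?(ltW c10)//; lra.
    by rewrite ler_peMl ?powR_ge0// le_max lexx.
  rewrite ge_min; apply/orP; right; rewrite (le_trans (hC c (ltW c1)))// -mulrA.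
  apply: ler_pM; rewrite ?powR_ge0 ?(ltW C0)//; first by rewrite le_max lexx orbT.
  rewrite !powRN ler_pdivlMr ?powR_gt0// mulrC ler_pdivrMr ?powR_gt0//.
  rewrite -powRM ?(ltW c0)//; apply: ge0_ler_powR => //.
  - by rewrite nnegrE ltW.
  - by rewrite nnegrE mulr_ge0// ltW.
  - by rewrite mulr2n mulrDl mul1r lerD2r ltW.
have [N _ hN] : \forall n \near \oo, [/\ (0 < al n)%N, (0 < n)%N &
    forall c : R, 1 <= c -> n%:R * p (urn_idx p n c) <= C * c `^ (- r')].
  near=> n; split; [by near: n|by near: n; exact: nbhs_infty_gt|].
  by near: n; exact: dom.
have mD : measurable (`]0, +oo[%classic : set (measurableTypeR R)) by exact: measurable_itv.
have ptw (c : R) : 0 < c -> g n c @[n --> \oo] --> h (c `^ (- rho)).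
  move=> c0; have cr0 : 0 < c `^ (- rho) by exact: powR_gt0.
  have := h_cvg cr0 (urn_idx_cvg p0 pni pinv prv c0).
  apply: cvg_trans; apply: near_eq_cvg; near=> n.
  have [a0 n0 _] : [/\ (0 < al n)%N, (0 < n)%N &
    forall c : R, 1 <= c -> n%:R * p (urn_idx p n c) <= C * c `^ (- r')].
    by apply: hN; near: n; exists N.
  rewrite g_val ?(ltW c0)// ifT//.
  have pn : n%:R^-1 <= p 1%N by near: n; apply: filterS (near_p1 p0) => n [].
  have [_ _ _ aln] := urn_al_spec pinv n0 pn.
  (* Since al n <= n, once n > c the index of the cell of c is below n^2 <= M n, so its urn is among
     those kept. *)
  apply: leq_trans (Mn n); rewrite truncn_lt_nat ?mulr_ge0 ?(ltW c0)// natrM.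
  rewrite (@le_lt_trans _ _ (c * n%:R))// ?ler_wpM2l ?ler_nat ?(ltW c0)//.
  rewrite ltr_pM2r ?ltr0n//; near: n; exact: nbhs_infty_gtr.
have [] := @dominated_convergence _ _ _ mu `]0, +oo[%classic mD
  (fun n c => (g (n + N)%N c)%:E) (fun c => (h (c `^ (- rho)))%:E) (fun c => (G c)%:E).
- move=> n; apply/measurable_EFinP/measurable_funTS; exact: measurable_g.
- apply/measurable_EFinP/measurable_funTS; apply: (measurableT_comp mh).
  exact: measurable_powR.
- apply: aeW => c /=; rewrite in_itv/= andbT => c0.
  apply: cvg_EFin; first by near=> n.
  have := ptw c c0; rewrite -(cvg_shiftn N); exact.
- exact: shifted_powR_integrable.
- apply: aeW => c n /=; rewrite in_itv/= andbT => c0; rewrite lee_fin.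
  have [a0 n0 hC] := hN (n + N)%N (leq_addl n N).
  exact: Gdom.
move=> ih _ cv; split => //.
rewrite -(cvg_shiftn N).
have := fine_cvg (a := \int[mu]_(c in `]0, +oo[) h (c `^ (- rho))).
rewrite fineK; last exact: integrable_fin_num.
move=> /(_ _ _ _ _ cv); apply: cvg_trans; apply: near_eq_cvg; near=> n.
have [a0 n0 hC] := hN (n + N)%N (leq_addl n N).
by rewrite /= integral_g.
Unshelve. all: by end_near. Qed.

End urn_sums.

(** * Integrals as limits over growing compact intervals *)

Section interval_integrals.
Variable R : realType.
Local Notation mu := (@lebesgue_measure R).
Implicit Types (f F : R -> R) (u v : nat -> R).

Lemma Rintegral_FTC (D : set R) f F (a b : R) : a < b -> `[a, b] `<=` D ->
  (forall x : R, D x -> is_derive x (1 : R) F (f x)) ->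
  (forall x : R, D x -> {for x, continuous f}) ->
  \int[mu]_(x in `[a, b]) f x = F b - F a.
Proof.
move=> ab abD dF cf.
have Dab (x : R) : a <= x <= b -> D x by move=> xab; apply: abD; rewrite /= in_itv.
have cF (x : R) : a <= x <= b -> {for x, continuous F}.
  by move=> xab; exact: der_continuous (dF x (Dab x xab)).
rewrite /Rintegral (@continuous_FTC2 _ f F a b ab)//.
- by apply: continuous_in_subspaceT => x; rewrite inE/= in_itv/= => /Dab; exact: cf.
- split.
  + move=> x; rewrite in_itv/= => /andP[ax xb].
    by have [] := dF x (Dab x _) => //; rewrite !ltW.
  + by apply: cvg_at_right_filter; apply: cF; rewrite lexx ltW.
  + by apply: cvg_at_left_filter; apply: cF; rewrite lexx ltW.
- move=> x; rewrite in_itv/= => /andP[ax xb]; rewrite derive1E.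
  have Dx : D x by apply: Dab; rewrite !ltW.
  by have [_ ->] := dF x Dx.
Qed.

Variables (D : set R) (u v : nat -> R).
Hypothesis und : forall n, u n.+1 <= u n.
Hypothesis vnd : forall n, v n <= v n.+1.
Hypothesis uvD : forall n, `[u n, v n] `<=` D.
Hypothesis Duv : forall x, D x -> exists n, u n <= x <= v n.

Lemma exhaustion_cvge f : measurable_fun D f -> (forall x, D x -> 0 <= f x) ->
  (\int[mu]_(x in `[u n, v n]) (f x)%:E @[n --> \oo] --> \int[mu]_(x in D) (f x)%:E)%E.
Proof.
move=> mf f0.
have -> : D = \bigcup_n `[u n, v n]%classic.
  apply/seteqP; split => x; last by move=> [n _]; exact: uvD.
  by move=> /Duv[n xn]; exists n => //=; rewrite in_itv.
apply: ge0_nondecreasing_set_cvg_integral.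
- apply/nondecreasing_seqP => n; apply/subsetPset => x /=; rewrite !in_itv/=.
  by move=> /andP[ux xv]; rewrite (le_trans (und n))//= (le_trans xv).
- by move=> n; exact: measurable_itv.
- move=> n; apply/measurable_EFinP; apply: measurable_funS mf; last exact: uvD.
  have -> : D = \bigcup_n `[u n, v n]%classic.
    apply/seteqP; split => x; last by move=> [m _]; exact: uvD.
    by move=> /Duv[m xn]; exists m => //=; rewrite in_itv.
  by apply: bigcup_measurable => m _; exact: measurable_itv.
- by move=> n x xn; rewrite lee_fin f0//; exact: (uvD xn).
Qed.

Lemma exhaustion_cvg f : mu.-integrable D (EFin \o f) -> (forall x, D x -> 0 <= f x) ->
  measurable D ->
  \int[mu]_(x in `[u n, v n]) f x @[n --> \oo] --> \int[mu]_(x in D) f x.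
Proof.
move=> fi f0 mD; have /integrableP[/measurable_EFinP mf _] := fi.
apply: fine_cvg; rewrite fineK; last exact: integrable_fin_num.
exact: exhaustion_cvge.
Qed.

End interval_integrals.

(** * Gamma-type integrals in the variable c^(-rho) *)

Section gamma_integrals.
Variables (R : realType) (rho : R).
Hypothesis rho1 : 1 < rho.
Local Notation mu := (@lebesgue_measure R).
Local Notation D := (`]0, +oo[%classic : set R).
Local Notation y c := (c `^ (- rho)).

Let theta := rho^-1.
Let rho0 : 0 < rho. Proof. by rewrite (lt_trans ltr01). Qed.

Lemma pow_integrable (h : R -> R) (K : R) : measurable_fun setT h ->
  (forall x, 0 <= x -> `|h x| <= K * Num.min 1 x) ->
  mu.-integrable D (fun c => (h (y c))%:E).
Proof.
move=> mh hK.
have K0 : 0 <= K by have := le_trans (normr_ge0 _) (hK 1 ler01); rewrite minxx mulr1.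
apply: (le_integrable _ _ _ (shifted_powR_integrable (K * 2 `^ rho) rho1)) => //.
  apply/measurable_EFinP/measurable_funTS; apply: (measurableT_comp mh).
  exact: measurable_powR.
move=> c; rewrite /= in_itv/= andbT => c0; rewrite lee_fin.
rewrite (le_trans (hK _ (powR_ge0 _ _)))// ger0_norm ?mulr_ge0 ?powR_ge0//.
rewrite -mulrA ler_wpM2l//.
have c10 : 0 < 1 + c by rewrite addr_gt0.
have [c1|c1] := leP c 1.
  rewrite (@le_trans _ _ 1)// ?ge_min ?lexx// powRN ler_pdivlMr ?powR_gt0// mul1r.
  rewrite ge0_ler_powR ?nnegrE ?(ltW c10) ?(ltW rho0)//.
  by rewrite mulr2n lerD2l.
rewrite ge_min; apply/orP; right.
rewrite !powRN ler_pdivlMr ?powR_gt0// mulrC ler_pdivrMr ?powR_gt0//.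
rewrite -powRM ?(ltW c0)//; apply: ge0_ler_powR => //; first exact: ltW.
- by rewrite nnegrE ltW.
- by rewrite nnegrE mulr_ge0// ltW.
- by rewrite mulr2n mulrDl mul1r lerD2r ltW.
Qed.

(** For j, s >= 1 the substitution x = c^(-rho) shows that this is theta Gamma(j - theta) s^(theta -
    j), with theta = 1/rho. *)
Definition gint (j s : nat) : R :=
  \int[mu]_(c in D) (y c ^+ j * expR (- (s%:R * y c))).

Let k (j s : nat) (x : R) := x ^+ j * expR (- (s%:R * x)).

Lemma gfun_measurable j s : measurable_fun setT (k j s).
Proof.
apply: measurable_funM; first exact: measurable_funX.
by apply: measurableT_comp => //; apply: measurableT_comp => //; exact: measurable_funM.
Qed.

Lemma expR_ge_pow (x : R) j : 0 <= x -> x ^+ j <= j`!%:R * expR x.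
Proof.
move=> x0; case: j => [|j].
  by rewrite expr0 mul1r; have := expR_ge1Dx x; lra.
have f0 : (0 : R) < (j.+1)`!%:R by rewrite ltr0n fact_gt0.
rewrite mulrC -ler_pdivrMr//; have := expR_ge1Dxn j x0; lra.
Qed.

Lemma gfun_dom j s : (0 < j)%N -> (0 < s)%N -> exists2 K, 0 <= K &
  forall x, 0 <= x -> `|k j s x| <= K * Num.min 1 x.
Proof.
move=> j0 s0.
exists (j`!%:R + (j.-1)`!%:R); first by rewrite addr_ge0.
move=> x x0; rewrite /k ger0_norm ?mulr_ge0 ?exprn_ge0 ?expR_ge0//.
have e1 : expR (- (s%:R * x)) <= expR (- x).
  by rewrite ler_expR lerN2 ler_peMl// ler1n.
have bd i : x ^+ i * expR (- (s%:R * x)) <= i`!%:R.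
  apply: (le_trans (ler_wpM2l _ e1)); first exact: exprn_ge0.
  by rewrite expRN ler_pdivrMr ?expR_gt0// expR_ge_pow.
rewrite /Num.min; case: ifP => _.
  by rewrite mulr1 (le_trans (bd j))// lerDl.
rewrite -(prednK j0) exprS mulrC mulrCA mulrC ler_wpM2r//.
by rewrite mulrC (le_trans (bd _))// lerDr.
Qed.

Lemma gint_integrable j s : (0 < j)%N -> (0 < s)%N ->
  mu.-integrable D (fun c => (y c ^+ j * expR (- (s%:R * y c)))%:E).
Proof.
move=> j0 s0; have [K _ hK] := gfun_dom j0 s0.
exact: (pow_integrable (gfun_measurable j s) hK).
Qed.

Let u (n : nat) : R := (n.+2%:R)^-1.
Let v (n : nat) : R := n.+2%:R.

Let u_gt0 n : 0 < u n. Proof. by rewrite invr_gt0 ltr0n. Qed.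

Let und n : u n.+1 <= u n.
Proof. by rewrite lef_pV2 ?posrE ?ltr0n// ler_nat. Qed.

Let vnd n : v n <= v n.+1. Proof. by rewrite ler_nat. Qed.

Let uv n : u n < v n.
Proof.
apply: (@lt_trans _ _ 1); first by rewrite invf_lt1 ?ltr0n// ltr1n.
by rewrite ltr1n.
Qed.

Let vy : v n @[n --> \oo] --> +oo%R.
Proof.
have : (n + 2)%N%:R @[n --> \oo] --> (+oo%R : set_system R).
  exact: cvg_comp (cvg_addnr 2) (@cvgr_idn R).
by apply: cvg_trans; apply: near_eq_cvg; near=> n; rewrite /= addn2.
Unshelve. all: by end_near. Qed.

Let u0 : u n @[n --> \oo] --> (0 : R).
Proof. exact: cvg_comp vy (@inv_cvgy R). Qed.

Let uvD (l : R) n : 0 < l -> `[l * u n, l * v n] `<=` D.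
Proof.
move=> l0 x /=; rewrite !in_itv/= andbT => /andP[ux _].
by rewrite (lt_le_trans _ ux)// mulr_gt0.
Qed.

Let Duv (l x : R) : 0 < l -> D x -> exists n, l * u n <= x <= l * v n.
Proof.
move=> l0; rewrite /= in_itv/= andbT => x0.
exists (maxn (Num.trunc (l / x)) (Num.trunc (x / l))); apply/andP; split.
  rewrite ler_pdivrMr ?ltr0n// mulrC -ler_pdivrMr// (le_trans (ltW (truncnS_gt _)))//.
  by rewrite ler_nat ltnS leqW// leq_maxl.
rewrite mulrC -ler_pdivrMr// (le_trans (ltW (truncnS_gt _)))//.
by rewrite ler_nat ltnS leqW// leq_maxr.
Qed.

Lemma gint_cvg (l : R) j s : 0 < l -> (0 < j)%N -> (0 < s)%N ->
  \int[mu]_(c in `[l * u n, l * v n]) (y c ^+ j * expR (- (s%:R * y c)))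
    @[n --> \oo] --> gint j s.
Proof.
move=> l0 j0 s0; apply: exhaustion_cvg.
- by move=> n; rewrite ler_wpM2l// ltW.
- by move=> n; rewrite ler_wpM2l// ltW.
- by move=> n; exact: uvD.
- by move=> x; exact: Duv.
- exact: gint_integrable.
- by move=> x _; rewrite mulr_ge0 ?expR_ge0 ?exprn_ge0 ?powR_ge0.
- exact: measurable_itv.
Qed.

Let dy (c : R) : 0 < c -> is_derive c (1 : R) (fun t => y t) (- rho * (y c / c)).
Proof.
move=> c0; apply: (is_derive_eq (is_derive1_powR (- rho) c0)).
congr (_ * _); rewrite powRB; last by apply/implyP => _; rewrite gt_eqF.
by rewrite powRr1// ltW.
Qed.

Lemma der_exprn (x : R) j : is_derive x (1 : R) (fun t => t ^+ j.+1) (j.+1%:R * x ^+ j).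
Proof.
elim: j => [|j IH].
  apply: (is_derive_eq (der_id x)); by rewrite expr0 mulr1.
have -> : (fun t : R => t ^+ j.+2) = (fun t => t * t ^+ j.+1).
  by apply/funext => t; rewrite exprS.
apply: (is_derive_eq (derM (der_id x) IH)).
by rewrite -[j.+2%:R]natr1 exprS; ring.
Qed.

Lemma der_gfun j s (x : R) : is_derive x (1 : R) (k j.+1 s)
  (j.+1%:R * k j s x - s%:R * k j.+1 s x).
Proof.
have dN : is_derive x (1 : R) (fun t => - (s%:R * t)) (- (s%:R * 1)).
  by apply: (is_derive_eq (is_deriveN (derZ s%:R (der_id x)))).
apply: (is_derive_eq (derM (der_exprn x j) (der_comp (is_derive_expR _) dN))).
by rewrite /k; ring.
Qed.

Lemma gfun_y_continuous j s (c : R) : 0 < c ->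
  {for c, continuous (fun c => k j.+1 s (y c))}.
Proof.
move=> c0; exact: der_continuous (der_comp (der_gfun j s _) (dy c0)).
Qed.

(** Integration by parts: with y = c^(-rho), the derivative in c of c y^j e^(-y) is (1 - rho j) y^j
    e^(-y) + rho y^(j+1) e^(-y). The boundary terms vanish, being O(c) at 0 and O(c^(1 - rho)) at
    infinity. *)
Lemma gint_rec j : (0 < j)%N -> gint j.+1 1 = (j%:R - theta) * gint j 1.
Proof.
case: j => // j _; set J := j.+1.
pose F c := c * k J 1 (y c).
pose f c := (1 - rho * J%:R) * k J 1 (y c) + rho * k J.+1 1 (y c).
have dF (c : R) : D c -> is_derive c (1 : R) F (f c).
  rewrite /= in_itv/= andbT => c0.
  apply: (is_derive_eq (derM (der_id c) (der_comp (der_gfun j 1 _) (dy c0)))).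
  have alg (E Y Yj jj : R) : 1 * (Y * Yj * E) +
      c * ((jj * (Yj * E) - 1 * (Y * Yj * E)) * (- rho * (Y / c))) =
      (1 - rho * jj) * (Y * Yj * E) + rho * (Y * (Y * Yj) * E).
    by field; rewrite gt_eqF.
  by rewrite /f /k /J /= !exprS; exact: alg.
have cf (c : R) : D c -> {for c, continuous f}.
  rewrite /= in_itv/= andbT => c0.
  have d1 := derZ (1 - rho * J%:R) (der_comp (der_gfun j 1 _) (dy c0)).
  have d2 := derZ rho (der_comp (der_gfun J 1 _) (dy c0)).
  exact: der_continuous (derD d1 d2).
have D1 n : `[1 * u n, 1 * v n] `<=` D by exact: uvD.
have uv1 n : 1 * u n < 1 * v n by rewrite !mul1r.
have lim1 : (1 - rho * J%:R) * \int[mu]_(c in `[1 * u n, 1 * v n]) (k J 1 (y c))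
   + rho * \int[mu]_(c in `[1 * u n, 1 * v n]) (k J.+1 1 (y c)) @[n --> \oo] -->
   (1 - rho * J%:R) * gint J 1 + rho * gint J.+1 1.
  apply: cvgD; apply: cvgM; try exact: cvg_cst.
    exact: (gint_cvg (j := J) (s := 1) ltr01).
  exact: (gint_cvg (j := J.+1) (s := 1) ltr01).
have intS i n : (0 < i)%N ->
    mu.-integrable `[1 * u n, 1 * v n] (EFin \o (fun c => k i 1 (y c))).
  by move=> i0; apply: integrableS (gint_integrable i0 (isT : (0 < 1)%N)).
have Fdiff n : (1 - rho * J%:R) * \int[mu]_(c in `[1 * u n, 1 * v n]) (k J 1 (y c))
   + rho * \int[mu]_(c in `[1 * u n, 1 * v n]) (k J.+1 1 (y c)) = F (v n) - F (u n).
  have D1' : `[u n, v n] `<=` D by have := @D1 n; rewrite !mul1r.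
  have i1 := intS J n isT; have i2 := intS J.+1 n isT.
  rewrite !mul1r in i1 i2 *.
  rewrite -(Rintegral_FTC (uv n) D1' dF cf).
  have mI : measurable (`[u n, v n]%classic : set (measurableTypeR R)) by exact: measurable_itv.
  rewrite -RintegralZl// -RintegralZl// -RintegralD//.
  - by have := integrableZl mI (1 - rho * J%:R) i1;
      apply: eq_integrable => // c _; rewrite /= EFinM.
  - by have := integrableZl mI rho i2;
      apply: eq_integrable => // c _; rewrite /= EFinM.
have [K K0 hK] := gfun_dom (isT : (0 < J)%N) (isT : (0 < 1)%N).
have Fn c : 0 < c -> `|F c| <= K * (c * Num.min 1 (y c)).
  move=> c0; rewrite /F normrM (gtr0_norm c0) mulrCA ler_wpM2l ?(ltW c0)//.
  exact: hK (powR_ge0 _ _).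
have Fv : F (v n) @[n --> \oo] --> (0 : R).
  apply/norm_cvg0P.
  apply: (@squeeze_cvgr _ _ _ _ (fun=> 0) (fun n => K * (v n `^ (- (rho - 1))))).
  - near=> n; rewrite normr_ge0/= (le_trans (Fn _ _))//.
    rewrite ler_wpM2l// opprB powRB; last by rewrite pnatr_eq0/= implybT.
    rewrite powRr1// -powRN ler_wpM2l// ge_min lexx orbT//.
  - exact: cvg_cst.
  - apply: cvg0Z; have r1 : 0 < rho - 1 by rewrite subr_gt0.
    exact: cvg_comp vy (powRN_cvgy r1).
have Fu : F (u n) @[n --> \oo] --> (0 : R).
  apply/norm_cvg0P.
  apply: (@squeeze_cvgr _ _ _ _ (fun=> 0) (fun n => K * u n)).
  - near=> n; rewrite normr_ge0/= (le_trans (Fn _ _))//.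
    by rewrite ler_wpM2l// ler_piMr ?(ltW (u_gt0 _))// ge_min lexx.
  - exact: cvg_cst.
  - exact: cvg0Z.
have lim0 : F (v n) - F (u n) @[n --> \oo] --> (0 : R).
  by rewrite -[X in _ --> X](subrr (0 : R)); exact: cvgB.
have e : (1 - rho * J%:R) * gint J 1 + rho * gint J.+1 1 = 0.
  apply: (cvg_unique _ lim1); first exact: Rhausdorff.
  by apply: cvg_trans lim0; apply: near_eq_cvg; near=> n; rewrite Fdiff.
have rn0 : rho != 0 by rewrite gt_eqF.
have -> : gint J.+1 1 = rho^-1 * ((1 - rho * J%:R) * gint J 1 + rho * gint J.+1 1)
     + (J%:R - theta) * gint J 1 by rewrite /theta; field.
by rewrite e mulr0 add0r.
Unshelve. all: by end_near. Qed.

(** Replacing c by 2^(-theta) c doubles c^(-rho). *)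
Lemma gint_scale j : (0 < j)%N -> gint j 2 = 2 `^ theta / 2 ^+ j * gint j 1.
Proof.
case: j => // j _; set J := j.+1.
have p20 : 0 < (2 : R) `^ theta by exact: powR_gt0.
pose l : R := (2 `^ theta)^-1.
have l0 : 0 < l by rewrite invr_gt0.
pose F (c : R) := l * c.
have dF (c : R) : is_derive c (1 : R) F l.
  by apply: (is_derive_eq (derZ l (der_id c))); rewrite mulr1.
have F' : F^`()%classic = cst l.
  by apply/funext => c; rewrite derive1E; have [_ ->] := dF c.
have yl (c : R) : 0 < c -> y (l * c) = 2 * y c.
  move=> c0; rewrite powRM ?ltW//; congr (_ * _).
  rewrite /l -powRN -powRrM mulrNN /theta mulVf ?powRr1// gt_eqF//.
have key n : \int[mu]_(c in `[l * u n, l * v n]) (k J 1 (y c)) =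
   l * 2 ^+ J * \int[mu]_(c in `[1 * u n, 1 * v n]) (k J 2 (y c)).
  rewrite !mul1r /Rintegral.
  have -> : (\int[mu]_(c in `[(l * u n)%R, (l * v n)%R]) (k J 1 (y c))%:E =
     \int[mu]_(c in `[u n, v n]) ((((fun c => k J 1 (y c)) \o F) * F^`()%classic)%R c)%:E)%E.
    apply: (@integration_by_substitution_increasing _ F (fun c => k J 1 (y c)) (u n) (v n)).
    - exact: ltW.
    - by move=> x z _ _ xz; rewrite /F ltr_pM2l.
    - by rewrite F' => x _; exact: cvg_cst.
    - by rewrite F'; exact: is_cvg_cst.
    - by rewrite F'; exact: is_cvg_cst.
    - split; [|apply: cvg_at_right_filter|apply: cvg_at_left_filter].
      + by move=> x _; have [] := dF x.
      + exact: der_continuous (dF _).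
      + exact: der_continuous (dF _).
    - apply: continuous_in_subspaceT => c; rewrite inE/= in_itv/= => /andP[uc _].
      by apply: gfun_y_continuous; rewrite (lt_le_trans _ uc)// mulr_gt0.
  rewrite -/(Rintegral mu `[u n, v n] (((fun c => k J 1 (y c)) \o F) * F^`()%classic)).
  rewrite -/(Rintegral mu `[u n, v n] (fun c => k J 2 (y c))).
  rewrite -RintegralZl//; last first.
    apply: integrableS (gint_integrable (isT : (0 < J)%N) (isT : (0 < 2)%N)) => //.
    by have := @uvD 1 n ltr01; rewrite !mul1r.
  apply: eq_Rintegral => c; rewrite inE/= in_itv/= => /andP[uc _].
  have c0 : 0 < c by exact: lt_le_trans uc.
  rewrite F' /= /F yl// /k mul1r exprMn; ring.
have lim1 := gint_cvg (j := J) (s := 1) l0 isT isT.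
have lim2 := gint_cvg (j := J) (s := 2) ltr01 isT isT.
have e : gint J 1 = l * 2 ^+ J * gint J 2.
  apply: (cvg_unique _ lim1); first exact: Rhausdorff.
  rewrite (_ : (fun n => _) = (fun n => l * 2 ^+ J *
    \int[mu]_(c in `[1 * u n, 1 * v n]) (k J 2 (y c)))); last exact/funext.
  by apply: cvgM => //; exact: cvg_cst.
rewrite e /l; field; rewrite expf_neq0//= gt_eqF//.
Qed.

Lemma gint_gt0 j : (0 < j)%N -> 0 < gint j 1.
Proof.
move=> j0; have y2 : 0 < (2 : R) `^ (- rho) by exact: powR_gt0.
apply: (@lt_le_trans _ _ ((2 `^ (- rho)) ^+ j * expR (-1))).
  by rewrite mulr_gt0 ?expR_gt0// exprn_gt0.
set C := _ * _.
have m12 : measurable (`[1, 2]%classic : set (measurableTypeR R)) by exact: measurable_itv.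
have e : C = \int[mu]_(c in `[1, 2]) C.
  rewrite Rintegral_cst//= lebesgue_measure_itv/= lte_fin ltr1n/=.
  by rewrite (_ : 2 - 1 = 1 :> R) ?mulr1//; ring.
have sub : `[1, 2]%classic `<=` D.
  by move=> c /=; rewrite !in_itv/= andbT => /andP[c1 _]; exact: lt_le_trans c1.
have gi := gint_integrable j0 (isT : (0 < 1)%N).
rewrite e; apply: (@le_trans _ _
    (\int[mu]_(c in `[1, 2]) (y c ^+ j * expR (- (1%:R * y c))))).
  apply: le_Rintegral => //.
  - have finI : (mu `[1%R, 2%R]%classic < +oo)%E.
      by rewrite lebesgue_measure_itv/= lte_fin ltr1n ltry.
    apply: (@measurable_bounded_integrable _ _ _ mu (fun=> C) _ m12 finI) => //.
    by exists `|C|; split; [exact: num_real|move=> x Cx z _ /=; exact: ltW].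
  - exact: integrableS gi.
  - move=> c; rewrite /= in_itv/= => /andP[c1 c2]; rewrite /C mul1r.
    have c0 : 0 < c by exact: lt_le_trans c1.
    apply: ler_pM; rewrite ?exprn_ge0 ?expR_ge0 ?(ltW y2)//.
      rewrite lerXn2r ?nnegrE ?powR_ge0// !powRN lef_pV2 ?posrE ?powR_gt0//.
      by rewrite ge0_ler_powR ?nnegrE ?(ltW rho0) ?(ltW c0).
    rewrite ler_expR lerN2 powRN invf_le1 ?powR_gt0//.
    have p1 : (1 : R) `^ rho = 1 by rewrite powR1.
    by rewrite -[leLHS]p1 ge0_ler_powR ?nnegrE ?(ltW rho0) ?(ltW c0).
rewrite -lee_fin /gint /Rintegral !fineK.
- apply: ge0_subset_integral => //.
  + by apply: measurable_int gi.
  + by move=> c _; rewrite lee_fin mulr_ge0 ?expR_ge0 ?exprn_ge0 ?powR_ge0.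
- exact: integrable_fin_num gi.
- by apply: integrable_fin_num => //; exact: integrableS gi.
Qed.

End gamma_integrals.

(** * The Beta function with one natural argument *)

Section beta_integrals.
Variable R : realType.
Local Notation mu := (@lebesgue_measure R).
Local Notation D := (`]0, 1[%classic : set R).

Let mD : measurable (D : set (measurableTypeR R)). Proof. exact: measurable_itv. Qed.

Lemma beta_base (a : R) : 0 < a ->
  (\int[mu]_(t in D) (t `^ (a - 1))%:E = (a^-1)%:E)%E.
Proof.
move=> a0; pose u n : R := (n.+3%:R)^-1; pose v n : R := 1 - u n.
have u0 n : 0 < u n by rewrite invr_gt0 ltr0n.
have u3 n : u n <= 3^-1 by rewrite lef_pV2 ?posrE ?ltr0n// ler_nat.
have und n : u n.+1 <= u n by rewrite lef_pV2 ?posrE ?ltr0n// ler_nat.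
have nR : (n.+3%:R : R) @[n --> \oo] --> +oo%R.
  have : ((n + 3)%N%:R : R) @[n --> \oo] --> +oo%R.
    exact: cvg_comp (cvg_addnr 3) (@cvgr_idn R).
  by apply: cvg_trans; apply: near_eq_cvg; near=> n; rewrite /= addn3.
have ulim : u n @[n --> \oo] --> (0 : R) by exact: cvg_comp nR (@inv_cvgy R).
pose F (t : R) := a^-1 * t `^ a; pose f (t : R) := t `^ (a - 1).
have dF (t : R) : D t -> is_derive t (1 : R) F (f t).
  rewrite /= in_itv/= => /andP[t0 _].
  apply: (is_derive_eq (derZ a^-1 (is_derive1_powR a t0))).
  by rewrite mulKf// gt_eqF.
have cf (t : R) : D t -> {for t, continuous f}.
  by rewrite /= in_itv/= => /andP[t0 _]; exact: powR_continuous.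
have uvD n : `[u n, v n] `<=` D.
  move=> t /=; rewrite !in_itv/= => /andP[ut tv].
  by rewrite (lt_le_trans (u0 n) ut)/= (le_lt_trans tv)// /v ltrBlDr ltrDl.
have uv n : u n < v n by rewrite /v; have := u3 n; lra.
have mf : measurable_fun setT f by exact: measurable_powR.
have ex : (\int[mu]_(t in `[u n, v n]) (f t)%:E @[n --> \oo] --> \int[mu]_(t in D) (f t)%:E)%E.
  apply: exhaustion_cvge => //.
  - by move=> n; rewrite /v lerD2l lerN2.
  - move=> t; rewrite /= in_itv/= => /andP[t0 t1].
    have t1' : 0 < 1 - t by rewrite subr_gt0.
    exists (maxn (Num.trunc t^-1) (Num.trunc (1 - t)^-1)); apply/andP; split.
      rewrite invf_ple ?posrE ?ltr0n// (le_trans (ltW (truncnS_gt _)))//.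
      by rewrite ler_nat ltnS leqW// leqW// leq_maxl.
    rewrite /v lerBrDr addrC -lerBrDr invf_ple ?posrE ?ltr0n// (le_trans (ltW (truncnS_gt _)))//.
    by rewrite ler_nat ltnS leqW// leqW// leq_maxr.
  - exact: measurable_funTS.
  - by move=> t _; exact: powR_ge0.
have fin n : mu.-integrable `[u n, v n] (EFin \o f).
  apply: continuous_compact_integrable; first exact: segment_compact.
  apply: continuous_in_subspaceT => t; rewrite inE => /(uvD n); exact: cf.
have FTC n : (\int[mu]_(t in `[u n, v n]) (f t)%:E = (F (v n) - F (u n))%:E)%E.
  rewrite -(Rintegral_FTC (uv n) (@uvD n) dF cf) /Rintegral fineK//.
  by apply: integrable_fin_num => //; exact: measurable_itv.
have lim : (F (v n) - F (u n))%:E @[n --> \oo] --> (a^-1)%:E.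
  apply: cvg_EFin; first by near=> n.
  have -> : a^-1 = a^-1 * 1 - a^-1 * 0 by rewrite mulr1 mulr0 subr0.
  apply: cvgB; (apply: cvgM; first exact: cvg_cst).
    have v1 : v n @[n --> \oo] --> (1 : R).
      by rewrite -[X in _ --> X]subr0; apply: cvgB => //; exact: cvg_cst.
    have : v n `^ a @[n --> \oo] --> (1 : R) `^ a.
      exact: (@continuous_cvg nat R R \oo _ v (fun t => t `^ a) 1 (powR_continuous ltr01) v1).
    by rewrite powR1.
  have : (n.+3%:R : R) `^ (- a) @[n --> \oo] --> (0 : R).
    exact: cvg_comp nR (powRN_cvgy a0).
  apply: cvg_trans; apply: near_eq_cvg; near=> n.
  by rewrite /= /u -powR_inv1// -powRrM mulN1r.
apply: (cvg_unique _ ex); first exact: ereal_hausdorff.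
by apply: cvg_trans lim; apply: near_eq_cvg; near=> n; rewrite FTC.
Unshelve. all: by end_near. Qed.

(** Induction through (1 - t)^(k+1) = (1 - t)^k - t (1 - t)^k, that is B(a, k+2) = B(a, k+1) -
    B(a+1, k+1). *)
Lemma beta_nat k (a : R) : 0 < a ->
  mu.-integrable D (EFin \o (fun t => t `^ (a - 1) * (1 - t) ^+ k)) /\
  \int[mu]_(t in D) (t `^ (a - 1) * (1 - t) ^+ k) = k`!%:R / \prod_(i < k.+1) (a + i%:R).
Proof.
elim: k a => [|k IH] a a0.
  have e : EFin \o (fun t : R => t `^ (a - 1) * (1 - t) ^+ 0) = (fun t => (t `^ (a - 1))%:E).
    by apply/funext => t; rewrite /= expr0 mulr1.
  split.
    rewrite e; apply/integrableP; split.
      by apply/measurable_EFinP/measurable_funTS; exact: measurable_powR.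
    apply: (le_lt_trans (y := (a^-1)%:E)); last by rewrite ltry.
    rewrite -beta_base// le_eqVlt; apply/orP; left; apply/eqP.
    by apply: eq_integral => t _; rewrite gee0_abs// lee_fin powR_ge0.
  rewrite /Rintegral.
  have -> : (\int[mu]_(t in D) (t `^ (a - 1) * (1 - t) ^+ 0)%:E = (a^-1)%:E)%E.
    by rewrite -beta_base//; apply: eq_integral => t _; rewrite expr0 mulr1.
  by rewrite big_ord_recl big_ord0 /= addr0 mulr1 div1r.
have [i1 e1] := IH a a0; have a10 : 0 < a + 1 by rewrite addr_gt0.
have [i2 e2] := IH (a + 1) a10.
have split t : D t -> t `^ (a - 1) * (1 - t) ^+ k.+1 =
    t `^ (a - 1) * (1 - t) ^+ k - t `^ (a + 1 - 1) * (1 - t) ^+ k.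
  rewrite /= in_itv/= => /andP[t0 _].
  have -> : t `^ (a + 1 - 1) = t `^ (a - 1) * t.
    rewrite (_ : a + 1 - 1 = (a - 1) + 1); last by ring.
    rewrite (@powRD _ t (a - 1) 1) ?powRr1 ?(ltW t0)//.
    by apply/implyP => _; rewrite gt_eqF.
  by rewrite exprS; ring.
split.
  have := integrableB mD i1 i2; apply: eq_integrable => // t; rewrite inE => Dt.
  by rewrite /= split.
transitivity (\int[mu]_(t in D) (t `^ (a - 1) * (1 - t) ^+ k - t `^ (a + 1 - 1) * (1 - t) ^+ k)).
  by apply: eq_Rintegral => t; rewrite inE; exact: split.
rewrite RintegralB// e1 e2.
have P0 (b : R) n : 0 < b -> \prod_(i < n) (b + i%:R) != 0.
  by move=> b0; apply/prodf_neq0 => i _; rewrite gt_eqF// ltr_wpDr.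
have s1 : \prod_(i < k.+2) (a + i%:R) = \prod_(i < k.+1) (a + i%:R) * (a + k.+1%:R).
  by rewrite big_ord_recr.
have s2 : \prod_(i < k.+2) (a + i%:R) = a * \prod_(i < k.+1) (a + 1 + i%:R).
  rewrite big_ord_recl/= addr0; congr (_ * _); apply: eq_bigr => i _.
  by rewrite /bump/= add1n -natr1; ring.
have n1 := P0 a k.+1 a0; have n2 := P0 (a + 1) k.+1 a10.
have ak : a + k.+1%:R != 0 by rewrite gt_eqF// ltr_wpDr.
have an : a != 0 by rewrite gt_eqF.
have s3 : \prod_(i < k.+1) (a + 1 + i%:R) = \prod_(i < k.+1) (a + i%:R) * (a + k.+1%:R) / a.
  by rewrite -s1 s2 mulrAC divff// mul1r.
rewrite s1 s3 factS natrM.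
move: ak; rewrite -natr1; move: (\prod_(i < k.+1) (a + i%:R)) n1 => Pr Pr0 ak.
by field; rewrite Pr0 an ak.
Qed.

Lemma euler_beta_nat k (a : R) : 0 < a ->
  euler_beta a k.+1%:R = k`!%:R / \prod_(i < k.+1) (a + i%:R).
Proof.
move=> a0; have [_ <-] := beta_nat k a0.
apply: eq_Rintegral => t; rewrite inE/= in_itv/= => /andP[_ t1].
rewrite -[k.+1%:R]natr1 addrK powR_mulrn// subr_ge0; exact: ltW.
Qed.

End beta_integrals.

(** * Poisson limits and uniform bounds for binomial probabilities *)

Section poisson_limit.
Variable R : realType.
Implicit Types (x p : R) (j n : nat).

Definition pois j x := x ^+ j / j`!%:R * expR (- x).

Definition binp j n p := binE p n (fun i _ => (i == j)%:R : R).

Lemma inv_natR_cvg : (n%:R : R)^-1 @[n --> \oo] --> (0 : R).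
Proof. exact: cvg_comp (@cvgr_idn R) (@inv_cvgy R). Qed.

Lemma bin_pow_cvg j : 'C(n, j)%:R / n%:R ^+ j @[n --> \oo] --> ((j`!)%:R^-1 : R).
Proof.
elim: j => [|j IH].
  under eq_fun do rewrite bin0 expr0 divr1.
  by rewrite fact0 invr1; exact: cvg_cst.
have h : ('C(n, j)%:R / n%:R ^+ j) * ((1 - j%:R * n%:R^-1) / j.+1%:R) @[n --> \oo] -->
    ((j`!)%:R^-1 * ((1 - j%:R * 0) / j.+1%:R) : R).
  apply: cvgM => //; apply: cvgM; last exact: cvg_cst.
  apply: cvgB; first exact: cvg_cst.
  by apply: cvgM; [exact: cvg_cst|exact: inv_natR_cvg].
have -> : (j.+1`!)%:R^-1 = (j`!)%:R^-1 * ((1 - j%:R * 0) / j.+1%:R) :> R.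
  by rewrite mulr0 subr0 div1r -invfM -natrM mulnC -factS.
apply: cvg_trans h; apply: near_eq_cvg; near=> n.
have jn : (j <= n)%N by near: n; exact: nbhs_infty_ge.
have n0 : (0 < n)%N by near: n; exact: nbhs_infty_gt.
have n0' : (n%:R : R) != 0 by rewrite pnatr_eq0 -lt0n.
have j0' : (j.+1%:R : R) != 0 by rewrite pnatr_eq0.
have e : j.+1%:R * 'C(n, j.+1)%:R = (n%:R - j%:R) * 'C(n, j)%:R :> R.
  by rewrite -natrB// -!natrM mul_bin_left.
have -> : 'C(n, j.+1)%:R = (n%:R - j%:R) * 'C(n, j)%:R / j.+1%:R :> R.
  by rewrite -e mulrC mulKf.
rewrite exprS; move: j0' ('C(n, j)%:R : R) => j0' C.
by field; rewrite n0' expf_neq0//= addrC natr1.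
Unshelve. all: by end_near. Qed.

Lemma cvg_expR (u : nat -> R) (l : R) :
  u n @[n --> \oo] --> l -> expR (u n) @[n --> \oo] --> expR l.
Proof.
by move=> ul; exact: (@continuous_cvg nat R R \oo _ u expR l (@continuous_expR R l) ul).
Qed.

(** With y = x_n / n, the inequality 1 + z <= e^z at z = -y and at z = y/(1 - y) squeezes 1 - y
    between e^(-y/(1-y)) and e^(-y). *)
Lemma pow1_cvg (x_ : nat -> R) x : 0 < x -> x_ n @[n --> \oo] --> x ->
  (1 - x_ n / n%:R) ^+ n @[n --> \oo] --> expR (- x).
Proof.
move=> x0 xx.
have yl : x_ n / n%:R @[n --> \oo] --> (0 : R).
  by rewrite -[X in _ --> X](mulr0 x); apply: cvgM => //; exact: inv_natR_cvg.
have yl1 : (1 - x_ n / n%:R)^-1 @[n --> \oo] --> (1 : R).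
  rewrite -[X in _ --> X]invr1; apply: cvgV; first exact: oner_neq0.
  by rewrite -[X in _ --> X]subr0; apply: cvgB => //; exact: cvg_cst.
have y1 : \forall n \near \oo, x_ n / n%:R < 1.
  have h2 : (0 : R) < 2^-1 by rewrite invr_gt0.
  have := cvg_near_le yl h2; apply: filterS => n /andP[_]; rewrite add0r => h.
  by rewrite (le_lt_trans h)// invf_lt1// ltr1n.
have xpos : \forall n \near \oo, 0 < x_ n.
  have x20 : 0 < x / 2 by rewrite divr_gt0.
  have := cvg_near_le xx x20; apply: filterS => n /andP[h _].
  by apply: lt_le_trans h; lra.
apply: (@squeeze_cvgr _ _ _ _ (fun n => expR (- (x_ n * (1 - x_ n / n%:R)^-1)))
    (fun n => expR (- x_ n))).
- near=> n; have n0 : (0 < n)%N by near: n; exact: nbhs_infty_gt.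
  have n0' : (n%:R : R) != 0 by rewrite pnatr_eq0 -lt0n.
  have h1 : x_ n / n%:R < 1 by near: n.
  have h0 : 0 < x_ n by near: n.
  set y := x_ n / n%:R in h1 *.
  have xy : x_ n = n%:R * y by rewrite /y mulrCA divff// mulr1.
  have y10 : 0 < 1 - y by rewrite subr_gt0.
  have powE z : expR (- (n%:R * z)) = expR (- z) ^+ n.
    by rewrite -mulrN mulrC expRM_natr.
  rewrite xy -mulrA !powE; apply/andP; split.
    apply: lerXn2r; rewrite ?nnegrE ?expR_ge0 ?(ltW y10)//.
    rewrite expRN invf_ple ?posrE ?expR_gt0//.
    have := expR_ge1Dx (y / (1 - y)); rewrite (_ : 1 + _ = (1 - y)^-1)//.
    by field; rewrite gt_eqF.
  apply: lerXn2r; rewrite ?nnegrE ?expR_ge0 ?(ltW y10)//.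
  exact: expR_ge1Dx.
- apply: cvg_expR; apply: cvgN; rewrite -[X in _ --> X]mulr1; exact: cvgM.
- by apply: cvg_expR; exact: cvgN.
Unshelve. all: by end_near. Qed.

Lemma binp_cvg j (x_ : nat -> R) x : 0 < x -> x_ n @[n --> \oo] --> x ->
  binp j n (x_ n / n%:R) @[n --> \oo] --> pois j x.
Proof.
move=> x0 xx.
have yl : x_ n / n%:R @[n --> \oo] --> (0 : R).
  by rewrite -[X in _ --> X](mulr0 x); apply: cvgM => //; exact: inv_natR_cvg.
have powcv (z_ : nat -> R) (z : R) : z_ n @[n --> \oo] --> z ->
    z_ n ^+ j @[n --> \oo] --> z ^+ j.
  move=> zz; elim: j => [|i IH]; first by exact: cvg_cst.
  rewrite exprS; rewrite (_ : (fun n => _) = (fun n => z_ n * z_ n ^+ i)).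
    exact: cvgM.
  by apply/funext => n; rewrite exprS.
have d1 : (1 - x_ n / n%:R) ^- j @[n --> \oo] --> (1 : R).
  rewrite -[X in _ --> X]invr1; apply: cvgV; first exact: oner_neq0.
  rewrite -[X in _ --> X](expr1n _ j); apply: powcv.
  by rewrite -[X in _ --> X]subr0; apply: cvgB => //; exact: cvg_cst.
have y1 : \forall n \near \oo, x_ n / n%:R < 1.
  have h2 : (0 : R) < 2^-1 by rewrite invr_gt0.
  have := cvg_near_le yl h2; apply: filterS => n /andP[_]; rewrite add0r => h.
  by rewrite (le_lt_trans h)// invf_lt1// ltr1n.
have lim : ('C(n, j)%:R / n%:R ^+ j * x_ n ^+ j) *
    ((1 - x_ n / n%:R) ^+ n * (1 - x_ n / n%:R) ^- j) @[n --> \oo] -->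
    ((j`!)%:R^-1 * x ^+ j) * (expR (- x) * 1).
  apply: cvgM; first by apply: cvgM; [exact: bin_pow_cvg|exact: powcv].
  by apply: cvgM => //; exact: pow1_cvg.
have -> : pois j x = ((j`!)%:R^-1 * x ^+ j) * (expR (- x) * 1).
  by rewrite /pois mulr1 [x ^+ j * _]mulrC.
apply: cvg_trans lim; apply: near_eq_cvg; near=> n.
have jn : (j <= n)%N by near: n; exact: nbhs_infty_ge.
have h1 : x_ n / n%:R < 1 by near: n.
have y0 : 1 - x_ n / n%:R != 0 by rewrite gt_eqF// subr_gt0.
rewrite /binp binE_pmf (expfB_cond (m := n)) ?(negbTE y0)//.
by rewrite expr_div_n; ring.
Unshelve. all: by end_near. Qed.

Lemma binp_ge0 j n p : 0 <= p <= 1 -> 0 <= binp j n p.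
Proof. by move=> p01; rewrite -(binE_cst p n 0); exact: binE_le. Qed.

Lemma binp_le1 j n p : 0 <= p <= 1 -> binp j n p <= 1.
Proof.
by move=> p01; rewrite -[leRHS](binE_cst p n 1); apply: binE_le => // i m _; case: eqP.
Qed.

Lemma binp_le_mean j n p : (0 < j)%N -> 0 <= p <= 1 -> binp j n p <= n%:R * p.
Proof.
move=> j0 p01; rewrite -binE_id; apply: binE_le => // i m _.
by case: eqP => [->|_]; rewrite ?ler1n// ler0n.
Qed.

Lemma binp_min j n p : (0 < j)%N -> 0 <= p <= 1 ->
  binp j n p <= Num.min 1 (n%:R * p).
Proof. by move=> j0 p01; rewrite le_min binp_le1// binp_le_mean. Qed.

(** The indicator of the value j is at most 2^j 2^(-i), so the probability is at most 2^j (1 -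
    p/2)^n <= 2^j e^(-np/2), and x e^(-x/2) <= 2. In [urn_weight] this absorbs the unbounded factor
    n q. *)
Lemma binp_exp j n p : 0 <= p <= 1 -> n%:R * p * binp j n p <= 2 ^+ j.+1.
Proof.
move=> p01; have /andP[p0 p1] := p01.
have h : binp j n p <= 2 ^+ j * (1 - p / 2) ^+ n.
  rewrite (_ : 1 - p / 2 = 1 - p + 2^-1 * p); last by field.
  rewrite -binE_exp -binEZ; apply: binE_le => // i m _.
  case: eqP => [->|_]; last by rewrite mulr_ge0 ?exprn_ge0.
  by rewrite exprVn divff// expf_neq0.
have e : (1 - p / 2) ^+ n <= expR (- (n%:R * (p / 2))).
  rewrite (_ : - (n%:R * _) = n%:R * (- (p / 2))) ?mulrN// -[X in expR X]mulrN expRM_natl; apply: lerXn2r; rewrite ?nnegrE ?expR_ge0//; first by lra.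
  exact: expR_ge1Dx.
have np0 : 0 <= n%:R * p by rewrite mulr_ge0.
apply: (le_trans (ler_wpM2l np0 (le_trans h (ler_wpM2l _ e)))); first exact: exprn_ge0.
rewrite mulrCA exprSr ler_wpM2l ?exprn_ge0// expRN ler_pdivrMr ?expR_gt0//.
have := expR_ge1Dx (n%:R * (p / 2)); set E := expR _.
have h2 : n%:R * (p / 2) = n%:R * p / 2 by rewrite mulrA.
lra.
Qed.

Lemma binp_weight j n p (l : R) : (0 < j)%N -> 0 <= l -> 0 <= p <= 1 ->
  binp j n p * (l + n%:R * p) <= (l + 2 ^+ j.+1) * Num.min 1 (n%:R * p).
Proof.
move=> j0 l0 p01; have np0 : 0 <= n%:R * p by case/andP: p01 => *; rewrite mulr_ge0.
rewrite mulrDr mulrDl; apply: lerD.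
  by rewrite mulrC ler_wpM2l// binp_min.
rewrite mulrC; have b1 := binp_exp j n p01.
have p2 : (1 : R) <= 2 ^+ j.+1 by rewrite exprn_ege1// ler1n.
rewrite /Num.min; case: ifP => _; first by rewrite mulr1.
rewrite [leRHS]mulrC ler_wpM2l// (le_trans (binp_le1 j n p01))//.
Qed.

(** Passes to the limit from binomials, for which 0, k and k+1 are disjoint outcomes. *)
Lemma pois_sum_le k x : (0 < k)%N -> 0 < x ->
  expR (- x) + pois k x + pois k.+1 x <= 1.
Proof.
move=> k0 x0; have c : x @[n --> \oo] --> x by exact: cvg_cst.
have h : binp 0 n (x / n%:R) + binp k n (x / n%:R) + binp k.+1 n (x / n%:R)
    @[n --> \oo] --> pois 0 x + pois k x + pois k.+1 x.
  by apply: cvgD; [apply: cvgD|]; exact: (binp_cvg (x_ := fun=> x)).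
have -> : expR (- x) = pois 0 x by rewrite /pois expr0 fact0 divr1 mul1r.
apply: (cvgr_to_le h); near=> n.
have n0 : (0 : R) < n%:R by rewrite ltr0n; near: n; exact: nbhs_infty_gt.
have p01 : 0 <= x / n%:R <= 1.
  rewrite divr_ge0 ?(ltW x0) ?(ltW n0)//= ler_pdivrMr// mul1r.
  by near: n; exact: nbhs_infty_ger.
rewrite /binp -!binED -[leRHS](binE_cst (x / n%:R) n 1); apply: binE_le => // i m _.
case: i => [|i]; first by rewrite -(prednK k0) /= !addr0.
rewrite /= add0r; case: eqP => [<-|_]; last by rewrite add0r; case: eqP.
by case: eqP => [e|_]; [lia|rewrite addr0].
Unshelve. all: by end_near. Qed.

End poisson_limit.

(** * The two-valued urn statistic *)

Definition two_values (R : realType) (c0 c1 : R) (k j : nat) : R :=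
  c0 * (j == k)%:R + c1 * (j == k.+1)%:R.

Section two_values.
Variables (R : realType) (c0 c1 : R) (k : nat).
Local Notation g := (two_values c0 c1 k).

Lemma two_values_sqr j : g j ^+ 2 = two_values (c0 ^+ 2) (c1 ^+ 2) k j.
Proof.
rewrite /two_values; have [->|jk] := eqVneq j k.
  by rewrite (ltn_eqF (ltnSn k)) /=; ring.
by case: eqP => _ /=; ring.
Qed.

Lemma two_values_norm j : `|g j| <= `|c0| + `|c1|.
Proof.
rewrite /two_values (le_trans (ler_normD _ _))// !normrM !normr_nat; apply: lerD.
  by case: eqP => _; rewrite ?mulr1 ?mulr0.
by case: eqP => _; rewrite ?mulr1 ?mulr0.
Qed.

Lemma two_values_supp j : g j != 0 -> (j <= k.+1)%N.
Proof.
apply: contraNT; rewrite -ltnNge => kj.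
by rewrite /two_values (gtn_eqF (ltnW kj)) (gtn_eqF kj) !mulr0 addr0.
Qed.

Lemma binE_two_values p n :
  binE p n (fun j _ => g j) = c0 * binp k n p + c1 * binp k.+1 n p.
Proof. by rewrite binED !binEZ. Qed.

Lemma binE_norm_two_values p n : 0 <= p <= 1 ->
  binE p n (fun j _ => `|g j|) <= `|c0| * binp k n p + `|c1| * binp k.+1 n p.
Proof.
move=> p01; rewrite /binp -!binEZ -binED; apply: binE_le => // i j _.
by rewrite /two_values (le_trans (ler_normD _ _))// !normrM !normr_nat.
Qed.

(** For x > 0, the variance of [g] at a Poisson variable of mean x. *)
Definition pois_var (x : R) := c0 ^+ 2 * pois k x + c1 ^+ 2 * pois k.+1 x
  - (c0 * pois k x + c1 * pois k.+1 x) ^+ 2.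

Lemma pois_ge0 j (x : R) : 0 <= x -> 0 <= pois j x.
Proof. by move=> x0; rewrite mulr_ge0 ?expR_ge0// divr_ge0// exprn_ge0. Qed.

(* Cauchy-Schwarz, together with the fact that a Poisson variable vanishes with
   probability [expR (- x)]. *)
Lemma pois_var_ge (x : R) : (0 < k)%N -> 0 < x ->
  c0 ^+ 2 * pois k x * expR (- x) <= pois_var x.
Proof.
move=> k0 x0; have := pois_sum_le k0 x0; rewrite /pois_var.
have := pois_ge0 k (ltW x0); have := pois_ge0 k.+1 (ltW x0); have := expR_ge0 (- x).
set a := pois k x; set b := pois k.+1 x; set e := expR _ => e0 b0 a0 sum.
have CS : (c0 * a + c1 * b) ^+ 2 <= (c0 ^+ 2 * a + c1 ^+ 2 * b) * (a + b).
  have : 0 <= a * b * (c0 - c1) ^+ 2 by apply: mulr_ge0; [exact: mulr_ge0|exact: sqr_ge0].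
  by move=> h; rewrite -subr_ge0 (_ : _ - _ = a * b * (c0 - c1) ^+ 2)//; ring.
have Q0 : 0 <= c0 ^+ 2 * a + c1 ^+ 2 * b by apply: addr_ge0; apply: mulr_ge0 => //; exact: sqr_ge0.
have h1 : (c0 ^+ 2 * a + c1 ^+ 2 * b) * (a + b) <= (c0 ^+ 2 * a + c1 ^+ 2 * b) * (1 - e).
  by rewrite ler_wpM2l//; lra.
have h2 : 0 <= c1 ^+ 2 * b * e by apply: mulr_ge0 => //; apply: mulr_ge0 => //; exact: sqr_ge0.
apply: (@le_trans _ _ ((c0 ^+ 2 * a + c1 ^+ 2 * b) * e)).
  by rewrite mulrDl lerDl.
have := le_trans CS h1; rewrite mulrBr mulr1; lra.
Qed.

End two_values.

(** * Integrals of Poisson probabilities and of the limiting variance *)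

Section pois_integrals.
Variables (R : realType) (rho : R).
Hypothesis rho1 : 1 < rho.
Local Notation mu := (@lebesgue_measure R).
Local Notation D := (`]0, +oo[%classic : set R).
Local Notation y c := (c `^ (- rho)).

Definition has_pint (h : R -> R) (v : R) :=
  mu.-integrable D (fun c => (h (y c))%:E) /\ \int[mu]_(c in D) h (y c) = v.

Let mD : measurable (D : set (measurableTypeR R)). Proof. exact: measurable_itv. Qed.

Lemma has_pintD h1 h2 v1 v2 : has_pint h1 v1 -> has_pint h2 v2 ->
  has_pint (fun x => h1 x + h2 x) (v1 + v2).
Proof.
move=> [i1 e1] [i2 e2]; split; last by rewrite RintegralD// e1 e2.
by have := integrableD mD i1 i2; apply: eq_integrable.
Qed.

Lemma has_pintZ a h v : has_pint h v -> has_pint (fun x => a * h x) (a * v).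
Proof.
move=> [i e]; split; last by rewrite RintegralZl// e.
by have := integrableZl mD a i; apply: eq_integrable => // c _; rewrite EFinM.
Qed.

Lemma has_pint_eq h1 h2 v1 v2 : has_pint h1 v1 -> (forall x, h1 x = h2 x) ->
  v1 = v2 -> has_pint h2 v2.
Proof. by move=> h /funext <- <-. Qed.

Lemma has_pint_gint j s : (0 < j)%N -> (0 < s)%N ->
  has_pint (fun x => x ^+ j * expR (- (s%:R * x))) (gint rho j s).
Proof. by move=> j0 s0; split => //; exact: gint_integrable. Qed.

Lemma has_pint_pois j : (0 < j)%N -> has_pint (@pois R j) (gint rho j 1 / j`!%:R).
Proof.
move=> j0; apply: has_pint_eq (has_pintZ (j`!%:R^-1) (has_pint_gint j0 (isT : (0 < 1)%N))) _ _.
  by move=> x; rewrite /pois mul1r mulrA [_^-1 * _]mulrC.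
by rewrite mulrC.
Qed.

Lemma has_pint_poisM i j : (0 < i)%N -> (0 < j)%N ->
  has_pint (fun x => pois i x * pois j x) (gint rho (i + j) 2 / (i`!%:R * j`!%:R)).
Proof.
move=> i0 j0; have ij0 : (0 < i + j)%N by rewrite addn_gt0 i0.
apply: has_pint_eq (has_pintZ ((i`!%:R * j`!%:R)^-1) (has_pint_gint ij0 (isT : (0 < 2)%N))) _ _.
  move=> x; rewrite /pois (_ : - (2%:R * x) = - x + - x); last by ring.
  by rewrite expRD exprD invfM; ring.
by rewrite mulrC.
Qed.

Lemma has_pint_var (c0 c1 : R) k : (0 < k)%N ->
  has_pint (pois_var c0 c1 k)
   (c0 ^+ 2 * (gint rho k 1 / k`!%:R) + c1 ^+ 2 * (gint rho k.+1 1 / (k.+1)`!%:R)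
    - (c0 ^+ 2 * (gint rho (k + k) 2 / (k`!%:R * k`!%:R))
       + 2 * c0 * c1 * (gint rho (k + k.+1) 2 / (k`!%:R * (k.+1)`!%:R))
       + c1 ^+ 2 * (gint rho (k.+1 + k.+1) 2 / ((k.+1)`!%:R * (k.+1)`!%:R)))).
Proof.
move=> k0; have A1 := has_pintZ (c0 ^+ 2) (has_pint_pois k0).
have A2 := has_pintZ (c1 ^+ 2) (has_pint_pois (isT : (0 < k.+1)%N)).
have B1 := has_pintZ (- c0 ^+ 2) (has_pint_poisM k0 k0).
have B2 := has_pintZ (- (2 * c0 * c1)) (has_pint_poisM k0 (isT : (0 < k.+1)%N)).
have B3 := has_pintZ (- c1 ^+ 2) (has_pint_poisM (isT : (0 < k.+1)%N) (isT : (0 < k.+1)%N)).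
apply: has_pint_eq (has_pintD (has_pintD A1 A2) (has_pintD (has_pintD B1 B2) B3)) _ _.
  by move=> x; rewrite /pois_var; ring.
by rewrite !mulNr; ring.
Qed.

Lemma has_pint_gt0 h v j a : has_pint h v -> (0 < j)%N -> 0 < a ->
  (forall x, 0 < x -> a * (x ^+ j * expR (- (2%:R * x))) <= h x) -> 0 < v.
Proof.
move=> [ih <-] j0 a0 le.
have [ia ea] := has_pintZ a (has_pint_gint j0 (isT : (0 < 2)%N)).
apply: (@lt_le_trans _ _ (a * gint rho j 2)).
  by rewrite mulr_gt0// gint_scale// mulr_gt0 ?gint_gt0// divr_gt0 ?exprn_gt0//.
rewrite -ea; apply: le_Rintegral => // c; rewrite /= in_itv/= andbT => c0.
by apply: le; exact: powR_gt0.
Qed.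

End pois_integrals.

(** * The closed form of sigma_k^2 *)

Section urn_sigma2.
Variables (R : realType) (theta : R) (k : nat).
Hypothesis theta0 : 0 < theta.
Hypothesis theta1 : theta < 1.
Hypothesis k0 : (0 < k)%N.
Local Notation rho := (theta^-1).
Local Notation g j := (gint rho j 1).

Let rho1 : 1 < rho. Proof. by rewrite invf_gt1. Qed.

Lemma gint_prod m : g (k + m) = g k * \prod_(i < m) (k%:R - theta + i%:R).
Proof.
elim: m => [|m IH]; first by rewrite addn0 big_ord0 mulr1.
rewrite addnS gint_rec ?addn_gt0 ?k0// IH big_ord_recr/= invrK natrD.
by ring.
Qed.

Let A : R := g k / k`!%:R.

(** Scaling and recursion express every integral through [g k] and the product of k - theta + i over
    i < k. That product is (k-1)! / B(k - theta, k), which is how the Beta function enters. *)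
Lemma two_values_var :
  (k%:R - theta) ^+ 2 * (g k / k`!%:R) + (- k.+1%:R) ^+ 2 * (g k.+1 / (k.+1)`!%:R)
    - ((k%:R - theta) ^+ 2 * (gint rho (k + k) 2 / (k`!%:R * k`!%:R))
       + 2 * (k%:R - theta) * (- k.+1%:R) * (gint rho (k + k.+1) 2 / (k`!%:R * (k.+1)`!%:R))
       + (- k.+1%:R) ^+ 2 * (gint rho (k.+1 + k.+1) 2 / ((k.+1)`!%:R * (k.+1)`!%:R)))
  = A * urn_sigma2 theta k.
Proof.
have kt : 0 < k%:R - theta.
  by rewrite subr_gt0 (lt_le_trans theta1)// ler1n.
pose a := k%:R - theta.
have kkR : (k + k)%N%:R = k%:R + k%:R :> R by rewrite natrD.
have kE : k = k.-1.+1 by rewrite prednK.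
pose Pr := \prod_(i < k) (a + i%:R).
have Pr0 : Pr != 0.
  by apply/prodf_neq0 => i _; rewrite gt_eqF// ltr_wpDr.
have B : euler_beta a k%:R = (k.-1)`!%:R / Pr.
  by rewrite {1}kE euler_beta_nat// -kE.
have kf : k`!%:R = k%:R * (k.-1)`!%:R :> R by rewrite {1}kE factS -kE natrM.
have f0 : ((k.-1)`!%:R : R) != 0 by rewrite pnatr_eq0 -lt0n fact_gt0.
have kn0 : (k%:R : R) != 0 by rewrite pnatr_eq0 -lt0n.
have k1n0 : (k.+1%:R : R) != 0 by rewrite pnatr_eq0.
have G1 : g k.+1 = a * g k by rewrite gint_rec// invrK.
have G2 : g (k + k) = g k * Pr by exact: gint_prod.
have G3 : g (k + k).+1 = (2 * k%:R - theta) * (g k * Pr).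
  by rewrite gint_rec ?addn_gt0 ?k0// G2 invrK kkR; ring.
have G4 : g (k + k).+2 = (2 * k%:R + 1 - theta) * ((2 * k%:R - theta) * (g k * Pr)).
  by rewrite gint_rec// G3 invrK -natr1 kkR; ring.
rewrite addSn !addnS !gint_scale ?addn_gt0 ?k0// G1 G2 G3 G4 invrK.
rewrite /urn_sigma2 -/a B.
have -> : (2 : R) `^ (2 * k%:R + 2 - theta) = 2 ^+ (k + k).+2 / 2 `^ theta.
  rewrite powRB; last by apply/implyP.
  by rewrite -powR_mulrn// -addn2 !natrD; congr (_ `^ _ / _); ring.
have t0 : (2 : R) `^ theta != 0 by rewrite gt_eqF// powR_gt0.
rewrite factS natrM kf !exprS /A kf.
have p0 : (2 : R) ^+ (k + k) != 0 by rewrite expf_neq0.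
move: (2 `^ theta) t0 (2 ^+ (k + k)) p0 => T T0 Q Q0.
rewrite -[k.+1%:R]natr1 in k1n0 *.
move: (g k) ((k.-1)`!%:R : R) f0 Pr Pr0 {B G1 G2 G3 G4} => Gk f f0 Pr Pr0.
have aE : a = k%:R - theta by [].
move: (k%:R : R) kn0 k1n0 aE => K Kn0 K1n0 ->.
field; rewrite Kn0 f0 Pr0 T0 Q0 K1n0//.
Qed.

End urn_sigma2.

Lemma cvg_sqr (R : realType) (T : Type) (F : set_system T) {FF : Filter F}
    (f : T -> R) (l : R) : f x @[x --> F] --> l -> f x ^+ 2 @[x --> F] --> l ^+ 2.
Proof.
move=> fl; rewrite expr2; under eq_fun do rewrite expr2.
exact: cvgM.
Qed.

(** * Limits of the sums over the first M n urns *)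

Section urn_limits.
Variables (R : realType) (p : nat -> R) (rho : R) (M : nat -> nat).
Hypothesis p0 : forall i, (0 < i)%N -> 0 < p i.
Hypothesis pni : forall i, (0 < i)%N -> p i.+1 <= p i.
Hypothesis pinv : forall i, (0 < i)%N -> p i <= i%:R^-1.
Hypothesis prv : forall a, (0 < a)%N ->
  p (a * i)%N / p i @[i --> \oo] --> a%:R `^ (- rho).
Hypothesis rho1 : 1 < rho.
Hypothesis nM : forall n, (n * n <= M n)%N.
Hypothesis psum1 : \sum_(i < N) p i.+1 @[N --> \oo] --> (1 : R).
Local Notation al := (urn_al p).
Local Notation q := (fun n (u : 'I_(M n)) => p u.+1).

Lemma psum_le1 K : \sum_(i < K) p i.+1 <= 1.
Proof.
move/cvg_lim : psum1 => <- //; apply: limr_ge.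
  by apply/cvg_ex; exists 1.
near=> m'; rewrite -(big_mkord xpredT (fun i => p i.+1)) -(big_mkord xpredT (fun i => p i.+1)).
have Km : (K <= m')%N by near: m'; exact: nbhs_infty_ge.
rewrite (big_cat_nat (leq0n K) Km)/= lerDl; apply: sumr_ge0 => i _.
by apply/ltW/p0.
Unshelve. all: by end_near. Qed.

Let p01 i : (0 < i)%N -> 0 <= p i <= 1.
Proof.
move=> i0; rewrite ltW ?p0//= (le_trans (pinv i0))// invf_le1 ?ltr0n//.
by rewrite ler1n.
Qed.

Lemma divnK_le n (x : R) : 0 <= x -> x <= n%:R ->
  (0 <= x / n%:R <= 1) * (n%:R * (x / n%:R) = x).
Proof.
move=> x0; have [->|n0] := posnP n.
  by rewrite invr0 mulr0 mul0r lexx ler01 => xl; have -> : x = 0 by lra.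
have n0' : 0 < n%:R :> R by rewrite ltr0n.
move=> xn; rewrite (divr_ge0 x0 (ltW n0'))/= ler_pdivrMr// mul1r xn; split => //.
by rewrite mulrC divfK// gt_eqF.
Qed.

Lemma min1_measurable : measurable_fun setT (fun x : R => Num.min 1 x).
Proof. by apply: measurable_minr => //; exact: measurable_cst. Qed.

Lemma pois_continuous j : continuous (@pois R j).
Proof.
move=> x; rewrite /pois; apply: cvgM.
  by apply: cvgM; [exact: exprn_continuous|exact: cvg_cst].
by apply: continuous_cvg; [exact: continuous_expR|exact: cvgN].
Qed.

Lemma pois_measurable j : measurable_fun setT (@pois R j).
Proof. by apply: continuous_measurable_fun; exact: pois_continuous. Qed.

Lemma pois_var_measurable (c0 c1 : R) j : measurable_fun setT (pois_var c0 c1 j).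
Proof.
apply: continuous_measurable_fun => x; rewrite /pois_var.
have H i c : (c * pois i y) @[y --> x] --> c * pois i x.
  by apply: cvgM; [exact: cvg_cst|exact: pois_continuous].
apply: cvgB; first by apply: cvgD; exact: H.
by apply: cvg_sqr; apply: cvgD; exact: H.
Qed.

Lemma sum_min1_le : exists2 C : R, 0 < C &
  \forall n \near \oo, \sum_u Num.min 1 (n%:R * q n u) <= C * (al n)%:R :> R.
Proof.
have [] := @urn_sum_dct R p rho p0 pni pinv prv rho1 M (fun _ x => Num.min 1 x)
  (fun x => Num.min 1 x) 1 nM ler01 _ _ min1_measurable.
- move=> x_ x x0 xx; apply: (@continuous_cvg nat R R \oo _ x_ (fun x => Num.min 1 x) x) xx.
  have : {for x, continuous ((fun=> 1 : R^o) \min (id : R -> R^o))}.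
    by apply: continuous_min; [exact: cst_continuous|exact: cvg_id].
  by move=> H.
- by move=> n x x0 _; rewrite mul1r ger0_norm// le_min ler01.
set v := \int[_]_(_ in _) _ => _ cv.
exists (`|v| + 1); first by rewrite ltr_wpDl.
have aloo := urn_al_cvgy p0 pinv.
near=> n; rewrite -ler_pdivrMr; last first.
  by rewrite ltr0n; near: n; exact: (iffLR (cvgnyPge _) aloo 1%N).
near: n; move/cvgrPdist_le : cv => /(_ 1 ltr01); apply: filterS => n.
by rewrite ler_distl => /andP[? _]; have := ler_norm v; lra.
Unshelve. all: by end_near. Qed.

Lemma sum_binp_cvg k : (0 < k)%N ->
  (\sum_u binp k n (q n u)) / (al n)%:R @[n --> \oo] --> gint rho k 1 / k`!%:R.
Proof.
move=> k0; have [] := @urn_sum_dct R p rho p0 pni pinv prv rho1 M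
  (fun n x => binp k n (x / n%:R)) (pois k) 1 nM ler01 _ _ (pois_measurable k).
- by move=> x_ x x0 xx; exact: binp_cvg.
- move=> n x x0 xn; have [x01 xE] := divnK_le x0 xn.
  by rewrite mul1r ger0_norm ?binp_ge0// -{2}xE binp_min.
move=> _; rewrite (has_pint_pois rho1 k0).2 => cv.
apply: cvg_trans cv; apply: near_eq_cvg; near=> n.
congr (_ / _); apply: eq_bigr => u _; congr (binp _ _ _).
by rewrite mulrC mulKf// pnatr_eq0 -lt0n; near: n; exact: nbhs_infty_gt.
Unshelve. all: by end_near. Qed.

Section two_values_limits.
Variables (c0 c1 : R) (k : nat).
Hypothesis k0 : (0 < k)%N.
Local Notation g := (two_values c0 c1 k).

Lemma urn_weight_le l : exists2 C : R, 0 < C &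
  \forall n \near \oo, urn_weight (q n) n l g <= C * (al n)%:R.
Proof.
have [C C0 HC] := sum_min1_le.
set K : R := (`|c0| + `|c1|) * (l%:R + 2 ^+ k.+2) + 1.
have K0 : 0 < K.
  by rewrite /K ltr_wpDl// mulr_ge0// addr_ge0// exprn_ge0.
exists (K * C); first by rewrite mulr_gt0.
apply: filterS HC => n Hn; rewrite -mulrA (le_trans _ (ler_wpM2l (ltW K0) Hn))//.
rewrite mulr_sumr; apply: ler_sum => u _.
have pu := p01 (ltn0Sn u).
have lnu : 0 <= l%:R + n%:R * p u.+1.
  by rewrite addr_ge0// mulr_ge0//; case/andP: pu.
have m0 : 0 <= Num.min 1 (n%:R * p u.+1).
  by rewrite le_min ler01 mulr_ge0//; case/andP: pu.
rewrite (le_trans (ler_wpM2r lnu (binE_norm_two_values _ _ _ _ pu)))// mulrDl -!mulrA.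
have B1 := binp_weight n k0 (ler0n R l) pu.
have B2 := binp_weight n (ltn0Sn k) (ler0n R l) pu.
have B1' : binp k n (p u.+1) * (l%:R + n%:R * p u.+1)
    <= (l%:R + 2 ^+ k.+2) * Num.min 1 (n%:R * p u.+1).
  apply: le_trans B1 _; apply: ler_wpM2r => //.
  by rewrite lerD2l ler_eXn2l// ltr1n.
have := ler_wpM2l (normr_ge0 c0) B1'; have := ler_wpM2l (normr_ge0 c1) B2.
rewrite /K; lra.
Qed.

(** Each binomial variance, as a function of x = n p, tends to [pois_var] and is O(min(1, x)), so
    [urn_sum_dct] applies. *)
Lemma urn_var_cvg v : has_pint rho (pois_var c0 c1 k) v ->
  (\sum_u urn_var (q n) n g u) / (al n)%:R @[n --> \oo] --> v.
Proof.
move=> [_ <-].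
pose h_ n x : R := binE (x / n%:R) n (fun j _ => g j ^+ 2)
                   - binE (x / n%:R) n (fun j _ => g j) ^+ 2.
have hE n y : h_ n y = c0 ^+ 2 * binp k n (y / n%:R) + c1 ^+ 2 * binp k.+1 n (y / n%:R)
    - (c0 * binp k n (y / n%:R) + c1 * binp k.+1 n (y / n%:R)) ^+ 2.
  rewrite /h_ binE_two_values; congr (_ - _).
  by rewrite -(binE_two_values _ _ k); apply: eq_binE => *; rewrite two_values_sqr.
have [] := @urn_sum_dct R p rho p0 pni pinv prv rho1 M h_ (pois_var c0 c1 k)
  (c0 ^+ 2 + c1 ^+ 2 + (`|c0| + `|c1|) ^+ 2) nM _ _ _ (pois_var_measurable c0 c1 k).
- by rewrite addr_ge0 ?addr_ge0 ?sqr_ge0.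
- move=> x_ x x0 xx.
  have H i c : (c * binp i n (x_ n / n%:R)) @[n --> \oo] --> c * pois i x.
    by apply: cvgM; [exact: cvg_cst|exact: binp_cvg].
  under eq_fun do rewrite hE.
  apply: cvgB; first by apply: cvgD; exact: H.
  by apply: cvg_sqr; apply: cvgD; exact: H.
- move=> n x x0 xn; have [x01 xE] := divnK_le x0 xn; rewrite hE.
  have := binp_min n k0 x01; have := binp_min n (ltn0Sn k) x01; rewrite xE.
  have := binp_ge0 k n x01; have := binp_ge0 k.+1 n x01.
  have m0 : 0 <= Num.min 1 x by rewrite le_min ler01.
  have m1 : Num.min 1 x <= 1 by rewrite ge_min lexx.
  move: (Num.min 1 x) m0 m1 (binp k n _) (binp k.+1 n _) => m m0 m1 a b b0 a0 bm am.
  rewrite (le_trans (ler_normB _ _))// mulrDl; apply: lerD.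
    rewrite ger0_norm; last first.
      by apply: addr_ge0; apply: mulr_ge0 => //; exact: sqr_ge0.
    by rewrite mulrDl; apply: lerD; apply: ler_wpM2l => //; exact: sqr_ge0.
  have N : `|c0 * a + c1 * b| <= (`|c0| + `|c1|) * m.
    rewrite (le_trans (ler_normD _ _))// !normrM (ger0_norm a0) (ger0_norm b0) mulrDl.
    by apply: lerD; exact: ler_wpM2l.
  have GG : 0 <= (`|c0| + `|c1|) * m by rewrite mulr_ge0// addr_ge0.
  rewrite normrX (le_trans (lerXn2r 2 _ _ N)) ?nnegrE//.
  rewrite exprMn; apply: ler_wpM2l; first exact: sqr_ge0.
  by rewrite expr2 -[leRHS]mulr1 ler_wpM2l.
move=> _ cv; apply: cvg_trans cv; apply: near_eq_cvg; near=> n.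
have n0 : (n%:R : R) != 0.
  by rewrite pnatr_eq0 -lt0n; near: n; exact: nbhs_infty_gt.
congr (_ / _); apply: eq_bigr => u _; rewrite urn_varE /h_ /urn_mean.
by rewrite [n%:R * _]mulrC mulfK.
Unshelve. all: by end_near. Qed.

End two_values_limits.

(** Finitely many urns carry all but e/2 of the mass, and each of their terms decays geometrically
    in m n; the other terms are at most their weights. *)
Lemma small_mass_cvg0 (m : nat -> nat) : m n @[n --> \oo] --> \oo ->
  small_mass (q n) (m n) @[n --> \oo] --> (0 : R).
Proof.
move=> moo; apply/cvgrPdist_le => e e0.
have e2 : 0 < e / 2 by rewrite divr_gt0.
have /cvgrPdist_le/(_ _ e2)[N _ /(_ N (leqnn N))/=] := psum1.
rewrite ler_distl => /andP[_ SN].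
have T0 : \sum_(i < N) p i.+1 * (1 - p i.+1 / 2) ^+ m n @[n --> \oo] --> (0 : R).
  elim: N {SN} => [|K IH].
    by under eq_fun do rewrite big_ord0; exact: cvg_cst.
  under eq_fun do rewrite big_ord_recr/=.
  have pK0 := p0 (ltn0Sn K); have /andP[_ pK1] := p01 (ltn0Sn K).
  have H : (1 - p K.+1 / 2) ^+ n @[n --> \oo] --> (0 : R).
    by apply: cvg_expr; rewrite ger0_norm; lra.
  have H2 : p K.+1 * (1 - p K.+1 / 2) ^+ m n @[n --> \oo] --> p K.+1 * (0 : R).
    by apply: cvgM; [exact: cvg_cst|exact: (cvg_comp _ _ moo H)].
  have := cvgD IH H2; rewrite mulr0 addr0 => H3.
  exact: H3.
have fb n i : 0 <= p i.+1 * (1 - p i.+1 / 2) ^+ m n <= p i.+1.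
  have /andP[pi0 pi1] := p01 (ltn0Sn i).
  have h0 : 0 <= 1 - p i.+1 / 2 by lra.
  rewrite mulr_ge0 ?exprn_ge0//= -[leRHS]mulr1 ler_wpM2l//.
  by rewrite exprn_ile1//; lra.
near=> n; rewrite sub0r normrN ger0_norm; last first.
  by apply: sumr_ge0 => u _; case/andP: (fb n u).
have Tn : \sum_(i < N) p i.+1 * (1 - p i.+1 / 2) ^+ m n <= e / 2.
  near: n; move/cvgrPdist_le : T0 => /(_ _ e2); apply: filterS => n.
  by rewrite sub0r normrN; apply: le_trans; exact: ler_norm.
rewrite /small_mass -(big_mkord xpredT (fun i => p i.+1 * (1 - p i.+1 / 2) ^+ m n)).
rewrite -(big_mkord xpredT (fun i => p i.+1 * (1 - p i.+1 / 2) ^+ m n)) in Tn.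
have NM : (N <= M n)%N.
  rewrite (leq_trans _ (nM n))//; have : (N <= n)%N.
    by near: n; exact: nbhs_infty_ge.
  nia.
have := psum_le1 (M n); rewrite -(big_mkord xpredT (fun i => p i.+1)) in SN *.
rewrite -(big_mkord xpredT (fun i => p i.+1)).
rewrite !(big_cat_nat (leq0n N) NM)/=.
have : \sum_(N <= i < M n) p i.+1 * (1 - p i.+1 / 2) ^+ m n <= \sum_(N <= i < M n) p i.+1.
  by apply: ler_sum => i _; case/andP: (fb n i).
lra.
Unshelve. all: by end_near. Qed.

End urn_limits.

(** * The law of the loads on the probability space *)

Section urn_law.
Variables (R : realType) (d : measure_display) (T : measurableType d).
Variables (P : probability T R) (p : nat -> R) (X : nat -> {RV P >-> nat}).
Hypothesis X_law : forall j i, (0 < i)%N -> P (X j @^-1` [set i]) = (p i)%:E.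
Hypothesis X_indep : mutually_independent X.

Lemma Rexp_sum (I : finType) (f : I -> T -> R) (C : R) :
  (forall i, measurable_fun setT (f i)) -> (forall i w, `|f i w| <= C) ->
  \int[P]_w (\sum_i f i w) = \sum_i \int[P]_w f i w.
Proof.
move=> mf fC; rewrite -[in RHS]big_enum; under eq_Rintegral do rewrite -big_enum/=.
elim: (enum I) => [|i s IH].
  by under eq_Rintegral do rewrite big_nil; rewrite big_nil Rexp_cst.
under eq_Rintegral do rewrite big_cons.
rewrite big_cons RintegralD ?IH//.
  by apply: (bounded_integrable_prob P measurableT (mf i) (fC i)).
apply: (@bounded_integrable_prob _ _ _ P (fun w => \sum_(j <- s) f j w) (\sum_(j <- s) C)) => //.
  exact: measurable_sum.
by move=> w; rewrite (le_trans (ler_norm_sum _ _ _))// ler_sum.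
Qed.

Lemma measurable_ball j A : measurable (X j @^-1` A).
Proof. by rewrite -[_ @^-1` _]setTI; exact: (measurable_funPT (X j)). Qed.

Definition balls n w : seq nat := mkseq (fun j => X j w) n.

Lemma measurable_balls n (phi : seq nat -> R) :
  measurable_fun setT (fun w => phi (balls n w)).
Proof.
elim: n phi => [|n IH] phi; first exact: (measurable_cst (phi [::])).
move=> _ A mA; rewrite setTI.
have -> : (fun w => phi (balls n.+1 w)) @^-1` A =
    \bigcup_i (X n @^-1` [set i] `&` (fun w => phi (rcons (balls n w) i)) @^-1` A).
  have S w : balls n.+1 w = rcons (balls n w) (X n w) by rewrite /balls mkseqS.
  apply/seteqP; split => [w /=|w [i _ [/= <-]]]; rewrite S => Aw //.
  by exists (X n w).
apply: bigcup_measurable => i _; apply: measurableI; first exact: measurable_ball.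
by rewrite -[_ @^-1` _]setTI; exact: (IH (fun s => phi (rcons s i))).
Qed.

Lemma urn_load_balls n i w : urn_load X n i w = (\sum_(j < n) (nth 0 (balls n w) j == i))%N.
Proof. by apply: eq_bigr => j _; rewrite nth_mkseq. Qed.

Variable M : nat.

Definition load_vec n w (u : 'I_M) := urn_load X n u.+1 w.

Lemma measurable_load_vec n (F : ('I_M -> nat) -> R) :
  measurable_fun setT (fun w => F (load_vec n w)).
Proof.
pose phi s := F (fun u => (\sum_(j < n) (nth 0 s j == u.+1))%N).
have -> : (fun w => F (load_vec n w)) = (fun w => phi (balls n w)).
  by apply/funext => w; congr F; apply/funext => u; rewrite /load_vec urn_load_balls.
exact: measurable_balls.
Qed.

(** Index 0 counts as outside, so a ball lands outside with exactly the probability left over by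
    urns 1 to M. *)
Definition urns_outside : set nat := [set i | ~~ (0 < i <= M)%N].

Lemma prob_outside j : P (X j @^-1` urns_outside) = (1 - \sum_(u < M) p u.+1)%:E.
Proof.
have H N : P (X j @^-1` [set i | (0 < i <= N)%N]) = (\sum_(u < N) p u.+1)%:E.
  elim: N => [|N IH].
    rewrite big_ord0 (_ : [set i | _] = set0) ?preimage_set0 ?measure0//.
    by apply/seteqP; split => // i /= /andP[]; lia.
  rewrite big_ord_recr/= EFinD -IH -(X_law j (ltn0Sn N)) -measureU; try exact: measurable_ball.
    rewrite -preimage_setU; congr (P (_ @^-1` _)); apply/seteqP; split => i /=.
      by move=> h; have [->|] := eqVneq i N.+1; [right|left; lia].
    by case => [|->]; lia.
  rewrite -preimage_setI (_ : _ `&` _ = set0) ?preimage_set0//.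
  by apply/seteqP; split => // i /= []; lia.
rewrite (_ : _ @^-1` _ = ~` (X j @^-1` [set i | (0 < i <= M)%N])).
  by rewrite probability_setC; [rewrite H EFinB|exact: measurable_ball].
by rewrite preimage_setC; apply/seteqP; split => w /=; move/negP.
Qed.

Definition later_event (s : seq nat) (B : nat -> set nat) : set T :=
  \bigcap_(j in [set` s]) X j @^-1` B j.

Lemma measurable_later s B : measurable (later_event s B).
Proof. by apply: bigcap_measurableType => // j _; exact: measurable_ball. Qed.

Definition set_ball n (A : set nat) (B : nat -> set nat) j := if j == n then A else B j.

Lemma later_event_cons n s A B w : n \notin s ->
  later_event (n :: s) (set_ball n A B) w <-> A (X n w) /\ later_event s B w.
Proof.
move=> ns; split.
  move=> H; split.
    by have := H n (mem_head _ _); rewrite /set_ball /= eqxx.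
  move=> j js; have := H j; rewrite /= inE js orbT /set_ball => /(_ isT).
  by case: eqP => // jn; move: js; rewrite jn /= (negbTE ns).
move=> [An H] j; rewrite /= inE /set_ball; case: eqP => [->//|_ /= js]; exact: H.
Qed.

Lemma prob_later_cons n s A B : uniq s -> n \notin s ->
  fine (P (later_event (n :: s) (set_ball n A B)))
  = fine (P (X n @^-1` A)) * fine (P (later_event s B)).
Proof.
move=> us ns; rewrite /later_event !X_indep/= ?us ?ns// big_cons /set_ball eqxx.
have -> : (\prod_(j <- s) P (X j @^-1` (if j == n then A else B j)) =
           \prod_(j <- s) P (X j @^-1` B j))%E.
  rewrite !big_seq; apply: eq_bigr => j js; case: eqP => // jn.
  by move: js; rewrite jn /= (negbTE ns).
rewrite -X_indep// fineM// fin_num_measure//; first exact: measurable_ball.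
exact: measurable_later.
Qed.

Let r := 1 - \sum_(u < M) p u.+1.

(** The event on later balls makes the induction go through: the ball of index n leaves the load
    vector and becomes one more condition in the event, split according to where it lands. *)
Lemma Rexp_load_later n s B (F : ('I_M -> nat) -> R) (C : R) :
  uniq s -> {in s, forall j, n <= j}%N -> (forall J, `|F J| <= C) ->
  \int[P]_w (F (load_vec n w) * \1_(later_event s B) w)
  = multE (fun u : 'I_M => p u.+1) r n F * fine (P (later_event s B)).
Proof.
elim: n s B F => [|n IH] s B F us ns FC.
  have -> : (fun w => F (load_vec 0 w) * \1_(later_event s B) w)
      = (fun w => F (fun=> 0%N) * \1_(later_event s B) w).
    apply/funext => w; congr (F _ * _); apply/funext => u.
    by rewrite /load_vec /urn_load big_ord0.
  have mI : measurable_fun setT (\1_(later_event s B) : T -> R).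
    by apply: measurable_indic; exact: measurable_later.
  rewrite RintegralZl//; last first.
    by apply: (bounded_integrable_prob P (B := 1)) => // w; rewrite indicE; case: (_ \in _); rewrite ?normr1 ?normr0.
  rewrite /= /Rintegral integral_indic ?setIT//; exact: measurable_later.
have nns : n \notin s by apply/negP => /ns; rewrite ltnn.
pose D A := later_event (n :: s) (set_ball n A B).
have mD A : measurable (D A) by exact: measurable_later.
have uns : uniq (n :: s) by rewrite /= nns.
have nsn : {in n :: s, forall j, n <= j}%N.
  by move=> j; rewrite inE => /predU1P[->//|/ns]; exact: ltnW.
have E w : F (load_vec n.+1 w) * \1_(later_event s B) w =
    F (load_vec n w) * \1_(D urns_outside) w
    + \sum_(u < M) F (add_ball u (load_vec n w)) * \1_(D [set u.+1]) w.
  have DE A : \1_(D A) w = \1_(later_event s B) w * \1_A (X n w) :> R.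
    rewrite !indicE -natrM mulnb; congr (nat_of_bool _)%:R.
    apply/idP/andP; rewrite !inE.
      by move/(later_event_cons _ _ _ nns) => [].
    by case=> ? ?; apply/(later_event_cons _ _ _ nns).
  have loadS u : load_vec n.+1 w u = (load_vec n w u + (X n w == u.+1))%N.
    by rewrite /load_vec /urn_load big_ord_recr.
  rewrite DE; under eq_bigr do rewrite DE.
  have [/andP[i0 iM]|out] := boolP (0 < X n w <= M)%N.
    have iM' : ((X n w).-1 < M)%N by rewrite prednK.
    pose v := Ordinal iM'; have XE : X n w = v.+1 by rewrite /v/= prednK.
    rewrite (bigD1 v)//= big1 ?addr0; last first.
      move=> u uv; rewrite [X in _ * (_ * X)](_ : _ = 0) ?mulr0// indicE memNset//=.
      by rewrite XE => -[vu]; case/eqP: uv; exact/val_inj/esym.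
    rewrite [\1_urns_outside _]indicE memNset/= ?mulr0 ?add0r; last first.
      by rewrite /urns_outside /= i0 iM.
    rewrite [\1_[set _] _]indicE mem_set/= ?mulr1//.
    congr (F _ * _); apply/funext => u; rewrite loadS /add_ball addnC XE eqSS.
    by rewrite (inj_eq val_inj).
  rewrite big1 ?addr0; last first.
    move=> u _; rewrite [X in _ * (_ * X)](_ : _ = 0) ?mulr0// indicE memNset//=.
    by move=> XE; move: out; rewrite XE/= ltn_ord.
  rewrite [\1_urns_outside _]indicE mem_set/= ?mulr1//.
  congr (F _ * _); apply/funext => u; rewrite loadS.
  case: eqP => [XE|]; last by rewrite addn0.
  by move: out; rewrite XE/= ltn_ord.
under eq_Rintegral do rewrite E.
have mG (G : ('I_M -> nat) -> R) A : measurable_fun setT (fun w => G (load_vec n w) * \1_(D A) w).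
  by apply: measurable_funM; [exact: measurable_load_vec|exact: measurable_indic].
have bG (G : ('I_M -> nat) -> R) A w : (forall J, `|G J| <= C) -> `|G (load_vec n w) * \1_(D A) w| <= C.
  move=> GC; rewrite indicE; case: (_ \in _); rewrite ?mulr1// mulr0 normr0.
  exact: le_trans (normr_ge0 _) (GC (fun=> 0%N)).
rewrite RintegralD//; last 2 first.
- by apply: (bounded_integrable_prob P (B := C)) => // w; exact: bG.
- apply: (@bounded_integrable_prob _ _ _ P (fun w => \sum_(u < M) F (add_ball u (load_vec n w)) * \1_(D [set u.+1]) w) (\sum_(u < M) C)) => //.
    by apply: measurable_sum => u; exact: (mG (F \o add_ball u)).
  move=> w; apply: le_trans (ler_norm_sum _ _ _) _; apply: ler_sum => u _.
  by apply: (bG (F \o add_ball u)) => J; exact: FC.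
rewrite (@Rexp_sum _ (fun (u : 'I_M) w => F (add_ball u (load_vec n w)) * \1_(D [set u.+1]) w) C); last 2 first.
- by move=> u; exact: (mG (F \o add_ball u)).
- by move=> u w; apply: (bG (F \o add_ball u)) => J; exact: FC.
rewrite IH// /D prob_later_cons// prob_outside/= -/r [in RHS]mulrDl [in RHS]mulr_suml; congr (_ + _).
  by rewrite mulrCA mulrA.
apply: eq_bigr => u _; have FuC J : `|(F \o add_ball u) J| <= C by exact: FC.
rewrite (IH _ _ (F \o add_ball u) uns nsn FuC) prob_later_cons// X_law//=.
by rewrite mulrCA mulrA.
Qed.

Lemma Rexp_load n (F : ('I_M -> nat) -> R) (C : R) : (forall J, `|F J| <= C) ->
  \int[P]_w F (load_vec n w) = multE (fun u : 'I_M => p u.+1) r n F.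
Proof.
move=> FC; have nilP : {in [::] : seq nat, forall j, (n <= j)%N} by [].
have := @Rexp_load_later n [::] (fun=> setT) F C isT nilP FC.
have -> : later_event [::] (fun=> setT) = setT by apply/seteqP; split.
rewrite (congr1 fine (probability_setT P))/= mulr1 => <-.
by apply: eq_Rintegral => w _; rewrite indicE in_setT mulr1.
Qed.

Definition some_outside n : set T := \big[setU/set0]_(j < n) (X j @^-1` urns_outside).

Lemma measurable_some_outside n : measurable (some_outside n).
Proof. by apply: bigsetU_measurable => j _; exact: measurable_ball. Qed.

Lemma prob_some_outside n : fine (P (some_outside n)) <= n%:R * r.
Proof.
rewrite /some_outside; elim: n => [|n IH]; first by rewrite big_ord0 measure0 mul0r.
rewrite big_ord_recr/= (le_trans (fine_prob_setU _ _ _))//.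
- exact: measurable_some_outside.
- exact: measurable_ball.
by rewrite -natr1 mulrDl mul1r lerD// prob_outside.
Qed.

Definition occ_vec k (J : 'I_M -> nat) : R := \sum_u (J u == k)%:R.

(** Urns beyond N are empty, and since k > 0 an empty urn is not counted. *)
Lemma urn_occE N n k w : (0 < k)%N -> (forall j, j < n -> X j w <= N)%N ->
  urn_occ R X n k w = \sum_(i < N) (urn_load X n i.+1 w == k)%:R.
Proof.
move=> k0 XN; rewrite -(big_mkord xpredT (fun i => (urn_load X n i.+1 w == k)%:R : R)).
rewrite -(big_add1 _ _ 0 N.+1 xpredT (fun i => (urn_load X n i w == k)%:R : R)) /urn_occ.
have L i : (N < i)%N -> urn_load X n i w = 0%N.
  move=> Ni; rewrite /urn_load big1// => j _; case: eqP => // XE.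
  by have := XN j (ltn_ord j); rewrite XE leqNgt Ni.
have S : [set` index_iota 1 N.+1] `<=` [set i : nat | (1 <= i)%N].
  by move=> i /=; rewrite mem_index_iota => /andP[].
rewrite (@fsbig_seq _ _ _ _ (index_iota 1 N.+1)) ?iota_uniq//; apply/esym.
apply: fsbig_widen => // i [/= i1]; rewrite mem_index_iota i1/= ltnS => /negP.
by rewrite -ltnNge => Ni; rewrite L// (ltn_eqF k0).
Qed.

Lemma sum_urn_load_le N n w : (\sum_(i < N) urn_load X n i.+1 w <= n)%N.
Proof.
rewrite exchange_big/= -[leqRHS](card_ord n) -sum1_card; apply: leq_sum => j _.
case: (X j w) => [|x]; first by rewrite big1.
under eq_bigr do rewrite eqSS.
have [xN|Nx] := ltnP x N.
  rewrite (bigD1 (Ordinal xN))//= eqxx big1// => i /eqP iE.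
  by case: eqP => // xi; case: iE; exact/val_inj/esym.
by rewrite big1// => i _; rewrite gtn_eqF// (leq_trans (ltn_ord i)).
Qed.

Lemma sum_load_eq_le N n k w : (0 < k)%N ->
  0 <= (\sum_(i < N) ((urn_load X n i.+1 w == k)%:R : R)) <= n%:R.
Proof.
move=> k0; apply/andP; split; first exact: sumr_ge0.
apply: (@le_trans _ _ (\sum_(i < N) (urn_load X n i.+1 w)%:R)).
  apply: ler_sum => i _; case: eqP => [->|_]; last exact: ler0n.
  by rewrite ler1n.
by rewrite -natr_sum ler_nat sum_urn_load_le.
Qed.

Lemma urn_occ_bounds n k w : (0 < k)%N -> 0 <= urn_occ R X n k w <= n%:R.
Proof.
move=> k0; rewrite (@urn_occE (\max_(j < n) X j w))//; first exact: sum_load_eq_le.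
by move=> j jn; exact: (leq_bigmax (Ordinal jn)).
Qed.

Lemma urn_occ_load_vec n k w : (0 < k)%N -> ~ some_outside n w ->
  urn_occ R X n k w = occ_vec k (load_vec n w).
Proof.
move=> k0 out; apply: urn_occE => // j jn.
apply/negPn/negP => XM; apply: out; rewrite /some_outside -(bigcup_mkord n (fun j => X j @^-1` urns_outside)).
by exists j => //=; rewrite /urns_outside /= (negbTE XM) andbF.
Qed.

Lemma measurable_urn_occ n k k' (F : R -> R -> R) :
  measurable_fun setT (fun w => F (urn_occ R X n k w) (urn_occ R X n k' w)).
Proof.
pose occ s k0 : R := \sum_(i \in [set i : nat | (1 <= i)%N])
  (((\sum_(j < n) (nth 0 s j == i))%N == k0)%:R : R).
have occE k0 w : urn_occ R X n k0 w = occ (balls n w) k0.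
  by rewrite /urn_occ /occ; apply: eq_fsbigr => i _; rewrite urn_load_balls.
under eq_fun do rewrite !occE.
exact: (measurable_balls n (fun s => F (occ s k) (occ s k'))).
Qed.

Lemma occ_vec_bounds n k w : (0 < k)%N -> 0 <= occ_vec k (load_vec n w) <= n%:R.
Proof. exact: sum_load_eq_le. Qed.

(** Both counts lie in [0, n] and can differ only on [some_outside n], an event of probability at
    most n r. *)
Lemma expectation_urn_occ n k : (0 < k)%N -> 0 <= r ->
  `|fine ('E_P[urn_occ R X n k]%E) - multE (fun u : 'I_M => p u.+1) r n (occ_vec k)|
  <= n%:R * (n%:R * r).
Proof.
move=> k0 r0; have -> : fine ('E_P[urn_occ R X n k]%E) = \int[P]_w urn_occ R X n k w.
  by rewrite unlock.
rewrite -(@Rexp_load n (occ_vec k) (\sum_(u < M) 1)); last first.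
  move=> J; rewrite (le_trans (ler_norm_sum _ _ _))// ler_sum// => u _.
  by rewrite normr_nat; case: eqP.
have mo := measurable_urn_occ n k k (fun x _ => x); have ml := measurable_load_vec n (occ_vec k).
rewrite -RintegralB//; last 2 first.
- apply: (bounded_integrable_prob P (B := n%:R)) => // w.
  by have /andP[h0 h1] := urn_occ_bounds n w k0; rewrite ger0_norm.
- apply: (@bounded_integrable_prob _ _ _ P (fun w => occ_vec k (load_vec n w)) n%:R) => // w.
  by have /andP[h0 h1] := occ_vec_bounds n w k0; rewrite ger0_norm.
have := @Rexp_indic_bound _ _ _ P (fun w => urn_occ R X n k w - occ_vec k (load_vec n w))
  (some_outside n) 0 n%:R (measurable_funB mo ml) (measurable_some_outside n) (ler0n _ _).
rewrite add0r => H; apply: le_trans (H _) _; last first.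
  by apply: ler_wpM2l => //; exact: prob_some_outside.
move=> w; rewrite add0r indicE; have [out|good] := boolP (w \in some_outside n).
  rewrite mulr1; have := urn_occ_bounds n w k0; have := occ_vec_bounds n w k0.
  by rewrite ler_distl => /andP[? ?] /andP[? ?]; apply/andP; split; lra.
by rewrite urn_occ_load_vec// ?subrr ?normr0 ?mulr0//; move: good; rewrite notin_setE.
Qed.

End urn_law.

(** * Law of large numbers and central limit theorem for the urns *)

Section urn_clt.
Variables (R : realType) (d : measure_display) (T : measurableType d).
Variables (P : probability T R) (p : nat -> R) (X : nat -> {RV P >-> nat}).
Variables (rho : R) (M : nat -> nat).
Hypothesis X_law : forall j i, (0 < i)%N -> P (X j @^-1` [set i]) = (p i)%:E.
Hypothesis X_indep : mutually_independent X.
Hypothesis p0 : forall i, (0 < i)%N -> 0 < p i.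
Hypothesis pni : forall i, (0 < i)%N -> p i.+1 <= p i.
Hypothesis pinv : forall i, (0 < i)%N -> p i <= i%:R^-1.
Hypothesis prv : forall a, (0 < a)%N ->
  p (a * i)%N / p i @[i --> \oo] --> a%:R `^ (- rho).
Hypothesis rho1 : 1 < rho.
Hypothesis nM : forall n, (n * n <= M n)%N.
Hypothesis psum1 : \sum_(i < N) p i.+1 @[N --> \oo] --> (1 : R).
Hypothesis p1 : p 1 < 1.
Local Notation al := (urn_al p).
Local Notation q := (fun n (u : 'I_(M n)) => p u.+1).
Local Notation r := (fun n => 1 - \sum_(u < M n) p u.+1).
Local Notation J := (fun n w => @load_vec R d T P X (M n) n w).
Hypothesis nr : forall n : nat, n%:R * (n%:R * r n) <= 1.

Lemma urn_subprob n : subprob (q n) (r n).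
Proof.
split; [by move=> u; exact/ltW/p0| |by rewrite subrK].
by rewrite subr_ge0 (psum_le1 p0 psum1).
Qed.

Lemma urn_prob_le n (u : 'I_(M n)) : q n u <= 1 - (1 - p 1).
Proof.
rewrite subKr; case: u => u /= _; elim: u => // u IH.
exact: le_trans (pni (ltn0Sn u)) IH.
Qed.

Lemma al_gt0 : \forall n \near \oo, (0 < al n)%N.
Proof. exact: (iffLR (cvgnyPge _) (urn_al_cvgy p0 pinv) 1%N). Qed.

Lemma dev_sum_le c0 c1 k n I :
  `|dev_sum (q n) n (two_values c0 c1 k) I| <= \sum_(u < M n) 2 * (`|c0| + `|c1|).
Proof.
apply: le_trans (ler_norm_sum _ _ _) _; apply: ler_sum => u _.
exact: (urn_dev_le n (urn_subprob n) (two_values_norm c0 c1 k)).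
Qed.

(** Chebyshev's inequality with [dev_sum_variance] and [urn_weight_le]. The threshold t is
    quantified after n, so it may depend on n. *)
Lemma prob_dev_sum_gt (c0 c1 : R) k : (0 < k)%N -> exists2 C : R, 0 < C &
  \forall n \near \oo, forall t : R, 0 < t ->
    fine (P [set w | t < `|dev_sum (q n) n (two_values c0 c1 k) (J n w)|])
    <= C * (al n)%:R / t ^+ 2.
Proof.
move=> k0; set g := two_values c0 c1 k; pose G : R := `|c0| + `|c1|.
have [C C0 HC] := urn_weight_le p0 pni pinv prv rho1 nM c0 c1 k0 k.+1.
have G0 : 0 <= G by exact: addr_ge0.
have GC0 : 0 <= 3 * G * C by apply: mulr_ge0; [exact: mulr_ge0|exact: ltW].
exists (3 * G * C + C); first exact: ltr_wpDl.
near=> n => t t0; rewrite ler_pdivlMr ?exprn_gt0//.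
pose Y w := dev_sum (q n) n g (J n w).
pose B : R := \sum_(u < M n) 2 * G.
have YB w : `|Y w| <= B by exact: dev_sum_le.
have Dn I : `|dev_sum (q n) n g I ^+ 2| <= B ^+ 2.
  have B0 : 0 <= B := le_trans (normr_ge0 _) (dev_sum_le c0 c1 k I).
  by rewrite normrX; apply: lerXn2r; rewrite ?nnegrE//; exact: dev_sum_le.
have mY : measurable_fun setT Y by exact: (measurable_load_vec X n (dev_sum (q n) n g)).
have mA : measurable [set w | t < `|Y w|].
  by apply: (@measurable_set_lt _ _ _ (fun=> t) (fun w => `|Y w|)) => //; exact: measurableT_comp.
have EY : \int[P]_w (Y w ^+ 2) <= 3 * G * C * (al n)%:R.
  rewrite (Rexp_load X_law X_indep n Dn).
  apply: le_trans (dev_sum_variance n (urn_subprob n) _ (@urn_prob_le n)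
    (two_values_norm c0 c1 k) (@two_values_supp _ c0 c1 k) (ltn0Sn k)) _.
    by rewrite subr_gt0.
  rewrite -[leRHS]mulrA ler_wpM2l ?mulr_ge0//.
  by near: n; exact: HC.
apply: (@le_trans _ _ (3 * G * C * (al n)%:R)); last first.
  by apply: ler_wpM2r => //; rewrite lerDl ltW.
apply: le_trans EY; rewrite mulrC.
have -> : t ^+ 2 * fine (P [set w | t < `|Y w|])
    = \int[P]_w (t ^+ 2 * \1_[set w | t < `|Y w|] w).
  rewrite RintegralZl//.
    by rewrite /Rintegral integral_indic// setIT.
  apply: (bounded_integrable_prob P (B := 1)) => // w; rewrite indicE.
  by case: (_ \in _); rewrite ?normr1 ?normr0.
have mt : measurable_fun setT (fun w => t ^+ 2 * \1_[set w | t < `|Y w|] w).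
  by apply: measurable_funM => //; exact: measurable_indic.
apply: le_Rintegral => //.
- apply: (@bounded_integrable_prob _ _ _ P _ (t ^+ 2)) => // w.
  rewrite indicE; case: (_ \in _); rewrite ?mulr1 ?mulr0 ?normr0 ?sqr_ge0//.
  by rewrite ger0_norm ?sqr_ge0.
- apply: (@bounded_integrable_prob _ _ _ P (fun w => Y w ^+ 2) (B ^+ 2)) => //.
    exact: measurable_funX.
  by move=> w; exact: (Dn (J n w)).
move=> w _; rewrite indicE; have [tY|_] := boolP (w \in _); last by rewrite mulr0 sqr_ge0.
rewrite mulr1 -[leRHS]real_normK ?num_real//.
by move: tY; rewrite inE => /= /ltW tY; apply: lerXn2r => //; rewrite nnegrE ltW.
Unshelve. all: by end_near. Qed.

Lemma dev_sum_occ c0 c1 k n (I : 'I_(M n) -> nat) :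
  dev_sum (q n) n (two_values c0 c1 k) I =
  c0 * (occ_vec R k I - \sum_u binp k n (q n u))
  + c1 * (occ_vec R k.+1 I - \sum_u binp k.+1 n (q n u)).
Proof.
rewrite /occ_vec -!sumrB !mulr_sumr -big_split; apply: eq_bigr => u _ /=.
by rewrite /urn_dev /urn_mean binE_two_values /two_values; ring.
Qed.

Lemma multE_occ k n :
  multE (q n) (r n) n (occ_vec R k) = \sum_u binp k n (q n u).
Proof.
rewrite /occ_vec multE_sum; apply: eq_bigr => u _.
by rewrite (multE_urn u (urn_subprob n) n (fun j => (j == k)%:R)).
Qed.

Lemma near_norm_cvg0 (u v : nat -> R) :
  (\forall n \near \oo, `|u n| <= v n) -> v n @[n --> \oo] --> (0 : R) ->
  u n @[n --> \oo] --> (0 : R).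
Proof.
move=> uv v0; apply/cvgr0Pnorm_le => e e0.
near=> n; apply: (@le_trans _ _ (v n)); first by near: n; exact: uv.
apply: le_trans (ler_norm _) _; near: n.
by move/cvgr0Pnorm_le : v0; exact.
Unshelve. all: by end_near. Qed.

Section scaling.
Variable A : R.
Hypothesis A0 : 0 < A.
Local Notation b := (fun n => Num.sqrt (A * (al n)%:R)).

Lemma scale_sqr n : b n ^+ 2 = A * (al n)%:R.
Proof. by rewrite sqr_sqrtr// mulr_ge0// ltW. Qed.

Lemma scale_gt0 : \forall n \near \oo, 0 < b n.
Proof.
by apply: filterS al_gt0 => n an; rewrite sqrtr_gt0 mulr_gt0// ltr0n.
Qed.

Lemma scale_inv_cvg0 : (b n)^-1 @[n --> \oo] --> (0 : R).
Proof.
have boo : b n @[n --> \oo] --> +oo.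
  apply/cvgryPge => K; near=> n; apply: le_trans (ler_norm K) _.
  rewrite -sqrtr_sqr ler_wsqrtr// mulrC -ler_pdivrMr//.
  have /ltW/le_trans := truncnS_gt (K ^+ 2 / A); apply; rewrite ler_nat.
  near: n; exact: (iffLR (cvgnyPge _) (urn_al_cvgy p0 pinv)).
exact: (cvg_comp _ _ boo (@inv_cvgy R)).
Unshelve. all: by end_near. Qed.

Lemma scale_div_cvg0 : b n / n%:R @[n --> \oo] --> (0 : R).
Proof.
apply: (@near_norm_cvg0 _ (fun n => A * (b n)^-1)); last first.
  by rewrite -(mulr0 A); apply: cvgM; [exact: cvg_cst|exact: scale_inv_cvg0].
near=> n.
have [n0 n1] : (0 < n)%N /\ n%:R^-1 <= p 1 by near: n; exact: near_p1.
have b0 : 0 < b n by near: n; exact: scale_gt0.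
have [_ _ _ an] := urn_al_spec pinv n0 n1.
have nR : 0 < n%:R :> R by rewrite ltr0n.
rewrite ger0_norm; last by rewrite divr_ge0 ?sqrtr_ge0.
by rewrite ler_pdivrMr// mulrAC ler_pdivlMr// -expr2 scale_sqr ler_pM2l// ler_nat.
Unshelve. all: by end_near. Qed.

Section stein.
Variables (c0 c1 s : R) (k : nat).
Hypothesis k0 : (0 < k)%N.
Hypothesis var : has_pint rho (pois_var c0 c1 k) (A * s ^+ 2).
Local Notation g := (two_values c0 c1 k).
Local Notation W := (fun n w => dev_sum (q n) n g (J n w) / b n).

(** [stein_multinomial] with l = k+1, where [urn_weight] is O(b^2), together with convergence of the
    summed variances over b^2 to s^2. *)
Lemma stein_urn_cvg (f f1 : R -> R) (C0 C1 C2 : R) :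
  [/\ forall x, `|f x| <= C0, forall x, `|f1 x| <= C1,
     forall x y, `|f x - f y| <= C1 * `|x - y|,
     forall x y, `|f1 x - f1 y| <= C2 * `|x - y| &
     forall x t, `|f (x + t) - f x - t * f1 x| <= C2 * t ^+ 2] ->
  \int[P]_w (s ^+ 2 * f1 (W n w) - W n w * f (W n w)) @[n --> \oo] --> (0 : R).
Proof.
move=> [fC0 f1C1 fL f1L f2].
pose G : R := `|c0| + `|c1|; have G0 : 0 <= G by exact: addr_ge0.
have [C C_gt0 HC] := urn_weight_le p0 pni pinv prv rho1 nM c0 c1 k0 k.+1.
pose c := 1 - p 1; have c_gt0 : 0 < c by rewrite subr_gt0.
pose sm n := small_mass (q n) n./2.
pose V n := \sum_u urn_var (q n) n g u.
(* [E1 n] is b n times [cov_rate] at (C1, C0), and [E2 n] is [cov_rate] at (C2, C1); [beta] is the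
   bound of [stein_multinomial] after [urn_weight] is replaced by (C / A) b^2, plus the error in the
   variance. *)
pose E1 n := 2 * C1 * G * 2 ^+ k.+1 / c * sm n + 4 * C0 * (b n / n%:R).
pose E2 n := 2 * C2 * G * 2 ^+ k.+1 / c * (sm n * (b n)^-1) + 4 * C1 * n%:R^-1.
pose beta n := `|V n / (al n)%:R / A - s ^+ 2| * C1
  + C / A * (E1 n + 3 * G * E2 n + 4 * C2 * G ^+ 2 * (b n)^-1).
have sm0 : sm n @[n --> \oo] --> (0 : R).
  apply: (small_mass_cvg0 p0 pinv rho1 nM psum1 (m := fun n => n./2)).
  by apply/cvgnyPge => N; exists (N.*2)%N => // n /= Nn; rewrite -(doubleK N) half_leq.
have beta0 : beta n @[n --> \oo] --> (0 : R).
  have HV : V n / (al n)%:R / A - s ^+ 2 @[n --> \oo] --> (0 : R).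
    have H := urn_var_cvg p0 pni pinv prv rho1 nM k0 var.
    have -> : (0 : R) = A * s ^+ 2 / A - s ^+ 2.
      by rewrite mulrAC divff ?gt_eqF// mul1r subrr.
    by apply: cvgB; [apply: cvgM; [exact: H|exact: cvg_cst]|exact: cvg_cst].
  have Z (a : R) (u : nat -> R) : u n @[n --> \oo] --> (0 : R) ->
      a * u n @[n --> \oo] --> (0 : R).
    by move=> u0; rewrite -(mulr0 a); apply: cvgM; [exact: cvg_cst|].
  have D (u v : nat -> R) : u n @[n --> \oo] --> (0 : R) ->
      v n @[n --> \oo] --> (0 : R) -> u n + v n @[n --> \oo] --> (0 : R).
    by move=> u0 v0; rewrite -(addr0 0); exact: cvgD.
  have inv0 : (n%:R : R)^-1 @[n --> \oo] --> (0 : R) by exact: inv_natR_cvg.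
  apply: (D _ _); last apply: (Z (C / A)); last apply: (D _ _); last exact/Z/scale_inv_cvg0.
    by rewrite -(mul0r C1); apply: cvgM; [exact/norm_cvg0P|exact: cvg_cst].
  apply: (D _ _); first by apply: (D _ _); apply: (Z _ _); [exact: sm0|exact: scale_div_cvg0].
  apply: (Z _ _); apply: (D _ _); apply: (Z _ _); last exact: inv0.
  by rewrite -(mulr0 0); apply: cvgM; [exact: sm0|exact: scale_inv_cvg0].
apply: near_norm_cvg0 beta0; near=> n.
have n0 : (0 < n)%N by near: n; exact: nbhs_infty_gt.
have b0 : 0 < b n by near: n; exact: scale_gt0.
have a0 : (0 < al n)%N by near: n; exact: al_gt0.
have Hw : urn_weight (q n) n k.+1 g <= C * (al n)%:R by near: n; exact: HC.
have C00 := le_trans (normr_ge0 _) (fC0 0).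
have C10 := le_trans (normr_ge0 _) (f1C1 0).
have C20 : 0 <= C2 by have := le_trans (normr_ge0 _) (f2 0 1); rewrite expr1n mulr1.
pose B : R := \sum_(u < M n) 2 * G.
pose Wv I := dev_sum (q n) n g I / b n.
have WB I : `|Wv I| <= B / b n.
  by rewrite normrM normfV (gtr0_norm b0) ler_pM2r ?invr_gt0//; exact: dev_sum_le.
pose F1 I := s ^+ 2 * f1 (Wv I); pose F2 I := Wv I * f (Wv I).
have FB I : `|F1 I - F2 I| <= s ^+ 2 * C1 + B / b n * C0.
  apply: le_trans (ler_normB _ _) _; apply: lerD.
    by rewrite normrM ger0_norm ?sqr_ge0//; apply: ler_wpM2l; [exact: sqr_ge0|].
  by rewrite normrM; exact: ler_pM.
rewrite (Rexp_load X_law X_indep n FB) multEB multEZ.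
have qr := urn_subprob n.
have S := @stein_multinomial R _ (q n) (r n) c G n k.+1 g qr c_gt0 (@urn_prob_le n)
  (two_values_norm c0 c1 k) (@two_values_supp _ c0 c1 k) (ltn0Sn k) n0 (b n) b0
  f f1 C0 C1 C2 fC0 f1C1 fL f1L f2.
have E1C1 : `|multE (q n) (r n) n (fun I => f1 (Wv I))| <= C1.
  by apply: (multE_bound qr) => I; exact: f1C1.
have VE : V n / b n ^+ 2 = V n / (al n)%:R / A by rewrite scale_sqr invfM mulrA mulrAC.
rewrite -[\sum_u urn_var _ _ _ _]/(V n) VE in S.
set EF := multE _ _ n F2 in S *; set Ef := multE _ _ n (fun I => f1 (Wv I)) in S E1C1 *.
have -> : s ^+ 2 * Ef - EF = - (V n / (al n)%:R / A - s ^+ 2) * Ef - (EF - V n / (al n)%:R / A * Ef).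
  by ring.
apply: le_trans (ler_normB _ _) _; apply: lerD.
  by rewrite normrM normrN; apply: ler_wpM2l.
apply: le_trans S _.
set K := (X in _ * X <= _).
have K0 : 0 <= K.
  have c10 := cov_rate_ge0 n k.+1 qr c_gt0 (two_values_norm c0 c1 k) b0 C10 C00.
  have c20 := cov_rate_ge0 n k.+1 qr c_gt0 (two_values_norm c0 c1 k) b0 C20 C10.
  rewrite /K !addr_ge0// ?divr_ge0 ?mulr_ge0 ?exprn_ge0 ?(ltW b0)//.
apply: le_trans (ler_wpM2r K0 Hw) _.
have -> : C * (al n)%:R = C / A * b n ^+ 2.
  by rewrite scale_sqr mulrA divfK// gt_eqF.
rewrite -[leLHS]mulrA; apply: ler_wpM2l; first by apply: divr_ge0; exact: ltW.
rewrite /K /E1 /E2 /cov_rate -/(sm n) le_eqVlt; apply/orP; left; apply/eqP.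
by field; rewrite ?gt_eqF// ltr0n.
Unshelve. all: by end_near. Qed.

End stein.

(** The mean of the count over b^2 tends to 1 by the choice of A, which uses half of delta;
    Chebyshev with values 1 at k and 0 at k+1 covers the other half. *)
Lemma urn_lln k (delta : R) : (0 < k)%N -> A = gint rho k 1 / k`!%:R -> 0 < delta ->
  fine (P [set w | delta < `|occ_vec R k (J n w) / b n ^+ 2 - 1|]) @[n --> \oo] --> (0 : R).
Proof.
move=> k0 AE delta0; have [C C0 HC] := prob_dev_sum_gt 1 0 k0.
have delta2 : 0 < delta / 2 by rewrite divr_gt0.
have mu1 : (\sum_u binp k n (q n u)) / (al n)%:R / A @[n --> \oo] --> (1 : R).
  have H := sum_binp_cvg p0 pni pinv prv rho1 nM k0; rewrite -AE in H.
  have := cvgM H (cvg_cst A^-1); rewrite divff ?gt_eqF// => H2; exact: H2.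
apply: (@near_norm_cvg0 _ (fun n => C / (delta / 2) ^+ 2 / A * ((b n)^-1 * (b n)^-1))); last first.
  have H := cvgM (cvg_cst (C / (delta / 2) ^+ 2 / A)) (cvgM scale_inv_cvg0 scale_inv_cvg0).
  by rewrite !mulr0 in H; exact: H.
near=> n.
have b0 : 0 < b n by near: n; exact: scale_gt0.
have a0 : (0 < al n)%N by near: n; exact: al_gt0.
have b2 := scale_sqr n; have aR : 0 < (al n)%:R :> R by rewrite ltr0n.
have mu_n : `|1 - (\sum_u binp k n (q n u)) / (al n)%:R / A| <= delta / 2.
  by near: n; move/cvgrPdist_le : mu1; exact.
rewrite ger0_norm; last exact/fine_ge0/measure_ge0.
have HCn : forall t : R, 0 < t ->
    fine (P [set w | t < `|dev_sum (q n) n (two_values 1 0 k) (J n w)|])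
    <= C * (al n)%:R / t ^+ 2 by near: n; exact: HC.
have t0 : 0 < delta / 2 * b n ^+ 2 by rewrite mulr_gt0// exprn_gt0.
have m1 (c : R) (F : ('I_(M n) -> nat) -> R) : measurable [set w | c < `|F (J n w)|].
  apply: (@measurable_set_lt _ _ _ (fun=> c) (fun w => `|F (J n w)|)) => //.
  by apply: measurableT_comp => //; exact: (measurable_load_vec X n F).
apply: (@le_trans _ _ (C * (al n)%:R / (delta / 2 * b n ^+ 2) ^+ 2)).
  apply: le_trans (HCn _ t0); apply: le_fine_prob.
  - exact: (m1 delta (fun I => occ_vec R k I / b n ^+ 2 - 1)).
  - exact: (m1 _ (dev_sum (q n) n (two_values 1 0 k))).
  move=> w /=; rewrite dev_sum_occ mul1r mul0r addr0 => Hw.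
  have := mu_n; set S := \sum_u _; move: (occ_vec R k _) Hw => o Hw Hmu.
  rewrite -ltr_pdivlMr ?exprn_gt0// -[X in _ < _ / X]gtr0_norm ?exprn_gt0//.
  rewrite -normfV -normrM.
  have E : o / b n ^+ 2 - 1 = (o - S) / b n ^+ 2 - (1 - S / (al n)%:R / A).
    rewrite b2; field; by rewrite !gt_eqF.
  rewrite E in Hw; have := ler_normB ((o - S) / b n ^+ 2) (1 - S / (al n)%:R / A); lra.
rewrite le_eqVlt; apply/orP; left; apply/eqP.
have -> : C * (al n)%:R = C / A * b n ^+ 2 by rewrite b2 mulrA divfK// gt_eqF.
by field; rewrite !gt_eqF.
Unshelve. all: by end_near. Qed.

(** Applied to t = R_{n,k} / b^2 and x = b / sqrt(R_{n,k}), it carries the law of large numbers over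
    to the random normalization. *)
Lemma sqrt_ratio_close (t x delta : R) : 0 < x -> x ^+ 2 * t = 1 ->
  `|t - 1| <= delta -> delta <= 2^-1 -> x <= 2 /\ `|x - 1| <= 2 * delta.
Proof.
move=> x0 xt td d2; have d0 := le_trans (normr_ge0 _) td.
move: td; rewrite ler_norml => /andP[t1 t2].
have xx0 : 0 <= x * x by rewrite mulr_ge0 ?(ltW x0).
have lo : 1 <= x * x * (1 + delta) by rewrite -{1}xt expr2; apply: ler_wpM2l => //; lra.
have hi : x * x * (1 - delta) <= 1 by rewrite -{2}xt expr2; apply: ler_wpM2l => //; lra.
split.
  rewrite leNgt; apply/negP => x2; have : 2 * x < x * x by rewrite ltr_pM2r.
  have : x * x * 2^-1 <= x * x * (1 - delta) by apply: ler_wpM2l => //; lra.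
  lra.
rewrite ler_norml; apply/andP; split; rewrite leNgt; apply/negP => h.
  have h1 : x * x * (1 + delta) <= x * (1 + delta).
    by rewrite -mulrA ler_piMl ?mulr_ge0 ?(ltW x0)//; lra.
  have : x * (1 + delta) < (1 - 2 * delta) * (1 + delta) by rewrite ltr_pM2r; lra.
  by have := mulr_ge0 d0 d0; lra.
have h1 : x * (1 - delta) <= x * x * (1 - delta).
  by rewrite ler_wpM2r ?ler_peMl ?(ltW x0)//; lra.
have : (1 + 2 * delta) * (1 - delta) < x * (1 - delta) by rewrite ltr_pM2r; lra.
have : delta * delta <= delta * 2^-1 by rewrite ler_wpM2l.
lra.
Qed.

End scaling.

(** W is the centred numerator over b = sqrt(A alpha(n)), and m is the mean of the numerator. When
    all balls stay among the kept urns and the count o of urns with k balls is positive, Z - W = W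
    (x - 1) + (m / b) x with x = b / sqrt(o), and both terms are small with high probability. *)
Lemma urn_weak_cvg (theta s : R) k (c0 := k%:R - theta) (c1 := - k.+1%:R)
    (A := gint rho k 1 / k`!%:R) :
  (0 < k)%N -> 0 < A -> 0 < s -> has_pint rho (pois_var c0 c1 k) (A * s ^+ 2) ->
  (c0 * fine 'E_P[urn_occ R X n k]%E - k.+1%:R * fine 'E_P[urn_occ R X n k.+1]%E)
    / Num.sqrt (al n)%:R @[n --> \oo] --> (0 : R) ->
  weak_cvg P (fun n w => Num.sqrt (urn_occ R X n k w)
      * ((k%:R * urn_occ R X n k w - k.+1%:R * urn_occ R X n k.+1 w)
         / urn_occ R X n k w - theta)) (normal_prob 0 s).
Proof.
move=> k0 A0 s0 var bias.
pose b n := Num.sqrt (A * (al n)%:R).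
pose g := two_values c0 c1 k.
pose W n w := dev_sum (q n) n g (J n w) / b n.
pose Z n w := Num.sqrt (urn_occ R X n k w)
      * ((k%:R * urn_occ R X n k w - k.+1%:R * urn_occ R X n k.+1 w)
         / urn_occ R X n k w - theta).
pose m n := c0 * (\sum_u binp k n (q n u)) + c1 * (\sum_u binp k.+1 n (q n u)).
(* This is where the bias hypothesis enters. It concerns the full scheme; by the choice of M each
   mean moves by at most 1, which is negligible against b. *)
have m0 : m n / b n @[n --> \oo] --> (0 : R).
  pose be n := (c0 * fine 'E_P[urn_occ R X n k]%E - k.+1%:R * fine 'E_P[urn_occ R X n k.+1]%E)
    / Num.sqrt (al n)%:R.
  apply: (@near_norm_cvg0 _ (fun n => (Num.sqrt A)^-1 * `|be n| + (`|c0| + `|c1|) * (b n)^-1)); last first.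
    rewrite -(addr0 0); apply: cvgD.
      by rewrite -(mulr0 (Num.sqrt A)^-1); apply: cvgM; [exact: cvg_cst|exact/norm_cvg0P].
    rewrite -(mulr0 (`|c0| + `|c1|)); apply: cvgM; first exact: cvg_cst.
    exact: scale_inv_cvg0.
  near=> n; have b0 : 0 < b n by near: n; exact: scale_gt0.
  have rn : 0 <= r n by have [_] := urn_subprob n.
  have := expectation_urn_occ X_law X_indep n k0 rn.
  have := expectation_urn_occ X_law X_indep n (ltn0Sn k) rn.
  rewrite !multE_occ; set e1 := fine _; set e2 := fine _.
  move=> /le_trans/(_ (nr n)) h1 /le_trans/(_ (nr n)) h2.
  have bE : b n = Num.sqrt A * Num.sqrt (al n)%:R by rewrite /b sqrtrM// ltW.
  have -> : (Num.sqrt A)^-1 * `|be n| = `|c0 * e2 + c1 * e1| / b n.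
    rewrite /be normrM normfV (ger0_norm (sqrtr_ge0 (al n)%:R)) bE invfM.
    by rewrite -/e1 -/e2 /c1 mulNr; move: `|_| => N; ring.
  rewrite -mulrDl normrM normfV (gtr0_norm b0) ler_pM2r ?invr_gt0//.
  have -> : m n = c0 * e2 + c1 * e1 - (c0 * (e2 - \sum_u binp k n (q n u))
      + c1 * (e1 - \sum_u binp k.+1 n (q n u))) by rewrite /m; ring.
  apply: le_trans (ler_normB _ _) _; rewrite lerD2l.
  apply: le_trans (ler_normD _ _) _; rewrite !normrM.
  by apply: lerD; rewrite -[leRHS]mulr1; apply: ler_wpM2l.
have [C C0 HC] := prob_dev_sum_gt c0 c1 k0.
have mJ n (F : ('I_(M n) -> nat) -> R) : measurable_fun setT (fun w => F (J n w)).
  exact: (measurable_load_vec X n F).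
have mW n : measurable_fun setT (W n) by exact: (mJ n (fun I => dev_sum (q n) n g I / b n)).
have mZ n : measurable_fun setT (Z n).
  exact: (measurable_urn_occ X n k k.+1
    (fun x y => Num.sqrt x * ((k%:R * x - k.+1%:R * y) / x - theta))).
have tight K : 0 < K -> \forall n \near \oo, fine (P [set w | K < `|W n w|]) <= C / A / K ^+ 2.
  move=> K0; near=> n; have b0 : 0 < b n by near: n; exact: scale_gt0.
  have -> : [set w | K < `|W n w|] = [set w | K * b n < `|dev_sum (q n) n g (J n w)|].
    apply/seteqP; split => w /=;
    by rewrite /W normrM normfV (gtr0_norm b0) ltr_pdivlMr.
  have HCn : forall t : R, 0 < t ->
    fine (P [set w | t < `|dev_sum (q n) n g (J n w)|])
    <= C * (al n)%:R / t ^+ 2 by near: n; exact: HC.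
  apply: le_trans (HCn _ (mulr_gt0 K0 b0)) _.
  have -> : C * (al n)%:R = C / A * b n ^+ 2 by rewrite scale_sqr// mulrA divfK// gt_eqF.
  rewrite le_eqVlt; apply/orP; left; apply/eqP.
  by field; rewrite !gt_eqF.
apply: (@stein_weak_cvg R s d T P W Z (C / A)) => //.
  by move=> f f1 C0' C1 C2 H; exact: (stein_urn_cvg A0 k0 var H).
move=> eta eta0; apply/cvgr0Pnorm_le => e e0.
(* With this K the tail C / (A K^2) of W is at most e/4; the two other exceptional events get e/4
   each. *)
pose K : R := 1 + 4 * C / A / e.
have KC : 0 <= 4 * C / A / e by apply/ltW; apply: divr_gt0 => //; apply: divr_gt0 => //; exact: mulr_gt0.
have K1 : 1 <= K by rewrite /K lerDl.
have K0 : 0 < K by exact: lt_le_trans K1.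
(* Then |W| |x - 1| <= K (2 delta) <= eta/2, while (m / b) x takes the other half because x <= 2. *)
pose delta := Num.min 2^-1 (eta / (4 * K)).
have delta0 : 0 < delta by rewrite lt_min invr_gt0 ltr0n divr_gt0// mulr_gt0.
have delta2 : delta <= 2^-1 by rewrite ge_min lexx.
have deltaK : 4 * K * delta <= eta.
  by rewrite mulrC -ler_pdivlMr ?mulr_gt0// ge_min lexx orbT.
have e4 : 0 < e / 4 by rewrite divr_gt0.
have lln := urn_lln A0 k0 (erefl A) delta0.
have inv0 : (n%:R : R)^-1 @[n --> \oo] --> (0 : R) by exact: inv_natR_cvg.
near=> n.
have b0 : 0 < b n by near: n; exact: scale_gt0.
have n0 : (0 < n)%N by near: n; exact: nbhs_infty_gt.
have mb : `|m n / b n| <= eta / 4.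
  by near: n; move/cvgr0Pnorm_le : m0; apply; rewrite divr_gt0.
have P1 : fine (P [set w | K < `|W n w|]) <= C / A / K ^+ 2 by near: n; exact: tight.
have P1' : C / A / K ^+ 2 <= e / 4.
  rewrite ler_pdivrMr ?exprn_gt0//; apply: (@le_trans _ _ (e / 4 * K)).
    rewrite /K mulrDr mulr1 (_ : e / 4 * _ = C / A); last by field; rewrite !gt_eqF.
    by rewrite lerDr divr_ge0// ltW.
  by rewrite ler_pM2l ?divr_gt0// expr2 ler_peMr// ltW.
have P2 : fine (P [set w | delta < `|occ_vec R k (J n w) / b n ^+ 2 - 1|]) <= e / 4.
  by apply: le_trans (ler_norm _) _; near: n; move/cvgr0Pnorm_le : lln; exact.
have P3 : fine (P (some_outside X (M n) n)) <= e / 4.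
  apply: le_trans (prob_some_outside X_law (M n) n) _.
  have nR : 0 < n%:R :> R by rewrite ltr0n.
  apply: (@le_trans _ _ n%:R^-1).
    by rewrite -[leRHS]mul1r ler_pdivlMr// mulrC.
  apply: le_trans (ler_norm _) _; near: n.
  by move/cvgr0Pnorm_le : inv0; exact.
have mS1 : measurable [set w | K < `|W n w|].
  by apply: (@measurable_set_lt _ _ _ (fun=> K) (fun w => `|W n w|)) => //; exact: measurableT_comp.
have mS2 : measurable [set w | delta < `|occ_vec R k (J n w) / b n ^+ 2 - 1|].
  apply: (@measurable_set_lt _ _ _ (fun=> delta) (fun w => `|occ_vec R k (J n w) / b n ^+ 2 - 1|)) => //.
  by apply: measurableT_comp => //; exact: (mJ n (fun I => occ_vec R k I / b n ^+ 2 - 1)).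
have mS3 := measurable_some_outside X (M n) n.
have mS : measurable [set w | eta < `|Z n w - W n w|].
  apply: (@measurable_set_lt _ _ _ (fun=> eta) (fun w => `|Z n w - W n w|)) => //.
  by apply: measurableT_comp => //; exact: measurable_funB.
rewrite ger0_norm; last exact/fine_ge0/measure_ge0.
apply: (@le_trans _ _ (fine (P ([set w | K < `|W n w|] `|`
  ([set w | delta < `|occ_vec R k (J n w) / b n ^+ 2 - 1|] `|` some_outside X (M n) n))))); last first.
  apply: le_trans (fine_prob_setU P mS1 (measurableU _ _ mS2 mS3)) _.
  have := fine_prob_setU P mS2 mS3; lra.
apply: le_fine_prob => //; first by apply: measurableU => //; exact: measurableU.
move=> w /= Hw; apply: contrapT => /not_orP[/negP hK /not_orP[/negP hd good]].
rewrite -leNgt in hK; rewrite -leNgt in hd.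
move: Hw; rewrite /Z (urn_occ_load_vec k0 good) (urn_occ_load_vec (ltn0Sn k) good).
set o := occ_vec R k _ in hd *; set o' := occ_vec R k.+1 _.
have b2 : 0 < b n ^+ 2 by rewrite exprn_gt0.
have o0 : 0 < o.
  have : 0 < o / b n ^+ 2 by move: hd; rewrite ler_norml => /andP[h _]; lra.
  by rewrite pmulr_lgt0// invr_gt0.
have so0 : 0 < Num.sqrt o by rewrite sqrtr_gt0.
pose x := b n / Num.sqrt o.
have x0 : 0 < x by rewrite divr_gt0.
have xt : x ^+ 2 * (o / b n ^+ 2) = 1.
  by rewrite /x exprMn exprVn (sqr_sqrtr (ltW o0)); field; rewrite !gt_eqF.
have [x2 x1] := sqrt_ratio_close x0 xt hd delta2.
have -> : Num.sqrt o * ((k%:R * o - k.+1%:R * o') / o - theta) = (c0 * o + c1 * o') / Num.sqrt o.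
  have oE : o = Num.sqrt o * Num.sqrt o by rewrite -expr2 sqr_sqrtr// ltW.
  rewrite /c0 /c1; move: (Num.sqrt o) so0 oE => y y0 ->.
  by field; rewrite gt_eqF.
have -> : (c0 * o + c1 * o') / Num.sqrt o - W n w = W n w * (x - 1) + m n / b n * x.
  rewrite /W dev_sum_occ /x /m -/o -/o'; field; rewrite !gt_eqF//.
rewrite ltNge => /negP; apply.
apply: le_trans (ler_normD _ _) _; rewrite [`|W n w * _|]normrM [`|m n / b n * x|]normrM (gtr0_norm x0).
have q1 : `|W n w| * `|x - 1| <= K * (2 * delta) by exact: ler_pM.
have q2 : `|m n / b n| * x <= eta / 4 * 2 by apply: ler_pM => //; exact: ltW.
lra.
Unshelve. all: by end_near. Qed.

End urn_clt.

(** * From the hypotheses on the urn probabilities to the theorem *)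

Lemma psum_cvg1 (R : realType) (p : nat -> R) : (forall i, (0 < i)%N -> 0 < p i) ->
  (\sum_(1 <= i <oo) (p i)%:E = 1)%E -> \sum_(i < N) p i.+1 @[N --> \oo] --> (1 : R).
Proof.
move=> p0 psum.
have : (\sum_(1 <= i < n) (p i)%:E)%E @[n --> \oo] --> (1 : R)%:E.
  rewrite -psum; apply: is_cvg_nneseries => i i1 _.
  by rewrite lee_fin ltW// p0.
move/fine_cvg => H.
have S : N.+1 @[N --> \oo] --> \oo.
  by apply/cvgnyPge => K; exists K => // n /=; exact: leqW.
have := cvg_comp _ _ S H; apply: cvg_trans; apply: near_eq_cvg; near=> N => /=.
by rewrite sumEFin/= big_add1/= big_mkord.
Unshelve. all: by end_near. Qed.

Lemma rv_seq_ratio (R : realType) (p : nat -> R) (rho : R) (L : R -> R) :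
  (forall i, (0 < i)%N -> 0 < p i) -> slowly_varying L ->
  (forall i, (1 <= i)%N -> p i = i%:R `^ (- rho) * L i%:R) ->
  forall a, (0 < a)%N -> p (a * i)%N / p i @[i --> \oo] --> a%:R `^ (- rho).
Proof.
move=> p0 [x0 [_ _ Lsv]] pE a a0.
have aR : 0 < a%:R :> R by rewrite ltr0n.
have noo : (n%:R : R) @[n --> \oo] --> +oo.
  apply/cvgryPge => K; near=> n; have /ltW/le_trans := truncnS_gt K; apply.
  by rewrite ler_nat; near: n; exact: nbhs_infty_ge.
have H : L (a%:R * n%:R) / L n%:R @[n --> \oo] --> (1 : R) by exact: (cvg_comp _ _ noo (Lsv _ aR)).
have H2 : a%:R `^ (- rho) * (L (a%:R * n%:R) / L n%:R) @[n --> \oo] --> a%:R `^ (- rho).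
  by rewrite -[X in _ --> X]mulr1; apply: cvgM; [exact: cvg_cst|exact: H].
apply: cvg_trans H2; apply: near_eq_cvg; near=> n => /=.
have n0 : (0 < n)%N by near: n; exact: nbhs_infty_gt.
have := p0 n n0; rewrite !pE ?muln_gt0 ?a0// natrM powRM// => pn.
have Ln : L n%:R != 0 by apply: contraTneq pn => ->; rewrite mulr0 ltxx.
have nn : n%:R `^ (- rho) != 0 by rewrite gt_eqF// powR_gt0// ltr0n.
by field; rewrite Ln nn.
Unshelve. all: by end_near. Qed.

Theorem theorem3 (R : realType) (d : measure_display) (T : measurableType d)
    (P : probability T R)
    (p : nat -> R)
    (p_gt0 : forall i, (1 <= i)%N -> 0 < p i)
    (p_noninc : forall i, (1 <= i)%N -> p i.+1 <= p i)
    (p_sum1 : (\sum_(1 <= i <oo) (p i)%:E = 1)%E)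
    (X : nat -> {RV P >-> nat})
    (X_law : forall j i, (1 <= i)%N -> P (X j @^-1` [set i]) = (p i)%:E)
    (X_indep : mutually_independent X)
    (theta : R) (theta_gt0 : 0 < theta) (theta_lt1 : theta < 1)
    (L0 : R -> R -> R)
    (L0_sv : slowly_varying (fun x => L0 x theta))
    (p_rv : forall i, (1 <= i)%N ->
       p i = i%:R `^ (- theta^-1) * L0 i%:R theta)
    (k : nat) (k_ge1 : (1 <= k)%N)
    (bias : ((k%:R - theta) * fine ('E_P[urn_occ R X n k])%E
              - k.+1%:R * fine ('E_P[urn_occ R X n k.+1])%E)
            / Num.sqrt (urn_alpha p n%:R)%:R @[n --> \oo] --> (0 : R)) :
  weak_cvg P
    (fun (n : nat) (w : T) =>
       Num.sqrt (urn_occ R X n k w)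
       * ((k%:R * urn_occ R X n k w - k.+1%:R * urn_occ R X n k.+1 w)
          / urn_occ R X n k w - theta))
    (normal_prob 0 (Num.sqrt (urn_sigma2 theta k))).
Proof.
have psum1 := psum_cvg1 p_gt0 p_sum1; have psum_le := psum_le1 p_gt0 psum1.
have rho1 : 1 < theta^-1 by rewrite invf_gt1.
have prv := rv_seq_ratio p_gt0 L0_sv p_rv.
(* By monotonicity i p_i is at most p_1 + ... + p_i, hence at most 1. *)
have pinv i : (0 < i)%N -> p i <= i%:R^-1.
  move=> i0; rewrite -[leRHS]mul1r ler_pdivlMr ?ltr0n// mulrC.
  apply: le_trans (psum_le i); rewrite -[i in i%:R]card_ord mulr_natl -sumr_const.
  apply: ler_sum => u _; case: u => u /= ui.
  have ni m l : (0 < m)%N -> p (m + l)%N <= p m.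
    move=> m0; elim: l => [|l IH]; first by rewrite addn0.
    by rewrite addnS (le_trans _ IH)// p_noninc// ltn_addr.
  by rewrite -(subnKC ui); exact: ni.
have p1 : p 1 < 1.
  have := psum_le 2; rewrite !big_ord_recr big_ord0/= add0r => h.
  by have := p_gt0 2 isT; lra.
(* The truncation level: the mass beyond urn M n is at most 1/n^2. *)
have [M MP] : {M : nat -> nat & forall n, (n * n <= M n)%N /\
    n%:R * (n%:R * (1 - \sum_(u < M n) p u.+1)) <= 1}.
  apply: (@choice _ _ (fun n m => (n * n <= m)%N /\
    n%:R * (n%:R * (1 - \sum_(u < m) p u.+1)) <= 1)) => n.
  have [->|n0] := posnP n; first by exists 0%N; rewrite !mul0r.
  have nn0 : 0 < n%:R * n%:R :> R by rewrite mulr_gt0 ?ltr0n.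
  have : \forall m \near \oo, (n * n <= m)%N /\
    n%:R * (n%:R * (1 - \sum_(u < m) p u.+1)) <= 1.
    near=> m; split; first by near: m; exact: nbhs_infty_ge.
    rewrite mulrA -ler_pdivlMl// mulr1; apply: le_trans (ler_norm _) _; near: m.
    by move/cvgrPdist_le : psum1; apply; rewrite invr_gt0.
  by move=> /filter_ex[m Hm]; exists m.
have nM n := (MP n).1; have nr n := (MP n).2.
pose A : R := gint theta^-1 k 1 / k`!%:R.
have A0 : 0 < A by rewrite divr_gt0 ?gint_gt0// ltr0n fact_gt0.
have var := has_pint_var rho1 (k%:R - theta) (- k.+1%:R) k_ge1.
rewrite (two_values_var theta_gt0 theta_lt1 k_ge1) in var.
have kt : 0 < k%:R - theta by rewrite subr_gt0 (lt_le_trans theta_lt1)// ler1n.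
(* A sigma_k^2 is the integral of [pois_var], which is bounded below by c0^2 [pois k x] e^(-x), a
   positive multiple of x^k e^(-2x); here c0 = k - theta is not 0. *)
have sigma0 : 0 < urn_sigma2 theta k.
  rewrite -(pmulr_rgt0 _ A0).
  apply: (@has_pint_gt0 R theta^-1 rho1 _ _ k ((k%:R - theta) ^+ 2 / k`!%:R) var k_ge1).
    by rewrite divr_gt0 ?exprn_gt0// ltr0n fact_gt0.
  move=> x x0; apply: le_trans (pois_var_ge _ _ k_ge1 x0).
  rewrite /pois (_ : - (2%:R * x) = - x + - x); last by ring.
  by rewrite expRD le_eqVlt; apply/orP; left; apply/eqP; ring.
apply: (urn_weak_cvg X_law X_indep p_gt0 p_noninc pinv prv rho1 nM psum1 p1 nr k_ge1 A0) => //.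
- by rewrite sqrtr_gt0.
- by rewrite sqr_sqrtr// ltW.
Unshelve. all: by end_near. Qed.
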